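(* Let $L>0$ and let $(\phi_0,\phi_1)\in H^3_{per,m}\times H^2_{per,m}$. There exist $t_{\max}>0$ and a unique local (strong) solution $\phi$ of the Cauchy problem $$\phi_{tt}-\phi_{xx}-\phi+\phi^3-\frac1L\int_0^L\phi^3\,dx=0\ \text{ in }[0,L]\times(0,t_{\max}),\qquad \phi(x,0)=\phi_0(x),\quad \phi_t(x,0)=\phi_1(x)\ \text{ in }[0,L],$$ satisfying $$(\phi,\phi_t)\in C([0,t_{\max}),H^3_{per,m}\times H^2_{per,m})\cap C^1([0,t_{\max}),H^2_{per,m}\times L^2_{per,m}).$$
   Context: $L^2_{per}$ is the space of real square-integrable $L$-periodic functions; for $s\ge0$, $H^s_{per}$ is the Sobolev space of real $L$-periodic functions with $\|f\|_{H^s_{per}}^2=L\sum_{n\in\mathbb{Z}}(1+n^2)^s|\hat f(n)|^2<\infty$ ($\hat f(n)$ the Fourier coefficients); $H^s_{per,m}=\{f\in H^s_{per}:\int_0^Lf\,dx=0\}$ and $L^2_{per,m}=H^0_{per,m}$. A strong solution is a function with the stated regularity for which the equation holds as an identity in $L^2_{per,m}$ at each time and the initial conditions hold. *)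

(* Defs.v *)
From mathcomp Require Import all_boot all_order all_algebra.
From mathcomp Require Import complex.
From mathcomp Require Import all_classical all_reals all_analysis.

Set Implicit Arguments.
Unset Strict Implicit.
Unset Printing Implicit Defensive.

Import Order.TTheory GRing.Theory Num.Theory.
Import numFieldNormedType.Exports.

Local Open Scope classical_set_scope.
Local Open Scope ring_scope.

(* Elements of the spaces below are represented by functions R -> R; two
   representatives stand for the same element when they are [L2eq]. *)
Definition L2per (R : realType) (L : R) : set (R -> R) :=
  [set f : R -> R | measurable_fun setT f /\ periodic f L /\
           (@lebesgue_measure R).-integrable `[0, L]
             (fun x => (f x ^+ 2)%:E)].

Definition L2eq (R : realType) (L : R) (f g : R -> R) : Prop :=
  {ae @lebesgue_measure R, forall x, `[0, L]%classic x -> f x = g x}.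

(* 1/L * int_0^L f(x) exp(-2 pi i n x / L) dx *)
Definition fourier (R : realType) (L : R) (f : R -> R) (n : int) : R[i] :=
  Complex
    (L^-1 * \int[@lebesgue_measure R]_(x in `[0, L])
              (f x * cos (2 * pi * n%:~R * x / L)))
    (- (L^-1 * \int[@lebesgue_measure R]_(x in `[0, L])
                 (f x * sin (2 * pi * n%:~R * x / L)))).

Definition Hs_sqnorm (R : realType) (L s : R) (f : R -> R) : \bar R :=
  (L%:E * \esum_(n in [set: int])
     ((1 + n%:~R ^+ 2) `^ s * Normc.normc (fourier L f n) ^+ 2)%:E)%E.

Definition Hs_norm (R : realType) (L s : R) (f : R -> R) : \bar R :=
  sqrte (Hs_sqnorm L s f).

Definition Hs_per (R : realType) (L s : R) : set (R -> R) :=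
  [set f : R -> R | L2per L f /\ (Hs_sqnorm L s f < +oo)%E].

Definition Hs_per_m (R : realType) (L s : R) : set (R -> R) :=
  [set f : R -> R | Hs_per L s f /\ \int[@lebesgue_measure R]_(x in `[0, L]) f x = 0].

(* A curve u : R -> (R -> R) maps a time t to a function u t of x; only its
   values on [0, T[ matter. *)
Definition C0_Hs (R : realType) (L s T : R) (u : R -> R -> R) : Prop :=
  forall t : R, `[0, T[%classic t ->
    Hs_per_m L s (u t) /\
    Hs_norm L s (fun x => u t' x - u t x)
      @[t' --> within `[0, T[%classic (nbhs t)] --> 0%E.

(* u is in C^1([0, T[, H^s_{per,m}) with time derivative v *)
Definition C1_Hs (R : realType) (L s T : R) (u v : R -> R -> R) : Prop :=
  [/\ C0_Hs L s T u, C0_Hs L s T v &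
      forall t : R, `[0, T[%classic t ->
        Hs_norm L s (fun x => (u t' x - u t x) / (t' - t) - v t x)
          @[t' --> within `[0, T[%classic t^'] --> 0%E].

Definition test_function (R : realType) (L : R) (zeta : R -> R) : Prop :=
  periodic zeta L /\ forall k x, derivable (derive1n k zeta) x 1.

(* g is the k-th distributional derivative of the L-periodic function f *)
Definition weak_deriv (R : realType) (L : R) (k : nat) (f g : R -> R) : Prop :=
  L2per L g /\
  forall zeta : R -> R, test_function L zeta ->
    \int[@lebesgue_measure R]_(x in `[0, L]) (f x * derive1n k zeta x) =
    (- 1) ^+ k * \int[@lebesgue_measure R]_(x in `[0, L]) (g x * zeta x).

Definition strong_solution (R : realType) (L T : R) (phi0 phi1 : R -> R)
    (phi : R -> R -> R) : Prop :=
  exists phi_t phi_tt : R -> R -> R,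
    [/\ C0_Hs L 3 T phi /\ C0_Hs L 2 T phi_t,
        C1_Hs L 2 T phi phi_t /\ C1_Hs L 0 T phi_t phi_tt,
        forall t : R, `]0, T[%classic t ->
          exists2 phi_xx : R -> R, weak_deriv L 2 (phi t) phi_xx &
            L2eq L
              (fun x => phi_tt t x - phi_xx x - phi t x + phi t x ^+ 3
                 - L^-1 * \int[@lebesgue_measure R]_(y in `[0, L])
                            (phi t y ^+ 3))
              (fun=> 0) &
        L2eq L (phi 0) phi0 /\ L2eq L (phi_t 0) phi1].

(* Main.v *)
Require Import Defs.
From mathcomp Require Import all_boot all_order all_algebra.
From mathcomp Require Import complex ring lra zify.
From mathcomp Require Import all_classical all_reals all_analysis.
From mathcomp Require Import measurable_realfun.

(* Expand in the real orthonormal basis [cas n x = cos (k_n x) + sin (k_n x)],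
   [k_n = 2 pi n / L], [n : int] (Hartley series); [hart f n] are the
   coefficients, and [hart f n ^+ 2 + hart f (- n) ^+ 2] is twice the squared
   modulus of the Fourier coefficient.  The equation becomes
   [y_n'' + k_n^2 y_n = y_n - (phi^3)_n] for [n != 0].

   Existence: Picard iteration for Duhamel's formula, in the norm
   [sum_n (1 + n^2) sup_t |y_n t|].  It is finite for the free evolution of
   H^3 x H^2 data by Cauchy-Schwarz, it makes pointwise products continuous
   because the weight is submultiplicative up to a factor, and since the
   supremum is inside the sum every continuity and differentiability statement
   in H^s reduces to single coefficients by dominated convergence.  The forced
   part gains one derivative, whence the H^3 x H^2 regularity.

   Uniqueness: the difference of two solutions satisfies an energy inequality
   in the l^2 norm of the coefficients, where the cube is Lipschitz on bounded
   sets by Bessel and Parseval; an exponential weight in time makes the estimate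
   a contraction on the whole interval. *)

Set Implicit Arguments.
Unset Strict Implicit.
Unset Printing Implicit Defensive.

Import Order.TTheory GRing.Theory Num.Theory.
Import numFieldNormedType.Exports.

Local Open Scope classical_set_scope.
Local Open Scope ring_scope.

(** * Means over a period *)

(** The nonlocal term is the coefficient of index [0] of the cube: subtracting it removes exactly
    that mode. So the equation splits into oscillators for [n != 0], while the zero mode stays at
    zero, and every division by [freq n] is legitimate. The two halves of the theorem live in
    different classes. The iteration converges where the supremum in time stands inside the sum; an
    arbitrary strong solution is merely continuous into H^3 and need not have such a majorant. The
    contraction therefore says nothing about a competitor, and uniqueness has its own argument, run
    on finitely many modes at a time and coupled only through an l^2 Lipschitz bound for the cube.
    Functions are real, so a real basis keeps all coefficients and estimates in [R]; the price is
    that multiplication by one basis function spreads a coefficient over four indices where complex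
    exponentials would need one. Identities between functions are checked on coefficients and
    brought back by injectivity of the coefficient map on integrable functions. *)

Lemma ae_mono (R : realType) (P Q : R -> Prop) : (forall x, P x -> Q x) ->
  {ae @lebesgue_measure R, forall x, P x} -> {ae @lebesgue_measure R, forall x, Q x}.
Proof.
move=> PQ; apply: filterS; last exact: PQ.
exact: (ae_filter_ringOfSetsType (@lebesgue_measure R)).
Qed.

Lemma ae_mono2 (R : realType) (P Q S : R -> Prop) : (forall x, P x -> Q x -> S x) ->
  {ae @lebesgue_measure R, forall x, P x} -> {ae @lebesgue_measure R, forall x, Q x} ->
  {ae @lebesgue_measure R, forall x, S x}.
Proof.
move=> PQ; apply: filterS2; last exact: PQ.
exact: (ae_filter_ringOfSetsType (@lebesgue_measure R)).
Qed.

Lemma L2eqW (R : realType) (L : R) (f g f' g' : R -> R) :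
  (forall x, f x = g x -> f' x = g' x) -> L2eq L f g -> L2eq L f' g'.
Proof.
move=> fg; apply: (@ae_mono R (fun x => `[0, L]%classic x -> f x = g x)
  (fun x => `[0, L]%classic x -> f' x = g' x)) => x E /E; exact: fg.
Qed.

Section average.
Variables (R : realType) (L : R).
Hypothesis L_gt0 : 0 < L.
Local Notation mu := (@lebesgue_measure R).
Implicit Types f g b : R -> R.

Definition itg f := mu.-integrable `[0, L] (EFin \o f).

Definition avg f := L^-1 * \int[mu]_(x in `[0, L]) f x.

Lemma itg_mfun f : measurable_fun setT f -> measurable_fun `[0, L] f.
Proof. by move=> mf; exact: measurable_funS mf. Qed.

Lemma itg_cst (c : R) : itg (cst c).
Proof.
apply/integrableP; split; first exact/measurable_EFinP/measurable_cst.
rewrite (eq_integral (cst `|c|%:E))// integral_cst//=.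
by rewrite lebesgue_measure_itv/= lte_fin L_gt0 -EFinD -EFinM ltry.
Qed.

Lemma itg_le f g : measurable_fun `[0, L] f ->
  (forall x, `|f x| <= g x) -> itg g -> itg f.
Proof.
move=> mf fg ig; apply: le_integrable ig => //.
- exact/measurable_EFinP.
- by move=> x _ /=; rewrite lee_fin (le_trans (fg x))// ler_norm.
Qed.

Lemma itg_bounded f (M : R) : measurable_fun setT f ->
  (forall x, `|f x| <= M) -> itg f.
Proof. by move=> mf fM; exact: itg_le (itg_mfun mf) fM (itg_cst M). Qed.

Lemma itgD f g : itg f -> itg g -> itg (fun x => f x + g x).
Proof. by move=> i1 i2; apply: (integrableD _ i1 i2). Qed.

Lemma itgZ (c : R) f : itg f -> itg (fun x => c * f x).
Proof. by move=> i1; apply: (integrableZl _ c i1). Qed.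

Lemma itgB f g : itg f -> itg g -> itg (fun x => f x - g x).
Proof. by move=> i1 i2; apply: (integrableB _ i1 i2). Qed.

Lemma itg_norm f : itg f -> itg (fun x => `|f x|).
Proof. by move=> i1; apply: (integrable_norm i1). Qed.

Lemma itg_meas f : itg f -> measurable_fun `[0, L] f.
Proof. by move=> /integrableP[/measurable_EFinP]. Qed.

Lemma itgM f b (M : R) : itg f -> measurable_fun setT b ->
  (forall x, `|b x| <= M) -> itg (fun x => f x * b x).
Proof.
move=> i1 mb bM; apply: (@itg_le _ (fun x => M * `|f x|)).
- apply: measurable_funM; [exact: itg_meas|exact: itg_mfun].
- by move=> x; rewrite normrM mulrC ler_wpM2r.
- exact/itgZ/itg_norm.
Qed.

Lemma itg_sum (I : Type) (s : seq I) (F : I -> R -> R) :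
  (forall i, itg (F i)) -> itg (fun x => \sum_(i <- s) F i x).
Proof.
move=> iF; elim: s => [|i s ih].
  by under eq_fun do rewrite big_nil; exact: itg_cst.
by under eq_fun do rewrite big_cons; exact: itgD.
Qed.

Lemma avg_cst (c : R) : avg (cst c) = c.
Proof.
rewrite /avg Rintegral_cst//= lebesgue_measure_itv/= lte_fin L_gt0/= subr0.
by rewrite mulrC mulfK// gt_eqF.
Qed.

Lemma avgD f g : itg f -> itg g -> avg (fun x => f x + g x) = avg f + avg g.
Proof. by move=> i1 i2; rewrite /avg RintegralD// mulrDr. Qed.

Lemma avgB f g : itg f -> itg g -> avg (fun x => f x - g x) = avg f - avg g.
Proof. by move=> i1 i2; rewrite /avg RintegralB// mulrBr. Qed.

Lemma avgZ (c : R) f : itg f -> avg (fun x => c * f x) = c * avg f.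
Proof. by move=> i1; rewrite /avg RintegralZl// mulrCA. Qed.

Lemma avg_sum (I : Type) (s : seq I) (F : I -> R -> R) :
  (forall i, itg (F i)) ->
  avg (fun x => \sum_(i <- s) F i x) = \sum_(i <- s) avg (F i).
Proof.
move=> iF; elim: s => [|i s ih].
  by under eq_fun do rewrite big_nil; rewrite big_nil avg_cst.
under eq_fun do rewrite big_cons.
by rewrite avgD//; [rewrite ih big_cons|exact: itg_sum].
Qed.

Lemma le_avg f g : itg f -> itg g -> (forall x, f x <= g x) -> avg f <= avg g.
Proof.
move=> i1 i2 fg; rewrite /avg ler_pM2l ?invr_gt0//; exact: le_Rintegral.
Qed.

Lemma norm_avg f : itg f -> `|avg f| <= avg (fun x => `|f x|).
Proof.
move=> i1; rewrite /avg normrM gtr0_norm ?invr_gt0// ler_pM2l ?invr_gt0//.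
exact: le_normr_Rintegral.
Qed.

Lemma norm_avg_le f (M : R) : measurable_fun setT f -> (forall x, `|f x| <= M) ->
  `|avg f| <= M.
Proof.
move=> mf fM; have i1 := itg_bounded mf fM.
rewrite -[leRHS]avg_cst; apply: le_trans (norm_avg i1) _.
by apply: le_avg => //; [exact: itg_norm|exact: itg_cst].
Qed.

Lemma avg_ge0 f : (forall x, 0 <= f x) -> 0 <= avg f.
Proof. by move=> f0; apply: mulr_ge0; [rewrite invr_ge0 ltW|apply: Rintegral_ge0]. Qed.

Lemma eq_avg f g : f =1 g -> avg f = avg g.
Proof. by move=> fg; congr avg; exact/funext. Qed.

Lemma ae_eq_avg f g : measurable_fun `[0, L] f -> measurable_fun `[0, L] g ->
  L2eq L f g -> avg f = avg g.
Proof.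
move=> mf mg fg; rewrite /avg; congr (_ * fine _).
apply: ae_eq_integral => //; try exact/measurable_EFinP.
by apply: ae_mono fg => x fg xD /=; rewrite fg.
Qed.

Lemma L2per_mD f : L2per L f -> measurable_fun `[0, L] f.
Proof. by move=> Lf; apply: itg_mfun; case: Lf. Qed.

Lemma L2per_itg_sqr f : L2per L f -> itg (fun x => f x ^+ 2).
Proof. by case=> _ []. Qed.

Lemma L2per_itg f : L2per L f -> itg f.
Proof.
move=> Lf; apply: (@itg_le _ (fun x => 1 + f x ^+ 2)).
- exact: L2per_mD.
- by move=> x; rewrite ler_norml; apply/andP; split; nra.
- by apply: itgD; [exact: itg_cst|exact: L2per_itg_sqr].
Qed.

Lemma L2per_bounded f (M : R) : measurable_fun setT f -> periodic f L ->
  (forall x, `|f x| <= M) -> L2per L f.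
Proof.
move=> mf pf fM; split=> //; split=> //.
apply: (@itg_bounded (fun x => f x ^+ 2) (M ^+ 2)).
- exact: measurable_funX.
- by move=> x; rewrite normrX lerXn2r// nnegrE (le_trans _ (fM x)).
Qed.

End average.

(** * The Hartley basis *)

Section hartley.
Variables (R : realType) (L : R).
Hypothesis L_gt0 : 0 < L.
Implicit Types f g b : R -> R.
Local Notation avg := (avg L).
Local Notation itg := (itg L).

Definition freq (n : int) : R := 2 * pi * n%:~R / L.

Definition cas (n : int) (x : R) : R := cos (freq n * x) + sin (freq n * x).

Definition hart f (n : int) : R := avg (fun x => f x * cas n x).

Lemma freqD m n : freq (m + n) = freq m + freq n.
Proof. by rewrite /freq intrD mulrDr mulrDl. Qed.

Lemma freqN n : freq (- n) = - freq n.
Proof. by rewrite /freq mulrNz mulrN mulNr. Qed.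

Lemma freqB m n : freq (m - n) = freq m - freq n.
Proof. by rewrite freqD freqN. Qed.

Lemma freq0 : freq 0 = 0.
Proof. by rewrite /freq mulr0 mul0r. Qed.

Lemma freq_eq0 n : (freq n == 0) = (n == 0).
Proof.
rewrite /freq !mulf_eq0 invr_eq0 (gt_eqF L_gt0) intr_eq0 (gt_eqF (pi_gt0 R)).
by rewrite pnatr_eq0 /= orbF.
Qed.

Lemma freqE n : freq n = freq 1 * n%:~R.
Proof. by rewrite /freq; ring. Qed.

Lemma freq1_gt0 : 0 < freq 1.
Proof. by rewrite /freq divr_gt0// mulr1 mulr_gt0// pi_gt0. Qed.

Lemma freqL n : freq n * L = 2 * pi * n%:~R.
Proof. by rewrite /freq mulfVK// gt_eqF. Qed.

Lemma cosD2pin (x : R) (n : int) : cos (x + 2 * pi * n%:~R) = cos x.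
Proof.
have E (m : nat) y : cos (y + 2 * pi * m%:R) = cos y :> R.
  have -> : y + 2 * pi * m%:R = y + (pi *+ 2) *+ m by ring.
  by rewrite periodicn//; exact: cosD2pi.
case: n => m; first exact: E.
by rewrite NegzE mulrNz mulrN -(E m.+1) -addrA addNr addr0.
Qed.

Lemma sinD2pin (x : R) (n : int) : sin (x + 2 * pi * n%:~R) = sin x.
Proof.
have E (m : nat) y : sin (y + 2 * pi * m%:R) = sin y :> R.
  have -> : y + 2 * pi * m%:R = y + (pi *+ 2) *+ m by ring.
  by rewrite periodicn//; exact: sinD2pi.
case: n => m; first exact: E.
by rewrite NegzE mulrNz mulrN -(E m.+1) -addrA addNr addr0.
Qed.

Lemma cas_periodic n : periodic (cas n) L.
Proof. by move=> x; rewrite /cas mulrDr freqL cosD2pin sinD2pin. Qed.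

Lemma cas0 x : cas 0 x = 1.
Proof. by rewrite /cas freq0 mul0r cos0 sin0 addr0. Qed.

Lemma is_derive_cos_lin (c x : R) :
  is_derive x 1 (fun y => cos (c * y)) (- c * sin (c * x)).
Proof. by apply: is_derive_eq; rewrite /GRing.scale/=; ring. Qed.

Lemma is_derive_sin_lin (c x : R) :
  is_derive x 1 (fun y => sin (c * y)) (c * cos (c * x)).
Proof. by apply: is_derive_eq; rewrite /GRing.scale/=; ring. Qed.

Lemma is_derive_continuous (f df : R -> R) :
  (forall x, is_derive x (1 : R) f (df x)) -> continuous f.
Proof.
by move=> h x; apply/differentiable_continuous/derivable1_diffP; have [] := h x.
Qed.

Lemma cos_lin_continuous (c : R) : continuous (fun y => cos (c * y)).
Proof. exact: is_derive_continuous (is_derive_cos_lin c). Qed.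

Lemma sin_lin_continuous (c : R) : continuous (fun y => sin (c * y)).
Proof. exact: is_derive_continuous (is_derive_sin_lin c). Qed.

Lemma cas_continuous n : continuous (cas n).
Proof.
by move=> x; apply: cvgD; [exact: cos_lin_continuous|exact: sin_lin_continuous].
Qed.

Lemma norm_cas n x : `|cas n x| <= 2.
Proof. by rewrite (le_trans (ler_normD _ _))// lerD// ?cos_max ?sin_max. Qed.

Lemma continuous_mfun f : continuous f -> measurable_fun setT f.
Proof. exact: continuous_measurable_fun. Qed.

Lemma measurable_cas n : measurable_fun setT (cas n).
Proof. by apply: continuous_mfun; exact: cas_continuous. Qed.

Lemma measurable_cos_lin (c : R) : measurable_fun setT (fun x => cos (c * x)).
Proof. by apply: continuous_mfun; exact: cos_lin_continuous. Qed.

Lemma measurable_sin_lin (c : R) : measurable_fun setT (fun x => sin (c * x)).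
Proof. by apply: continuous_mfun; exact: sin_lin_continuous. Qed.

Lemma itg_cas n : itg (cas n).
Proof. exact: itg_bounded (measurable_cas n) (norm_cas n). Qed.

Lemma itg_mul_cas f n : itg f -> itg (fun x => f x * cas n x).
Proof. by move=> i1; apply: itgM i1 (measurable_cas n) (norm_cas n). Qed.

Lemma itg_mul_cos f (c : R) : itg f -> itg (fun x => f x * cos (c * x)).
Proof. by move=> i1; apply: itgM i1 (measurable_cos_lin c) (fun=> cos_max _). Qed.

Lemma itg_mul_sin f (c : R) : itg f -> itg (fun x => f x * sin (c * x)).
Proof. by move=> i1; apply: itgM i1 (measurable_sin_lin c) (fun=> sin_max _). Qed.

Lemma avg_FTC (F f : R -> R) : (forall x, is_derive x (1 : R) F (f x)) ->
  continuous f -> avg f = L^-1 * (F L - F 0).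
Proof.
move=> Ff cf; have cF := is_derive_continuous Ff.
rewrite /avg /Rintegral (continuous_FTC2 (F := F))//.
- exact: continuous_subspaceT.
- split; [by move=> x _; have [] := Ff x| |].
  + exact/cvg_at_right_filter/cF.
  + exact/cvg_at_left_filter/cF.
- by move=> x _; rewrite derive1E; have [] := Ff x.
Qed.

Lemma avg_cos n : avg (fun x => cos (freq n * x)) = (n == 0)%:R.
Proof.
have [->|n0] := eqVneq n 0.
  by rewrite freq0; under eq_avg do rewrite mul0r cos0; rewrite avg_cst.
have k0 : freq n != 0 by rewrite freq_eq0.
have dF x : is_derive x (1 : R) (fun x => (freq n)^-1 * sin (freq n * x)) (cos (freq n * x)).
  by apply: is_derive_eq; rewrite /GRing.scale/=; field.
rewrite (avg_FTC dF); last exact: cos_lin_continuous.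
by rewrite freqL -[_ * _ * _]add0r sinD2pin mulr0 subrr mulr0.
Qed.

Lemma avg_sin n : avg (fun x => sin (freq n * x)) = 0.
Proof.
have [->|n0] := eqVneq n 0.
  by rewrite freq0; under eq_avg do rewrite mul0r sin0; rewrite avg_cst.
have k0 : freq n != 0 by rewrite freq_eq0.
have dF x : is_derive x (1 : R) (fun x => - (freq n)^-1 * cos (freq n * x)) (sin (freq n * x)).
  by apply: is_derive_eq; rewrite /GRing.scale/=; field.
rewrite (avg_FTC dF); last exact: sin_lin_continuous.
by rewrite freqL -[_ * _ * _]add0r cosD2pin mulr0 subrr mulr0.
Qed.

(** The sine of any frequency has mean zero, and the cosine has mean zero unless [m = n]:
    orthonormality of the basis is read off from this formula. *)
Lemma cas_mul m n x :
  cas m x * cas n x = cos (freq (m - n) * x) + sin (freq (m + n) * x).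
Proof.
by rewrite /cas freqB freqD [(freq m - _) * _]mulrBl [(freq m + _) * _]mulrDl cosB sinD; ring.
Qed.

Lemma cos_cas n x : cos (freq n * x) = 2^-1 * (cas n x + cas (- n) x).
Proof. by rewrite /cas freqN mulNr cosN sinN; field. Qed.

Lemma sin_cas n x : sin (freq n * x) = 2^-1 * (cas n x - cas (- n) x).
Proof. by rewrite /cas freqN mulNr cosN sinN; field. Qed.

Lemma hart_cas m n : hart (cas m) n = (m == n)%:R.
Proof.
rewrite /hart; under eq_avg do rewrite cas_mul.
rewrite avgD; first by rewrite avg_cos avg_sin addr0 subr_eq0.
- exact: itg_bounded (measurable_cos_lin _) (fun=> cos_max _).
- exact: itg_bounded (measurable_sin_lin _) (fun=> sin_max _).
Qed.

Lemma avg_mul_cos f n : itg f ->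
  avg (fun x => f x * cos (freq n * x)) = 2^-1 * (hart f n + hart f (- n)).
Proof.
move=> i1; have ic m := itg_mul_cas m i1.
rewrite /hart -avgD// -avgZ; last exact: itgD.
by apply: eq_avg => x; rewrite cos_cas; ring.
Qed.

Lemma avg_mul_sin f n : itg f ->
  avg (fun x => f x * sin (freq n * x)) = 2^-1 * (hart f n - hart f (- n)).
Proof.
move=> i1; have ic m := itg_mul_cas m i1.
rewrite /hart -avgB// -avgZ; last exact: itgB.
by apply: eq_avg => x; rewrite sin_cas; ring.
Qed.

(** By [cas_mul] the product splits into a cosine of index [m - n] and a sine of index [m + n]; each
    is half a sum or difference of two opposite [cas], hence four indices. This replaces the shift
    of a Fourier convolution. *)
Lemma hart_mul_cas f m n : itg f -> hart (fun x => cas m x * f x) n =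
  2^-1 * (hart f (m - n) + hart f (n - m) + hart f (m + n) - hart f (- (m + n))).
Proof.
move=> i1; rewrite /hart.
transitivity (avg (fun x => f x * cos (freq (m - n) * x) + f x * sin (freq (m + n) * x))).
  by apply: eq_avg => x; rewrite mulrAC cas_mul; ring.
rewrite avgD; [|exact: itg_mul_cos|exact: itg_mul_sin].
by rewrite avg_mul_cos// avg_mul_sin// opprB /hart; ring.
Qed.

Lemma hartB f g n : itg f -> itg g ->
  hart (fun x => f x - g x) n = hart f n - hart g n.
Proof.
move=> i1 i2; rewrite /hart -avgB; try exact: itg_mul_cas.
by apply: eq_avg => x; rewrite mulrBl.
Qed.

Lemma hartD f g n : itg f -> itg g ->
  hart (fun x => f x + g x) n = hart f n + hart g n.
Proof.
move=> i1 i2; rewrite /hart -avgD; try exact: itg_mul_cas.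
by apply: eq_avg => x; rewrite mulrDl.
Qed.

Lemma hartZ (c : R) f n : itg f -> hart (fun x => c * f x) n = c * hart f n.
Proof.
move=> i1; rewrite /hart -avgZ; try exact: itg_mul_cas.
by apply: eq_avg => x; rewrite mulrA.
Qed.

Lemma hart_cst (c : R) n : hart (cst c) n = c * (n == 0)%:R.
Proof.
rewrite eq_sym -hart_cas -hartZ; last exact: itg_cas.
by apply: eq_avg => x; rewrite cas0 mulr1.
Qed.

Lemma hart0 f : hart f 0 = avg f.
Proof. by apply: eq_avg => x; rewrite cas0 mulr1. Qed.

Lemma norm_hart f n (M : R) : measurable_fun setT f -> (forall x, `|f x| <= M) ->
  `|hart f n| <= 2 * M.
Proof.
move=> mf fM; apply: norm_avg_le => //.
- by apply: measurable_funM => //; exact: measurable_cas.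
- by move=> x; rewrite normrM mulrC ler_pM// norm_cas.
Qed.

Lemma L2eq_hart f g n : itg f -> itg g -> L2eq L f g -> hart f n = hart g n.
Proof.
move=> i1 i2 fg; apply: ae_eq_avg.
- by apply: itg_meas; exact: itg_mul_cas.
- by apply: itg_meas; exact: itg_mul_cas.
- by apply: L2eqW fg => x ->.
Qed.

Lemma normc_fourier f n : itg f -> Normc.normc (fourier L f n) ^+ 2 =
  2^-1 * (hart f n ^+ 2 + hart f (- n) ^+ 2).
Proof.
move=> i1; rewrite /fourier /Normc.normc sqr_sqrtr; last first.
  by rewrite addr_ge0// sqr_ge0.
rewrite (_ : _ * _ = avg (fun x => f x * cos (freq n * x))); last first.
  by apply: eq_avg => x; congr (_ * cos _); rewrite /freq; ring.
rewrite [X in - X](_ : _ * _ = avg (fun x => f x * sin (freq n * x))); last first.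
  by apply: eq_avg => x; congr (_ * sin _); rewrite /freq; ring.
by rewrite avg_mul_cos// avg_mul_sin//; field.
Qed.

End hartley.

(** * Bounded sums over the integers *)

Section cvg_facts.
Variable R : realType.

Lemma cvg_seq_sum (T : Type) (F : set_system T) (FF : Filter F) (I : Type) (s : seq I)
  (u : I -> T -> R) (l : I -> R) :
  (forall i, u i t @[t --> F] --> l i) ->
  (\sum_(i <- s) u i t) @[t --> F] --> \sum_(i <- s) l i.
Proof.
move=> ul; elim: s => [|i s ih].
  by under eq_cvg do rewrite big_nil; rewrite big_nil; exact: cvg_cst.
by under eq_cvg do rewrite big_cons; rewrite big_cons; exact: cvgD.
Qed.

Lemma cvgn_le (u : R ^nat) (l M : R) : u n @[n --> \oo] --> l ->
  (forall n, u n <= M) -> l <= M.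
Proof. by move=> ul uM; apply: (cvgr_to_le ul); near=> n. Unshelve. all: end_near. Qed.

Lemma cvgn_ge (u : R ^nat) (l M : R) : u n @[n --> \oo] --> l ->
  (forall n, M <= u n) -> M <= l.
Proof. by move=> ul uM; apply: (cvgr_to_ge ul); near=> n. Unshelve. all: end_near. Qed.

Lemma cvgn_ler (u v : R ^nat) (l l' : R) : u n @[n --> \oo] --> l ->
  v n @[n --> \oo] --> l' -> (forall n, u n <= v n) -> l <= l'.
Proof. by move=> ul vl uv; apply: (ler_cvg_to ul vl); near=> n. Unshelve. all: end_near. Qed.

Lemma bounded_series_cvg (u : R ^nat) (K : R) :
  (forall n, \sum_(0 <= i < n) `|u i| <= K) -> cvgn (series u).
Proof.
move=> uK; apply: normed_cvg; apply: nondecreasing_is_cvgn.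
  by apply: nondecreasing_series => n _ _; exact: normr_ge0.
by exists K => _ [n _ <-] /=; exact: uK.
Qed.

End cvg_facts.

Section bounded_sums.
Variable R : realType.
Implicit Types (a b : int -> R) (K : R).

(** For nonnegative [a] this bounds the full sum over [int] by [K], with no enumeration, no limit
    and no extended reals; it passes to limits because each instance is a finite sum. *)
Definition bsum a K := forall s, uniq s -> \sum_(n <- s) a n <= K.

Lemma ler_sum_subset (I : eqType) (r s : seq I) (a : I -> R) : (forall n, 0 <= a n) ->
  uniq s -> {subset s <= r} -> \sum_(n <- s) a n <= \sum_(n <- r) a n.
Proof.
move=> a0; elim: s r => [|x s ih] r /=.
  by rewrite big_nil => _ _; exact: sumr_ge0.
move=> /andP[xs us] sr; have xr : x \in r by apply: sr; rewrite inE eqxx.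
rewrite big_cons [leRHS](big_rem x xr)/= lerD2l ih// => y ys.
have : y \in r by apply: sr; rewrite inE ys orbT.
rewrite (perm_mem (perm_to_rem xr)) inE => /orP[/eqP yx|//].
by rewrite yx (negbTE xs) in ys.
Qed.

Lemma bsum_ge0 a K : bsum a K -> 0 <= K.
Proof. by move=> /(_ [::] isT); rewrite big_nil. Qed.

Lemma bsum_le a b K : (forall n, a n <= b n) -> bsum b K -> bsum a K.
Proof. by move=> ab bK s us; apply: le_trans (bK s us); exact: ler_sum. Qed.

Lemma bsum_wider a K K' : K <= K' -> bsum a K -> bsum a K'.
Proof. by move=> KK' aK s us; exact: le_trans (aK s us) KK'. Qed.

Lemma bsumD a b K K' : bsum a K -> bsum b K' -> bsum (fun n => a n + b n) (K + K').
Proof. by move=> aK bK s us; rewrite big_split lerD ?aK ?bK. Qed.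

Lemma bsumZ a (c : R) K : 0 <= c -> bsum a K -> bsum (fun n => c * a n) (c * K).
Proof. by move=> c0 aK s us; rewrite -mulr_sumr ler_wpM2l// aK. Qed.

Lemma bsum_inj a K (e : int -> int) : injective e -> bsum a K ->
  bsum (fun n => a (e n)) K.
Proof.
by move=> ie aK s us; rewrite -(big_map e xpredT); apply: aK; rewrite map_inj_uniq.
Qed.

Lemma bsum1 a K n : bsum a K -> a n <= K.
Proof. by move=> /(_ [:: n] isT); rewrite big_seq1. Qed.

Lemma bsum_sqr a K : (forall n, 0 <= a n) -> bsum a K ->
  bsum (fun n => a n ^+ 2) (K ^+ 2).
Proof.
move=> a0 aK s us; have K0 := bsum_ge0 aK.
apply: (@le_trans _ _ (\sum_(n <- s) K * a n)).
  by apply: ler_sum => n _; rewrite expr2 ler_wpM2r// (bsum1 n aK).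
by rewrite -mulr_sumr expr2 ler_wpM2l// aK.
Qed.

Definition wt (n : int) : R := 1 + n%:~R ^+ 2.

Lemma wt_ge1 n : 1 <= wt n.
Proof. by rewrite lerDl sqr_ge0. Qed.

Lemma wt_gt0 n : 0 < wt n.
Proof. exact: lt_le_trans (wt_ge1 n). Qed.

Lemma wt_ge0 n : 0 <= wt n.
Proof. exact/ltW/wt_gt0. Qed.

Lemma wtN n : wt (- n) = wt n.
Proof. by rewrite /wt mulrNz sqrrN. Qed.

(** Peetre's inequality: the difference of the two sides is an explicit sum of squares. It lets the
    weight be distributed over the two factors of a convolution. *)
Lemma wt_submul m n : wt n <= 2 * wt m * wt (n - m).
Proof.
rewrite /wt intrB; set x : R := m%:~R; set y : R := n%:~R.
have -> : 1 + y ^+ 2 = 2 * (1 + x ^+ 2) * (1 + (y - x) ^+ 2) -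
   (1 + (y - 2 * x) ^+ 2 + 2 * x ^+ 2 * (y - x) ^+ 2) by ring.
rewrite lerBlDr lerDl addr_ge0 ?addr_ge0 ?sqr_ge0//.
by rewrite mulr_ge0 ?sqr_ge0// mulr_ge0// sqr_ge0.
Qed.

Lemma bsum_unweight a K : (forall n, 0 <= a n) -> bsum (fun n => wt n * a n) K ->
  bsum a K.
Proof. by move=> a0; apply: bsum_le => n; rewrite ler_peMl// wt_ge1. Qed.

(** The enumeration [0, -1, 1, -2, 2, ...], used wherever a series over [int] has to be the limit of
    a sequence. *)
Definition ienum (i : nat) : int := if odd i then Negz i./2 else Posz i./2.

Lemma ienum_inj : injective ienum.
Proof.
move=> i j; rewrite /ienum.
have := odd_double_half i; have := odd_double_half j.
by case: (odd i); case: (odd j) => Ej Ei // [E]; rewrite -Ei -Ej E.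
Qed.

Lemma ienum_surj n : exists i, ienum i = n.
Proof.
case: n => m; first by exists m.*2; rewrite /ienum odd_double doubleK.
by exists m.*2.+1; rewrite /ienum /= odd_double /= uphalf_double.
Qed.

Lemma seq_enum_bound (s : seq int) : exists N, {subset s <= map ienum (iota 0 N)}.
Proof.
elim: s => [|n s [N ih]]; first by exists 0%N.
have [i <-] := ienum_surj n; exists (maxn N i.+1) => m.
rewrite inE => /orP[/eqP->|/ih /mapP[j]].
  by apply: map_f; rewrite mem_iota/= leq_maxr.
rewrite mem_iota /= add0n => jN ->; apply: map_f.
by rewrite mem_iota /= add0n (leq_trans jN)// leq_maxl.
Qed.

Lemma uniq_enum N : uniq (map ienum (iota 0 N)).
Proof. by rewrite (map_inj_uniq ienum_inj) iota_uniq. Qed.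

Lemma bsum_partial a K N : bsum a K -> \sum_(0 <= i < N) a (ienum i) <= K.
Proof.
move=> aK; rewrite -(big_map ienum xpredT); apply: aK.
by rewrite /index_iota subn0 uniq_enum.
Qed.

Lemma partial_bsum a K : (forall n, 0 <= a n) ->
  (forall N, \sum_(0 <= i < N) a (ienum i) <= K) -> bsum a K.
Proof.
move=> a0 aK s us; have [N sN] := seq_enum_bound s.
apply: le_trans (aK N); rewrite -(big_map ienum xpredT) /index_iota subn0.
exact: ler_sum_subset.
Qed.

(** Since [|ienum i| >= i / 2], the left side is at most [4 / (4 + i^2)], and
    [(i + 1) (i + 2) <= 3 (4 + i^2)]: hence [12 = 4 * 3]. The right side telescopes, so the same
    [12] bounds the whole sum. *)
Lemma invwt_ienum (i : nat) :
  (wt (ienum i))^-1 <= 12 * ((i%:R + 1)^-1 - (i%:R + 2)^-1).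
Proof.
have i0 : 0 <= i%:R :> R by [].
have iw : 4 + i%:R ^+ 2 <= 4 * wt (ienum i).
  rewrite /wt /ienum; case: ifPn => oi.
    have -> : i%:R = 1 + 2 * (i./2)%:R :> R.
      by rewrite -[in LHS](odd_double_half i) oi natrD -muln2 natrM mulrC.
    by rewrite NegzE mulrNz sqrrN -pmulrn -natr1; have : 0 <= (i./2)%:R :> R by []; nra.
  have -> : i%:R = 2 * (i./2)%:R :> R.
    by rewrite -[in LHS](odd_double_half i) (negbTE oi) add0n -muln2 natrM mulrC.
  by rewrite -pmulrn; nra.
have -> : (i%:R + 1)^-1 - (i%:R + 2)^-1 = ((i%:R + 1) * (i%:R + 2))^-1 :> R.
  by field; rewrite !gt_eqF//; lra.
rewrite ler_pdivlMr; last by rewrite mulr_gt0//; lra.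
rewrite mulrC ler_pdivrMr; last exact: wt_gt0.
by nra.
Qed.

Lemma bsum_invwt : bsum (fun n => (wt n)^-1) 12.
Proof.
apply: partial_bsum => [n|N]; first by rewrite invr_ge0 wt_ge0.
apply: (@le_trans _ _ (12 * (1 - (N%:R + 1)^-1))); last first.
  by rewrite ger_pMr// gerBl invr_ge0 addr_ge0.
elim: N => [|N ih]; first by rewrite big_geq// add0r invr1 subrr mulr0.
rewrite big_nat_recr//=; apply: le_trans (lerD ih (invwt_ienum N)) _.
by rewrite -mulrDr ler_pM2l// addrA subrK -[in leRHS]natr1 -addrA.
Qed.

(* AM-GM: [2 |y n| <= 1 / w n + w n * |y n|^2] *)
Lemma bsum_abs a K : bsum (fun n => wt n * a n ^+ 2) K ->
  bsum (fun n => `|a n|) (12 + K).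
Proof.
move=> aK; apply: bsum_le (bsumD bsum_invwt aK) => n.
have w0 := wt_gt0 n; rewrite -[leRHS](mulfK (lt0r_neq0 w0)) ler_pdivlMr//.
rewrite mulrDl mulVf ?gt_eqF// -[a n ^+ 2]real_normK ?num_real//.
have := sqr_ge0 (1 - wt n * `|a n|); nra.
Qed.

End bounded_sums.

(** * Synthesis of absolutely summable coefficients *)

Section synthesis.
Variables (R : realType) (L : R).
Hypothesis L_gt0 : 0 < L.
Local Notation mu := (@lebesgue_measure R).
Implicit Types (f g : R -> R) (a b : int -> R) (K : R).
Local Notation avg := (avg L).
Local Notation itg := (itg L).
Local Notation cas := (cas L).
Local Notation hart := (hart L).

Lemma avg_cvg (f_ : nat -> R -> R) f g :
  (forall n, measurable_fun `[0, L] (f_ n)) ->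
  (forall x, f_ n x @[n --> \oo] --> f x) -> itg g ->
  (forall n x, `|f_ n x| <= g x) ->
  avg (f_ n) @[n --> \oo] --> avg f.
Proof.
move=> mf ff ig fg; apply: cvgMr.
have mD : measurable (`[0, L]%classic : set R) by [].
have i_ n : itg (f_ n) by exact: itg_le (mf n) (fg n) ig.
have mlim : measurable_fun `[0, L] f by exact: measurable_fun_cvg mf _.
have flim x : `|f x| <= g x.
  by apply: cvgn_le (cvg_norm (ff x)) _ => n; exact: fg.
have ilim : itg f by exact: itg_le mlim flim ig.
apply: fine_cvg; rewrite /Rintegral fineK; last exact: integrable_fin_num.
apply: (@dominated_cvg _ _ _ mu _ mD _ _ (EFin \o g)) => //.
- by move=> n; apply/measurable_EFinP; exact: mf.
- by move=> x _; apply: cvg_EFin; [near=> n|exact: ff].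
- by move=> n x _ /=; rewrite lee_fin.
Unshelve. all: end_near. Qed.

Definition smb a := exists K, bsum (fun n => `|a n|) K.

Definition partial a N x := \sum_(0 <= i < N) a (ienum i) * cas (ienum i) x.

Definition syn a x := limn (partial a ^~ x).

Lemma smbZ (c : R) a : smb a -> smb (fun n => c * a n).
Proof.
move=> [K aK]; exists (`|c| * K); apply: bsum_le (bsumZ _ aK) => // n.
by rewrite normrM.
Qed.

Lemma smbB a b : smb a -> smb b -> smb (fun n => a n - b n).
Proof.
by move=> [K aK] [K' bK]; exists (K + K'); apply: bsum_le (bsumD aK bK) => n; exact: ler_normB.
Qed.

Lemma abs_series_le a b K N : bsum (fun n => `|a n|) K -> (forall n, `|b n| <= 2) ->
  \sum_(0 <= i < N) `|a (ienum i) * b (ienum i)| <= K * 2.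
Proof.
move=> aK b2; apply: le_trans (_ : \sum_(0 <= i < N) `|a (ienum i)| * 2 <= _).
  by apply: ler_sum => i _; rewrite normrM ler_wpM2l.
by rewrite -mulr_suml ler_wpM2r// (bsum_partial N aK).
Qed.

Lemma norm_partial a K N x : bsum (fun n => `|a n|) K -> `|partial a N x| <= K * 2.
Proof.
move=> aK; apply: le_trans (ler_norm_sum _ _ _) _.
by apply: (abs_series_le (b := cas ^~ x)) => // n; exact: norm_cas.
Qed.

Lemma syn_cvg a x : smb a -> partial a N x @[N --> \oo] --> syn a x.
Proof.
move=> [K aK]; apply: (@bounded_series_cvg _ _ (K * 2)) => n.
by apply: (abs_series_le (b := cas ^~ x)) => // m; exact: norm_cas.
Qed.

Lemma syn_eq a x l : partial a N x @[N --> \oo] --> l -> syn a x = l.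
Proof. by move=> h; apply/cvg_lim. Qed.

Lemma norm_syn a K x : bsum (fun n => `|a n|) K -> `|syn a x| <= K * 2.
Proof.
move=> aK; have sa : smb a by exists K.
apply: (@cvgn_le _ (fun N => `|partial a N x|)) => [|n]; last exact: norm_partial.
by apply: cvg_norm; exact: syn_cvg.
Qed.

Lemma synD a b x : smb a -> smb b -> syn (fun n => a n + b n) x = syn a x + syn b x.
Proof.
move=> sa sb; apply: syn_eq; rewrite (_ : (fun N => _) = (fun N => partial a N x + partial b N x)).
  by apply: cvgD; exact: syn_cvg.
apply/funext => N; rewrite /partial -big_split; apply: eq_bigr => i _ /=; exact: mulrDl.
Qed.

Lemma synZ (c : R) a x : smb a -> syn (fun n => c * a n) x = c * syn a x.
Proof.
move=> sa; apply: syn_eq; rewrite (_ : (fun N => _) = (fun N => c * partial a N x)).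
  by apply: cvgMr; exact: syn_cvg.
apply/funext => N; rewrite /partial mulr_sumr; apply: eq_bigr => i _ /=; exact/esym/mulrA.
Qed.

Lemma synB a b x : smb a -> smb b -> syn (fun n => a n - b n) x = syn a x - syn b x.
Proof.
move=> sa sb; rewrite -mulN1r -synZ// -synD//; last exact: smbZ.
by congr syn; apply/funext => n; rewrite mulN1r.
Qed.

Lemma measurable_partial a N : measurable_fun setT (partial a N).
Proof.
apply: measurable_sum => i; apply: measurable_funM => //; exact: measurable_cas.
Qed.

Lemma measurable_syn a : smb a -> measurable_fun setT (syn a).
Proof.
move=> sa; apply: (measurable_fun_cvg (h := partial a)).
  exact: measurable_partial.
by move=> x _; exact: syn_cvg.
Qed.

Lemma syn_periodic a : periodic (syn a) L.
Proof.
move=> x; rewrite /syn; congr (limn _); apply/funext => N.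
by apply: eq_bigr => i _; rewrite cas_periodic.
Qed.

Lemma syn_L2per a : smb a -> L2per L (syn a).
Proof.
move=> sa; case: (sa) => K aK.
apply: (L2per_bounded L_gt0 (measurable_syn sa) (@syn_periodic a)) => x.
exact: (norm_syn x aK).
Qed.

Lemma itg_syn a : smb a -> itg (syn a).
Proof. by move=> sa; exact/L2per_itg/syn_L2per. Qed.

(** Termwise integration by dominated convergence: all partial sums are below [2 * K], so
    [2 * K * |g|] is a majorant. As [g] is merely integrable, it may be a basis function, a
    synthesis or a derivative of a test function. *)
Lemma avg_syn a g : smb a -> itg g ->
  \sum_(0 <= i < N) a (ienum i) * hart g (ienum i) @[N --> \oo] -->
  avg (fun x => syn a x * g x).
Proof.
move=> sa ig; case: (sa) => K aK.
have icas i : itg (fun x => a (ienum i) * (g x * cas (ienum i) x)).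
  by apply: itgZ; exact: itg_mul_cas.
rewrite (_ : (fun N => _) = (fun N => avg (fun x => partial a N x * g x))); last first.
  apply/funext => N; rewrite /hart; under eq_bigr do rewrite -avgZ ?itg_mul_cas//.
  rewrite -avg_sum//; apply: eq_avg => x; rewrite mulr_suml; apply: eq_bigr => i _.
  by rewrite mulrAC mulrA.
apply: (avg_cvg (g := fun x => K * 2 * `|g x|)).
- move=> N; apply: measurable_funM; last exact: itg_meas.
  by apply: itg_mfun; exact: measurable_partial.
- by move=> x; apply: cvgMl; exact: syn_cvg.
- by apply: itgZ; exact: itg_norm.
- by move=> N x; rewrite normrM ler_wpM2r//; exact: norm_partial.
Qed.

(** By orthonormality the partial sums of the pairing with [cas n] are constant once [n] has been
    enumerated. *)
Lemma hart_syn a n : smb a -> hart (syn a) n = a n.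
Proof.
move=> sa; have h := avg_syn sa (itg_cas L_gt0 n).
have [i0 i0n] := ienum_surj n.
rewrite /hart -(cvg_lim _ h)//; apply: lim_near_cst => //; near=> N.
rewrite (bigD1_seq i0) ?iota_uniq//=; last first.
  by rewrite mem_index_iota/=; near: N; exact: nbhs_infty_gt.
rewrite i0n hart_cas// eqxx mulr1 big1 ?addr0// => i ii0.
rewrite hart_cas// -[in n == _]i0n (inj_eq ienum_inj) eq_sym.
by rewrite (negbTE ii0) mulr0.
Unshelve. all: end_near. Qed.

Lemma hart_syn_mul a g n : smb a -> itg g ->
  \sum_(0 <= i < N) a (ienum i) * hart (fun x => cas (ienum i) x * g x) n @[N --> \oo] -->
  hart (fun x => syn a x * g x) n.
Proof.
move=> sa ig; have := avg_syn sa (itg_mul_cas n ig).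
rewrite (_ : hart _ n = avg (fun x => syn a x * (g x * cas n x))); last first.
  by apply: eq_avg => x; rewrite mulrA.
apply: cvg_trans; rewrite (_ : (fun N => _) = (fun N => \sum_(0 <= i < N) a (ienum i) *
  hart (fun x : R => g x * cas n x) (ienum i)))//.
apply/funext => N; apply: eq_bigr => i _; congr (_ * _).
by apply: eq_avg => x; ring.
Qed.

End synthesis.

(** * Products, and Bessel's inequality *)

Section majorant_convolution.
Variable R : realType.
Implicit Types (M B : int -> R) (K : R).

Definition majconv_term M B (j i : int) :=
  M i * (2^-1 * (B (i - j) + B (j - i) + B (i + j) + B (- (i + j)))).

(* The indices i - j, j - i, i + j, - (i + j) are those of [hart_mul_cas]. *)
Definition majconv M B (j : int) :=
  limn (fun N => \sum_(0 <= i < N) majconv_term M B j (ienum i)).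

Lemma majconv_cvg M B K K' (j : int) : (forall n, 0 <= M n) -> bsum M K ->
  (forall n, 0 <= B n <= K') ->
  \sum_(0 <= i < N) majconv_term M B j (ienum i) @[N --> \oo] --> majconv M B j.
Proof.
move=> M0 MK BK'; apply: (@bounded_series_cvg _ _ (K * (2 * K'))) => N.
apply: le_trans (_ : \sum_(0 <= i < N) M (ienum i) * (2 * K') <= _).
  apply: ler_sum => i _; rewrite /majconv_term ger0_norm.
    apply: ler_wpM2l => //; rewrite ler_pdivrMl//.
    have := BK' (ienum i - j); have := BK' (j - ienum i).
    by have := BK' (ienum i + j); have := BK' (- (ienum i + j)); lra.
  apply: mulr_ge0 => //; apply: mulr_ge0 => //.
  by rewrite !addr_ge0//; case/andP: (BK' (ienum i - j));
    case/andP: (BK' (j - ienum i)); case/andP: (BK' (ienum i + j));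
    case/andP: (BK' (- (ienum i + j))).
have K'0 : 0 <= K' by have /andP[? ?] := BK' 0; lra.
by rewrite -mulr_suml ler_wpM2r ?mulr_ge0// (bsum_partial N MK).
Qed.

Lemma majconv_term_ge0 M B (j i : int) : (forall n, 0 <= M n) -> (forall n, 0 <= B n) ->
  0 <= majconv_term M B j i.
Proof. by move=> M0 B0; rewrite mulr_ge0// mulr_ge0// !addr_ge0. Qed.

Lemma majconv_ge0 M B K K' (j : int) : (forall n, 0 <= M n) -> bsum M K ->
  (forall n, 0 <= B n <= K') -> 0 <= majconv M B j.
Proof.
move=> M0 MK BK; apply: cvgn_ge (majconv_cvg M0 MK BK) _ => N.
by apply: sumr_ge0 => i _; apply: majconv_term_ge0 => // n; have /andP[] := BK n.
Qed.

(** Weighted Young inequality in l^1. After exchanging the sums, for a fixed index [m] the weight at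
    [j] is split by [wt_submul] between [m] and each of the four shifted indices. Every shift is
    injective in [j] and so contributes at most [2 * wt m * K']; half of four such terms gives the
    factor 4. *)
Lemma majconv_bsum M B K K' : (forall n, 0 <= M n) -> (forall n, 0 <= B n) ->
  bsum (fun n => wt R n * M n) K -> bsum (fun n => wt R n * B n) K' ->
  bsum (fun n => wt R n * majconv M B n) (4 * K * K').
Proof.
move=> M0 B0 MK BK s us.
have M1 := bsum_unweight M0 MK; have B1 := bsum_unweight B0 BK.
have B2 n : 0 <= B n <= K' by rewrite B0 (bsum1 n B1).
have K'0 := bsum_ge0 BK.
have cv : \sum_(j <- s) wt R j * (\sum_(0 <= i < N) majconv_term M B j (ienum i)) @[N --> \oo] -->
   \sum_(j <- s) wt R j * majconv M B j.
  by apply: cvg_seq_sum => j; apply: cvgMr; exact: majconv_cvg M0 M1 B2.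
apply: cvgn_le cv _ => N; under eq_bigr do rewrite mulr_sumr.
rewrite exchange_big /=.
apply: le_trans (_ : \sum_(0 <= i < N) (wt R (ienum i) * M (ienum i)) * (4 * K') <= _); last first.
  rewrite -mulr_suml (_ : 4 * K * K' = K * (4 * K')); last by ring.
  by rewrite ler_wpM2r ?mulr_ge0// (bsum_partial N MK).
apply: ler_sum => i _; set m := ienum i.
have tau (e : int -> int) : injective e -> (forall j, wt R j <= 2 * wt R m * wt R (e j)) ->
    \sum_(j <- s) wt R j * B (e j) <= 2 * wt R m * K'.
  move=> ie we; apply: le_trans (_ : \sum_(j <- s) 2 * wt R m * (wt R (e j) * B (e j)) <= _).
    by apply: ler_sum => j _; rewrite mulrA ler_wpM2r.
  rewrite -mulr_sumr ler_wpM2l ?mulr_ge0 ?wt_ge0//.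
  exact: (bsum_inj ie BK).
have t1 := tau (fun j => m - j); have t2 := tau (fun j => j - m).
have t3 := tau (fun j => m + j); have t4 := tau (fun j => - (m + j)).
have {}t1 : \sum_(j <- s) wt R j * B (m - j) <= 2 * wt R m * K'.
  apply: t1 => [j j' /= h|j]; first lia.
  by rewrite -[wt R (m - j)]wtN opprB; exact: wt_submul.
have {}t2 : \sum_(j <- s) wt R j * B (j - m) <= 2 * wt R m * K'.
  apply: t2 => [j j' /= h|j]; first lia.
  exact: wt_submul.
have t34 j : wt R j <= 2 * wt R m * wt R (m + j).
  by rewrite -(wtN R m) -[m in wt R (m + j)]opprK addrC; exact: wt_submul.
have {}t3 : \sum_(j <- s) wt R j * B (m + j) <= 2 * wt R m * K'.
  by apply: t3 => [j j' /= h|j]; [lia|exact: t34].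
have {}t4 : \sum_(j <- s) wt R j * B (- (m + j)) <= 2 * wt R m * K'.
  by apply: t4 => [j j' /= h|j]; [lia|rewrite wtN; exact: t34].
rewrite (_ : \sum_(j <- s) _ = M m * (2^-1 * (\sum_(j <- s) wt R j * B (m - j) +
  \sum_(j <- s) wt R j * B (j - m) + \sum_(j <- s) wt R j * B (m + j) +
  \sum_(j <- s) wt R j * B (- (m + j))))); last first.
  by rewrite -!big_split/= !mulr_sumr; apply: eq_bigr => j _; rewrite /majconv_term; ring.
rewrite [wt R m * M m]mulrC -mulrA; apply: ler_wpM2l => //.
rewrite ler_pdivrMl//; lra.
Qed.

End majorant_convolution.

(** * Coefficients of products, Bessel's inequality and Parseval's bound *)

Section products.
Variables (R : realType) (L : R).
Hypothesis L_gt0 : 0 < L.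
Implicit Types (f g : R -> R) (a b M B : int -> R) (K : R).
Local Notation avg := (avg L).
Local Notation itg := (itg L).
Local Notation cas := (cas L).
Local Notation hart := (hart L).
Local Notation syn := (syn L).

(** Only majorants of the two coefficient sequences enter the bound, so with majorants independent
    of time it is uniform in time. *)
Lemma norm_hart_mul a g M B K K' (j : int) :
  (forall n, `|a n| <= M n) -> bsum M K -> itg g ->
  (forall n, `|hart g n| <= B n) -> (forall n, B n <= K') ->
  `|hart (fun x => syn a x * g x) j| <= majconv M B j.
Proof.
move=> aM MK ig gB BK.
have sa : smb a by exists K; exact: bsum_le aM MK.
have M0 n : 0 <= M n by exact: le_trans (aM n).
have B0 n : 0 <= B n <= K' by rewrite BK andbT; exact: le_trans (gB n).
apply: cvgn_ler (cvg_norm (hart_syn_mul L_gt0 sa ig)) (majconv_cvg M0 MK B0) _ => N.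
apply: le_trans (ler_norm_sum _ _ _) _; apply: ler_sum => i _.
rewrite normrM hart_mul_cas//; apply: ler_pM => //.
rewrite normrM [`|2^-1|]ger0_norm// ler_pM2l//.
apply: le_trans (ler_normB _ _) _; apply: lerD => //.
apply: le_trans (ler_normD _ _) _; apply: lerD => //.
by apply: le_trans (ler_normD _ _) _; apply: lerD.
Qed.

(** The mean of [(f - P) ^+ 2] is nonnegative, where [P] is the projection on the modes in [s]; both
    the cross term and the mean of [P * P] reduce to the sum of squared coefficients. *)
Lemma bessel f : L2per L f -> bsum (fun n => hart f n ^+ 2) (avg (fun x => f x ^+ 2)).
Proof.
move=> Lf s us; have i1 := L2per_itg L_gt0 Lf.
pose P x := \sum_(n <- s) hart f n * cas n x.
have iP : itg P by apply: itg_sum => // n; apply: itgZ; exact: itg_cas.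
have bP x : `|P x| <= \sum_(n <- s) `|hart f n| * 2.
  apply: le_trans (ler_norm_sum _ _ _) _; apply: ler_sum => n _.
  by rewrite normrM ler_wpM2l// norm_cas.
have mP : measurable_fun setT P.
  by apply: measurable_sum => n; apply: measurable_funM => //; exact: measurable_cas.
have avP g : itg g -> avg (fun x => g x * P x) = \sum_(n <- s) hart f n * hart g n.
  move=> ig; rewrite [RHS](eq_bigr (fun n => avg (fun x => hart f n * (g x * cas n x)))).
    2: by move=> n _; rewrite avgZ//; exact: itg_mul_cas.
  rewrite -avg_sum//; last by move=> n; apply: itgZ; exact: itg_mul_cas.
  by apply: eq_avg => x; rewrite mulr_sumr; apply: eq_bigr => n _; ring.
have hP n : n \in s -> hart P n = hart f n.
  move=> ns; rewrite /hart (_ : avg _ = avg (fun x => cas n x * P x)); last first.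
    by apply: eq_avg => x; rewrite mulrC.
  rewrite avP ?itg_cas// (bigD1_seq n)//= hart_cas// eqxx mulr1 big1 ?addr0// => m mn.
  by rewrite hart_cas// eq_sym (negbTE mn) mulr0.
have := @avg_ge0 _ L L_gt0 (fun x => (f x - P x) ^+ 2) (fun x => sqr_ge0 _).
rewrite (_ : avg _ = avg (fun x => (f x ^+ 2 - 2 * (f x * P x)) + P x * P x)); last first.
  by apply: eq_avg => x; ring.
have i2 : itg (fun x => f x ^+ 2) by exact: L2per_itg_sqr.
have i3 : itg (fun x => f x * P x) by apply: itgM i1 mP bP.
have i4 : itg (fun x => P x * P x) by apply: itgM iP mP bP.
rewrite avgD//; last by apply: itgB => //; exact: itgZ.
rewrite avgB//; last exact: itgZ.
rewrite avgZ// !avP//.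
rewrite [X in _ + X](_ : _ = \sum_(n <- s) hart f n ^+ 2); last first.
  by apply: eq_big_seq => n ns; rewrite hP.
rewrite (_ : \sum_(n <- s) _ * _ = \sum_(n <- s) hart f n ^+ 2)//.
by lra.
Qed.

(** The converse half of Parseval, for absolutely summable coefficients: the synthesis is paired
    with itself in [avg_syn]. *)
Lemma avg_syn_sqr_le a K : smb a -> bsum (fun n => a n ^+ 2) K ->
  avg (fun x => syn a x ^+ 2) <= K.
Proof.
move=> sa aK; apply: cvgn_le (avg_syn L_gt0 sa (itg_syn L_gt0 sa)) _ => N.
rewrite (_ : \sum_(0 <= i < N) _ = \sum_(0 <= i < N) a (ienum i) ^+ 2).
  exact: (bsum_partial N aK).
by apply: eq_bigr => i _; rewrite hart_syn.
Qed.

End products.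

(** * Uniqueness of Hartley coefficients *)

Section heaviside.
Variable R : realType.

Lemma bernoulli_le (y : R) k : 0 <= y <= 1 -> 1 - k%:R * y <= (1 - y) ^+ k.
Proof.
move=> /andP[y0 y1]; elim: k => [|k ih]; first by rewrite expr0 mul0r subr0.
rewrite exprS; apply: (@le_trans _ _ ((1 - y) * (1 - k%:R * y))); last first.
  by rewrite ler_wpM2l// subr_ge0.
rewrite -natr1; have : 0 <= k%:R :> R by []; nra.
Qed.

Lemma bernoulli_ge (y : R) k : 0 <= y <= 1 -> (1 - y) ^+ k * (1 + k%:R * y) <= 1.
Proof.
move=> /andP[y0 y1]; elim: k => [|k ih]; first by rewrite expr0 mul0r addr0 mul1r.
apply: le_trans ih; rewrite exprSr -mulrA ler_wpM2l ?exprn_ge0 ?subr_ge0//.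
rewrite -natr1; have : 0 <= k%:R :> R by []; nra.
Qed.

(** The polynomials [(1 - s ^+ N) ^+ (2 ^ N)] tend to a step that jumps at [1/2]. Below the jump,
    Bernoulli's inequality gives the lower bound [1 - (2 * s) ^+ N], which tends to 1. *)
Lemma heaviside_lt (s : R) : 0 <= s -> s < 2^-1 ->
  (1 - s ^+ N) ^+ (2 ^ N) @[N --> \oo] --> (1 : R).
Proof.
move=> s0 s2; have q1 : `|2 * s| < 1 by rewrite ger0_norm; lra.
have s1 N : 0 <= s ^+ N <= 1 by rewrite exprn_ge0//= exprn_ile1//; lra.
apply: (@squeeze_cvgr _ _ _ _ (fun N => 1 - (2 * s) ^+ N) (cst 1)).
- near=> N; apply/andP; split.
    by apply: le_trans (bernoulli_le (2 ^ N) (s1 N)); rewrite natrX -exprMn.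
  by have /andP[? ?] := s1 N; rewrite exprn_ile1 ?subr_ge0// gerBl.
- rewrite -[X in _ --> X]subr0; apply: cvgB; first exact: cvg_cst.
  exact: cvg_expr.
- exact: cvg_cst.
Unshelve. all: end_near. Qed.

(** Beyond the jump, the reciprocal form of Bernoulli's inequality gives [1 / (1 + (2 * s) ^+ N)] as
    an upper bound, now with [2 * s > 1]. *)
Lemma heaviside_gt (s : R) : s <= 1 -> 2^-1 < s ->
  (1 - s ^+ N) ^+ (2 ^ N) @[N --> \oo] --> (0 : R).
Proof.
move=> s1 s2; have s0 : 0 < 2 * s by lra.
have q1 : `|(2 * s)^-1| < 1.
  by rewrite ger0_norm ?invr_ge0 1?ltW// invf_lt1//; lra.
have s1' N : 0 <= s ^+ N <= 1 by rewrite exprn_ge0 ?exprn_ile1//=; lra.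
apply: (@squeeze_cvgr _ _ _ _ (cst 0) (fun N => (2 * s)^-1 ^+ N)).
- near=> N; have /andP[t0 t1] := s1' N; apply/andP; split.
    by rewrite exprn_ge0// subr_ge0.
  rewrite exprVn -[leRHS]mul1r ler_pdivlMr ?exprn_gt0//.
  have e0 : 0 <= (1 - s ^+ N) ^+ (2 ^ N) by rewrite exprn_ge0// subr_ge0.
  have := bernoulli_ge (2 ^ N) (s1' N); rewrite natrX -exprMn mulrDr mulr1.
  lra.
- exact: cvg_cst.
- exact: cvg_expr.
Unshelve. all: end_near. Qed.

Lemma ae_neq (c : R) : {ae @lebesgue_measure R, forall x, x != c}.
Proof.
exists [set c]; split => //; first exact: lebesgue_measure_set1.
by move=> x /= /negP; rewrite negbK => /eqP.
Qed.

End heaviside.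

Lemma ae_derive_prefix_integral (R : realType) (g : R -> R) :
  (@lebesgue_measure R).-integrable setT (EFin \o g) -> locally_integrable setT g ->
  let F x := \int[@lebesgue_measure R]_(t in `[0, x]) g t in
  {ae @lebesgue_measure R, forall x, 0 < x -> derivable F x 1 /\ derive1 F x = g x}.
Proof.
move=> ig lg F.
have ig_y y : (@lebesgue_measure R).-integrable [set` Interval (BLeft 0) (BRight y)] (EFin \o g).
  by apply: (integrableS _ _ _ ig).
have F_eq := FTC1 ig_y lg.
apply: (@ae_mono R _ (fun x => 0 < x -> derivable F x 1 /\ derive1 F x = g x) _ F_eq).
by move=> x h x0; apply: h; rewrite /= lte_fin.
Qed.

(** * An integrable function with vanishing coefficients vanishes almost everywhere *)

Section uniqueness.
Variables (R : realType) (L : R).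
Hypothesis L_gt0 : 0 < L.
Local Notation mu := (@lebesgue_measure R).
Implicit Types (f g h : R -> R).
Local Notation avg := (avg L).
Local Notation itg := (itg L).
Local Notation hart := (hart L).
Local Notation freq := (freq L).

Variable f : R -> R.
Hypotheses (itg_f : itg f) (hart_f : forall n, hart f n = 0).

Let shifted (m : R) (n : int) x := cos (freq n * (x - m)).

Let shiftedE m n x : shifted m n x =
  cos (freq n * m) * cos (freq n * x) + sin (freq n * m) * sin (freq n * x).
Proof. by rewrite /shifted mulrBr cosB; ring. Qed.

Let measurable_shifted m n : measurable_fun setT (shifted m n).
Proof.
rewrite (funext (shiftedE m n)); apply: measurable_funD; apply: measurable_funM => //.
  exact: measurable_cos_lin.
exact: measurable_sin_lin.
Qed.

(* Bounded multipliers [h] such that [f * h] is orthogonal to all harmonics;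
   they form an algebra over the polynomials in [shifted m 1]. *)
Let annihilator m h := [/\ measurable_fun setT h, exists M : R, forall x, `|h x| <= M &
  forall n, avg (fun x => f x * (h x * shifted m n x)) = 0].

Let itg_h h (M : R) m n : measurable_fun setT h -> (forall x, `|h x| <= M) ->
  itg (fun x => f x * (h x * shifted m n x)).
Proof.
move=> mh hM; apply: (itgM (M := M)) => //.
  exact: measurable_funM.
by move=> x; rewrite normrM -[M]mulr1 ler_pM// cos_max.
Qed.

Let annihilator1 m : annihilator m (cst 1).
Proof.
split; [exact: measurable_cst|by exists 1 => x; rewrite normr1|move=> n].
rewrite (_ : avg _ = avg (fun x => cos (freq n * m) * (f x * cos (freq n * x)) +
  sin (freq n * m) * (f x * sin (freq n * x)))); last first.
  by apply: eq_avg => x; rewrite shiftedE /=; ring.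
have ic := itg_mul_cos (freq n) itg_f; have is_ := itg_mul_sin (freq n) itg_f.
rewrite avgD; [|exact: itgZ|exact: itgZ].
by rewrite !avgZ// avg_mul_cos// avg_mul_sin// !hart_f; ring.
Qed.

Let annihilatorD m (al be : R) h g : annihilator m h -> annihilator m g ->
  annihilator m (fun x => al * h x + be * g x).
Proof.
move=> [mh [M hM] h0] [mg [M' gM] g0]; split.
- by apply: measurable_funD; apply: measurable_funM.
- exists (`|al| * M + `|be| * M') => x; apply: le_trans (ler_normD _ _) _.
  by rewrite !normrM lerD// ler_wpM2l.
- move=> n; have ih := itg_h m n mh hM; have ig := itg_h m n mg gM.
  rewrite (_ : avg _ = avg (fun x => al * (f x * (h x * shifted m n x)) +
    be * (f x * (g x * shifted m n x)))); last first.
    by apply: eq_avg => x; ring.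
  rewrite avgD; [|exact: itgZ|exact: itgZ].
  by rewrite !avgZ// h0 g0; ring.
Qed.

(** Cosines centred at the same point [m] are closed under products: multiplying index [n] by index
    [1] gives half the sum of indices [n + 1] and [n - 1]. *)
Let annihilatorM m h : annihilator m h -> annihilator m (fun x => shifted m 1 x * h x).
Proof.
move=> [mh [M hM] h0]; split.
- exact: measurable_funM.
- exists M => x; rewrite normrM -[M]mul1r ler_pM//; exact: cos_max.
- move=> n; have ih k := itg_h m k mh hM.
  rewrite (_ : avg _ = avg (fun x => 2^-1 * (f x * (h x * shifted m (n + 1) x)) +
    2^-1 * (f x * (h x * shifted m (n - 1) x)))); last first.
    apply: eq_avg => x; rewrite /shifted freqB freqD.
    by rewrite [(_ + _) * (x - m)]mulrDl [(freq n - _) * (x - m)]mulrBl cosB cosD; field.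
  rewrite avgD; [|exact: itgZ|exact: itgZ].
  by rewrite !avgZ// !h0; ring.
Qed.

Let annihilator_poly m (al be : R) N k :
  annihilator m (fun x => (1 - (al + be * shifted m 1 x) ^+ N) ^+ k).
Proof.
have aff h : annihilator m h -> annihilator m (fun x => (al + be * shifted m 1 x) * h x).
  move=> ah; have := annihilatorD al be ah (annihilatorM ah).
  by congr annihilator; apply/funext => x; ring.
have pow h : annihilator m h -> annihilator m (fun x => (al + be * shifted m 1 x) ^+ N * h x).
  move=> ah; elim: N => [|n ih]; first by under eq_fun do rewrite expr0 mul1r.
  by under eq_fun do rewrite exprS -mulrA; exact: aff.
elim: k => [|k ih]; first by under eq_fun do rewrite expr0; exact: annihilator1.
have := annihilatorD 1 (-1) ih (pow _ ih).
by congr annihilator; apply/funext => x; rewrite exprS; ring.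
Qed.

(** On the period, the indicator of [[0, b]] is almost everywhere the bounded limit of polynomials
    in one cosine, and [f] is orthogonal to all of these; dominated convergence, with majorant
    [|f|], concludes. *)
Let avg_prefix (b : R) : 0 < b < L -> avg (fun x => f x * (x <= b)%R%:R) = 0.
Proof.
move=> /andP[b0 bL]; pose m := b / 2.
(* The cosine centred at the midpoint [m] of [[0, b]] exceeds its value at the endpoints exactly
   inside []0, b[], within one period. The factor [1/4] keeps [s] in [[0, 1]], and [s] crosses
   [1/2], the jump of the step polynomials, at [0], [b] and [L]. *)
pose s x := 2^-1 - 4^-1 * (shifted m 1 x - cos (freq 1 * m)).
pose H N x := (1 - s x ^+ N) ^+ (2 ^ N).
have aH N : annihilator m (H N).
  have := annihilator_poly m (2^-1 + 4^-1 * cos (freq 1 * m)) (- 4^-1) N (2 ^ N).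
  by congr annihilator; apply/funext => x; rewrite /H /s; congr ((1 - _ ^+ _) ^+ _); ring.
have H0 N : avg (fun x => f x * H N x) = 0.
  have [_ _ /(_ 0) <-] := aH N.
  by apply: eq_avg => x; rewrite /shifted freq0 mul0r cos0 mulr1.
have s01 x : 0 <= s x <= 1.
  have := cos_geN1 (freq 1 * (x - m)); have := cos_le1 (freq 1 * (x - m)).
  have := cos_geN1 (freq 1 * m); have := cos_le1 (freq 1 * m).
  by rewrite /s /shifted; lra.
have sE x : s x = 2^-1 + 2^-1 * (sin (freq 1 * (x / 2)) * sin (freq 1 * ((x - b) / 2))).
  rewrite /s /shifted (_ : freq 1 * (x - m) = freq 1 * (x / 2) + freq 1 * ((x - b) / 2)); last first.
    by rewrite /m; field.
  rewrite (_ : freq 1 * m = freq 1 * (x / 2) - freq 1 * ((x - b) / 2)); last first.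
    by rewrite /m; field.
  by rewrite cosD cosB; field.
have sinpos y : 0 < y < L -> 0 < sin (freq 1 * (y / 2)).
  move=> /andP[y0 yL]; apply: sin_gt0_pi; rewrite mulr_gt0 ?freq1_gt0 ?divr_gt0//=.
  have -> : freq 1 * (y / 2) = pi * (y / L) by rewrite /freq; field; rewrite gt_eqF.
  by rewrite gtr_pMr ?pi_gt0// ltr_pdivrMr// mul1r.
have Hlim x : 0 < x -> x < L -> x != b -> H N x @[N --> \oo] --> ((x <= b)%R%:R : R).
  move=> x0 xL xb; have p1 := sinpos x; rewrite x0 xL in p1; have {}p1 := p1 isT.
  have [/andP[s0 s1]] := s01 x.
  case: (ltgtP x b) xb => // xb _ /=.
    apply: heaviside_lt => //; rewrite sE.
    have := sinpos (b - x); rewrite subr_gt0 xb ltrBlDr (lt_trans bL) ?ltrDl// => /(_ isT).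
    by rewrite (_ : freq 1 * ((x - b) / 2) = - (freq 1 * ((b - x) / 2))) ?sinN; [nra|ring].
  apply: heaviside_gt => //; rewrite sE.
  have := sinpos (x - b); rewrite subr_gt0 xb ltrBlDr (lt_trans xL) ?ltrDl// => /(_ isT).
  by nra.
have H1 N x : `|H N x| <= 1.
  have /andP[s0 s1] := s01 x.
  have t0 : 0 <= s x ^+ N by rewrite exprn_ge0.
  have t1 : s x ^+ N <= 1 by rewrite exprn_ile1.
  by rewrite ger0_norm ?exprn_ge0 ?exprn_ile1 ?subr_ge0// gerBl.
have mfD := itg_meas itg_f.
have mH N : measurable_fun setT (H N) by case: (aH N).
have mind : measurable_fun setT (fun x : R => (x <= b)%R%:R : R).
  rewrite (_ : (fun x => _) = \1_(`]-oo, b]%classic)).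
    exact: measurable_indic.
  by apply/funext => x; rewrite indicE mem_setE in_itv.
have [] := @dominated_convergence _ _ _ mu `[0, L]%classic (measurable_itv _)
   (fun N x => (f x * H N x)%:E) (fun x => (f x * (x <= b)%R%:R)%:E) (fun x => `|f x|%:E).
- move=> N; apply/measurable_EFinP; apply: measurable_funM => //.
  exact: itg_mfun.
- apply/measurable_EFinP; apply: measurable_funM => //.
  exact: itg_mfun.
- pose P0 (x : R) := x != 0; pose PL (x : R) := x != L; pose Pb (x : R) := x != b.
  have a0L : {ae mu, forall x, P0 x /\ PL x}.
    by apply: (@ae_mono2 _ P0 PL) (ae_neq 0) (ae_neq L) => x ? ?.
  apply: (@ae_mono2 _ _ Pb) a0L (ae_neq b) => x [x0 xL] xb; rewrite /= in_itv/= => /andP[x0' xL'].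
  apply: cvg_EFin; first by near=> N.
  apply: cvgMr; apply: Hlim => //; rewrite lt_neqAle ?x0' ?xL' andbT.
    by rewrite eq_sym.
  exact: xL.
- exact: itg_norm.
- apply: aeW => x N _; rewrite /= lee_fin normrM -[leRHS]mulr1 ler_wpM2l//.
move=> ilim _; have lfin : (\int[mu]_(x in `[0%R, L]) (f x * (x <= b)%R%:R)%:E)%E \is a fin_num.
  exact: integrable_fin_num.
rewrite -(fineK lfin) => /fine_cvg; rewrite /avg /Rintegral.
set l := fine _ => h; suff -> : l = 0 by rewrite mulr0.
move: h; rewrite (_ : fine \o _ = cst 0); first by move=> /cvg_lim <-//; rewrite lim_cst.
apply/funext => N /=; have := H0 N; rewrite /avg /Rintegral => /eqP.
by rewrite mulf_eq0 invr_eq0 (gt_eqF L_gt0)/= => /eqP.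
Unshelve. all: end_near. Qed.

(** All integrals of [f] over [[0, b]] with [0 < b < L] vanish, so the primitive [F] is constant on
    the open period; Lebesgue differentiation identifies [f] with the derivative of [F] almost
    everywhere. The extension [g] by zero makes the integrand integrable on the whole line. *)
Lemma hart_eq0 : L2eq L f (fun=> 0).
Proof.
pose g := f \_ (`[0, L]%classic : set R).
have ig : mu.-integrable setT (EFin \o g).
  by rewrite -restrict_EFin; apply/integrable_restrict => //=; rewrite setTI.
pose F x := \int[mu]_(t in [set` Interval (BLeft 0) (BRight x)]) g t.
have F0 b : 0 < b < L -> F b = 0.
  move=> bL; have := avg_prefix bL; rewrite /avg => /eqP.
  rewrite mulf_eq0 invr_eq0 (gt_eqF L_gt0)/= => /eqP <-.
  rewrite /F Rintegral_mkcond [RHS]Rintegral_mkcond; congr (Rintegral mu setT _).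
  case/andP: bL => b0 bL.
  apply/funext => x; rewrite /g !patchE !mem_setE !in_itv/=.
  case: (leP 0 x) => x0 //=; case: (leP x b) => xb /=.
    by rewrite (le_trans xb (ltW bL)) mulr1.
  by rewrite mulr0 if_same.
have lg : locally_integrable setT g by exact: (integrable_locally _ itg_f).
have F_eq := ae_derive_prefix_integral ig lg.
have a0L : {ae mu, forall x, x != 0 /\ x != L}.
  by apply: (@ae_mono2 _ (fun x => x != 0) (fun x => x != L)) (ae_neq 0) (ae_neq L) => x ? ?.
apply: (@ae_mono2 R _ _ (fun x => `[0, L]%classic x -> f x = 0) _ a0L F_eq).
move=> x [x0 xL] dF; rewrite /= in_itv/= => /andP[x0' xL'].
have {}x0 : 0 < x by rewrite lt_neqAle x0' eq_sym x0.
have {}xL : x < L by rewrite lt_neqAle xL' xL.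
have [_] := dF x0; rewrite -/F.
rewrite /g patchE mem_setE in_itv/= (ltW x0) (ltW xL)/= => <-.
rewrite derive1E (@near_eq_derive _ _ _ F (cst 0)) ?derive_cst//.
have : x \in `]0, L[ by rewrite in_itv/= x0 xL.
by move=> /near_in_itvoo; apply: filterS => y; rewrite in_itv => /F0 ->.
Qed.

End uniqueness.

Lemma hart_inj (R : realType) (L : R) (f g : R -> R) : 0 < L ->
  itg L f -> itg L g -> hart L f =1 hart L g -> L2eq L f g.
Proof.
move=> L0 i1 i2 fg.
have h n : hart L (fun x => f x - g x) n = 0 by rewrite hartB// fg subrr.
apply: L2eqW (hart_eq0 L0 (itgB i1 i2) h) => x /eqP.
by rewrite subr_eq0 => /eqP.
Qed.

(** * Dominated convergence and Sobolev norms *)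

Section tannery.
Variable R : realType.

(** A finite set whose sum comes within [e] of the supremum of all finite sums leaves at most [e]
    for any set disjoint from it. *)
Lemma bsum_tail (B : int -> R) (K e : R) : 0 < e -> bsum B K ->
  exists2 s0, uniq s0 & forall s, uniq s -> {in s, forall n, n \notin s0} ->
    \sum_(n <- s) B n <= e.
Proof.
move=> e0 BK; pose S := [set x | exists2 s, uniq s & x = \sum_(n <- s) B n].
have supS : has_sup S.
  split; first by exists 0, [::] => //; rewrite big_nil.
  by exists K => _ [s us ->]; exact: BK.
have [_ [s0 us0 ->] h0] := sup_adherent e0 supS.
exists s0 => // s us ss0; have : \sum_(n <- s0 ++ s) B n <= sup S.
  apply: ub_le_sup; first by case: supS.
  exists (s0 ++ s) => //; rewrite cat_uniq us0 us andbT/=.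
  by apply/hasPn.
by rewrite big_cat/=; lra.
Qed.

(** The finite head tends to zero term by term, and the rest is below a tail of [B]. The filter is
    arbitrary because the lemma serves full, one-sided and punctured neighbourhoods. *)
Lemma tannery (T : Type) (F : set_system T) (FF : Filter F) (q : T -> int -> R)
    (B : int -> R) (K : R) :
  (\forall t \near F, forall n, 0 <= q t n <= B n) -> bsum B K ->
  (forall n, q t n @[t --> F] --> 0) ->
  forall e, 0 < e -> \forall t \near F, bsum (q t) e.
Proof.
move=> qB BK q0 e e0; have e20 : 0 < e / 2 by rewrite divr_gt0.
have [s0 us0 tail] := bsum_tail e20 BK.
have h : (\sum_(n <- s0) q t n) @[t --> F] --> 0.
  have := @cvg_seq_sum R T F FF _ s0 (fun n t => q t n) (fun=> 0) q0.
  by rewrite big1.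
near=> t => s us.
have qt : forall n, 0 <= q t n <= B n by near: t.
have q0' n : 0 <= q t n by have /andP[] := qt n.
rewrite (bigID [pred n | n \in s0])/= [leRHS]splitr lerD//.
  apply: (@le_trans _ _ (\sum_(n <- s0) q t n)).
    rewrite -big_filter; apply: ler_sum_subset => //; first exact: filter_uniq.
    by move=> n; rewrite mem_filter => /andP[].
  rewrite ltW//; near: t.
  by move/cvgrPdist_lt : h => /(_ _ e20); apply: filterS => t; rewrite sub0r normrN => /(le_lt_trans (ler_norm _)).
rewrite -big_filter; apply: le_trans (_ : \sum_(n <- [seq n <- s | n \notin s0]) B n <= _).
  by apply: ler_sum => n _; have /andP[] := qt n.
apply: tail; first exact: filter_uniq.
by move=> n; rewrite mem_filter => /andP[].
Unshelve. all: end_near. Qed.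

End tannery.

(** * Sobolev norms in terms of Hartley coefficients *)

Section sobolev.
Variables (R : realType) (L : R).
Hypothesis L_gt0 : 0 < L.
Local Notation itg := (itg L).
Local Notation hart := (hart L).
Implicit Types (f g : R -> R) (k : nat) (K : R).

Lemma Hs_termE k f n : itg f ->
  (1 + n%:~R ^+ 2) `^ k%:R * Normc.normc (fourier L f n) ^+ 2 =
  2^-1 * (wt R n ^+ k * hart f n ^+ 2 + wt R (- n) ^+ k * hart f (- n) ^+ 2).
Proof.
move=> i1; rewrite powR_mulrn ?addr_ge0 ?sqr_ge0// normc_fourier// wtN -/(wt R n).
by ring.
Qed.

Lemma Hs_sqnorm_le k f K : itg f ->
  bsum (fun n => wt R n ^+ k * hart f n ^+ 2) K ->
  (Hs_sqnorm L k%:R f <= (L * K)%:E)%E.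
Proof.
move=> i1 hK; rewrite /Hs_sqnorm EFinM lee_wpmul2l ?lee_fin ?(ltW L_gt0)//.
apply: ge_ereal_sup => _ [X [finX _] <-].
rewrite fsbig_finite//= sumEFin lee_fin.
under eq_bigr do rewrite Hs_termE//.
rewrite -mulr_sumr big_split/= ler_pdivrMl// mulr_natl mulr2n.
apply: lerD; first by apply: hK; exact: finmap.fset_uniq.
by apply: (bsum_inj (@oppr_inj int) hK); exact: finmap.fset_uniq.
Qed.

(** Each complex term is half the sum of the real terms at [n] and [- n]; the latter is dropped as
    nonnegative, which costs the factor 2. *)
Lemma bsum_Hs_sqnorm k f K : itg f ->
  (Hs_sqnorm L k%:R f <= (L * K)%:E)%E ->
  bsum (fun n => wt R n ^+ k * hart f n ^+ 2) (2 * K).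
Proof.
move=> i1; rewrite /Hs_sqnorm EFinM lee_pmul2l ?lte_fin// => hK s us.
have : (\sum_(n <- s) ((1 + n%:~R ^+ 2) `^ k%:R * Normc.normc (fourier L f n) ^+ 2)%:E <= K%:E)%E.
  apply: le_trans hK; apply: esum_ge; exists [set` s]; first by split => //; exact: finite_seq.
  by rewrite fsbig_seq.
rewrite sumEFin lee_fin; under eq_bigr do rewrite Hs_termE//.
rewrite -mulr_sumr big_split/= ler_pdivrMl// => /(le_trans _); apply.
rewrite lerDl sumr_ge0// => n _.
by apply: mulr_ge0; [apply/exprn_ge0/wt_ge0|exact: sqr_ge0].
Qed.

Lemma Hs_sqnorm_ge0 (s : R) f : (0 <= Hs_sqnorm L s f)%E.
Proof.
rewrite mule_ge0 ?lee_fin ?(ltW L_gt0)// esum_ge0// => n _.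
by rewrite lee_fin mulr_ge0 ?powR_ge0 ?sqr_ge0.
Qed.

Lemma Hs_sqnorm_bsum k f : itg f -> (Hs_sqnorm L k%:R f < +oo)%E ->
  exists K, bsum (fun n => wt R n ^+ k * hart f n ^+ 2) K.
Proof.
move=> i1 foo; have := Hs_sqnorm_ge0 k%:R f.
case E : (Hs_sqnorm _ _ _) foo => [r| |]// _ _; exists (2 * (r / L)).
by apply: bsum_Hs_sqnorm => //; rewrite E lee_fin mulrC divfK// gt_eqF.
Qed.

(** With its converse [cvg0_Hs_norm], this trades convergence in H^k for smallness of weighted
    square sums of coefficients. The norm takes extended real values, so finiteness near the limit
    is part of the claim. *)
Lemma Hs_norm_cvg0 (T : Type) (F : set_system T) (FF : Filter F) k (f_ : T -> R -> R) :
  (\forall t \near F, itg (f_ t)) ->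
  (forall e, 0 < e -> \forall t \near F,
    bsum (fun n => wt R n ^+ k * hart (f_ t) n ^+ 2) e) ->
  Hs_norm L k%:R (f_ t) @[t --> F] --> 0%E.
Proof.
move=> fi fe; have key (d : R) : 0 < d -> \forall t \near F, (Hs_norm L k%:R (f_ t) <= d%:E)%E.
  move=> d0; have e0 : 0 < d ^+ 2 / L by rewrite divr_gt0// exprn_gt0.
  near=> t; rewrite /Hs_norm.
  have -> : d%:E = sqrte (L * (d ^+ 2 / L))%:E.
    by rewrite mulrC divfK ?gt_eqF//= sqrtr_sqr ger0_norm// ltW.
  have dL : (0 <= (L * (d ^+ 2 / L))%:E)%E by rewrite lee_fin mulr_ge0 ?ltW.
  rewrite lee_sqrt//; apply: Hs_sqnorm_le.
    by near: t.
  by near: t; exact: fe.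
have ge0 t : (0 <= Hs_norm L k%:R (f_ t))%E by exact: sqrte_ge0.
apply/fine_cvgP; split.
  apply: filterS (key 1 ltr01) => t ht.
  by rewrite ge0_fin_numE// (le_lt_trans ht)// ltry.
apply/cvgrPdist_le => /= e e0; apply: filterS (key e e0) => t ht.
rewrite sub0r normrN ger0_norm ?fine_ge0// -lee_fin fineK//.
by rewrite ge0_fin_numE// (le_lt_trans ht)// ltry.
Unshelve. all: end_near. Qed.

Lemma cvg0_Hs_norm (T : Type) (F : set_system T) (FF : Filter F) k (f_ : T -> R -> R) :
  Hs_norm L k%:R (f_ t) @[t --> F] --> 0%E -> (\forall t \near F, itg (f_ t)) ->
  forall e, 0 < e -> \forall t \near F,
    bsum (fun n => wt R n ^+ k * hart (f_ t) n ^+ 2) e.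
Proof.
move=> f0 fi e e0; pose d := L * (e / 2).
have d0 : 0 < d by rewrite mulr_gt0// divr_gt0.
have sd0 : 0 < Num.sqrt d by rewrite sqrtr_gt0.
have /fine_cvgP[ffin /cvgrPdist_lt/(_ _ sd0) flim] := f0.
near=> t; rewrite (_ : e = 2 * (e / 2)); last by field.
apply: bsum_Hs_sqnorm; first by near: t.
have d0' : (0 <= d%:E)%E by rewrite lee_fin ltW.
rewrite -/d -lee_sqrt//.
have hf : Hs_norm L k%:R (f_ t) \is a fin_num by near: t.
rewrite -/(Hs_norm L k%:R (f_ t)) -(fineK hf) lee_fin.
have : `|0 - (fine \o (fun t => Hs_norm L k%:R (f_ t))) t| < Num.sqrt d by near: t.
by rewrite sub0r normrN => /ltW /(le_trans (ler_norm _)).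
Unshelve. all: end_near. Qed.

End sobolev.

(** * Weak second derivatives *)

Section weak_derivative.
Variables (R : realType) (L : R).
Hypothesis L_gt0 : 0 < L.
Local Notation mu := (@lebesgue_measure R).
Local Notation avg := (avg L).
Local Notation itg := (itg L).
Local Notation cas := (cas L).
Local Notation hart := (hart L).
Local Notation freq := (freq L).
Local Notation syn := (syn L).

Lemma itg_continuous (f : R -> R) : continuous f -> itg f.
Proof.
move=> cf; apply: continuous_compact_integrable; first exact: segment_compact.
exact: continuous_subspaceT.
Qed.

Lemma Rintegral_avg (f : R -> R) : \int[mu]_(x in `[0, L]) f x = L * avg f.
Proof. by rewrite /avg mulVKf ?gt_eqF. Qed.

Lemma derive1_periodic (f : R -> R) : (forall x, derivable f x 1) ->
  periodic f L -> periodic (derive1 f) L.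
Proof.
move=> df pf x.
have d1 : is_derive x (1 : R) (fun y => f (y + L)) (derive1 f (x + L)).
  have dL : is_derive (x + L) (1 : R) f (derive1 f (x + L)).
    by rewrite derive1E; apply/derivableP; exact: df.
  have dS : is_derive x (1 : R) (fun y : R => y + L) 1 by apply: is_derive_eq; rewrite addr0.
  by have := @is_derive1_comp _ f (fun y => y + L) x _ _ dL dS; rewrite mulr1.
rewrite (_ : (fun y => f (y + L)) = f) in d1; last by apply/funext => y; rewrite pf.
by rewrite [RHS]derive1E; case: d1.
Qed.

Lemma is_derive_cas n x :
  is_derive x (1 : R) (cas n) (freq n * (cos (freq n * x) - sin (freq n * x))).
Proof. by rewrite /cas; apply: is_derive_eq; rewrite /GRing.scale/=; ring. Qed.

Lemma test_function_derivable zeta k x : test_function L zeta ->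
  is_derive x (1 : R) (derive1n k zeta) (derive1n k.+1 zeta x).
Proof.
move=> [_ dz]; rewrite derive1nS derive1E; apply/derivableP; exact: dz.
Qed.

Lemma test_function_continuous zeta k : test_function L zeta ->
  continuous (derive1n k zeta).
Proof.
by move=> tz; apply: is_derive_continuous => x; exact: test_function_derivable.
Qed.

Lemma hart_test_function zeta n : test_function L zeta ->
  hart (derive1n 2 zeta) n = - freq n ^+ 2 * hart zeta n.
Proof.
move=> tz; have [pz dz] := tz.
pose C x := freq n * (cos (freq n * x) - sin (freq n * x)).
(* The Wronskian of [zeta] and [cas n]: it is periodic, so its derivative has mean zero. This
   performs both integrations by parts at once. *)
pose W x := derive1n 1 zeta x * cas n x - zeta x * C x.
have d0 x : is_derive x (1 : R) zeta (derive1n 1 zeta x).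
  exact: (test_function_derivable 0 x tz).
have d1 x : is_derive x (1 : R) (derive1n 1 zeta) (derive1n 2 zeta x).
  exact: (test_function_derivable 1 x tz).
have dcas x := is_derive_cas n x.
have dC x : is_derive x (1 : R) C (- freq n ^+ 2 * cas n x).
  by rewrite /C /cas; apply: is_derive_eq; rewrite /GRing.scale/=; ring.
have cz := @test_function_continuous _ 0 tz; rewrite derive1n0 in cz.
have c2 := @test_function_continuous _ 2 tz.
have dW x : is_derive x (1 : R) W (derive1n 2 zeta x * cas n x + freq n ^+ 2 * (zeta x * cas n x)).
  have e1 := is_deriveM (d1 x) (dcas x).
  have e2 := is_deriveM (d0 x) (dC x).
  by apply: (is_derive_eq (is_deriveB e1 e2)); rewrite /GRing.scale/= /C; ring.
have W0 : W L = W 0.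
  suff /(_ 0) : periodic W L by rewrite add0r.
  move=> x; rewrite /W cas_periodic// pz.
  rewrite (_ : derive1n 1 zeta (x + L) = derive1n 1 zeta x); last first.
    by rewrite derive1n1; apply: derive1_periodic => // y; have := dz 0%N y; rewrite derive1n0.
  by rewrite /C [freq n * (x + L)]mulrDr freqL// cosD2pin sinD2pin.
have cF : continuous (fun x => derive1n 2 zeta x * cas n x + freq n ^+ 2 * (zeta x * cas n x)).
  move=> x; apply: cvgD; first by apply: cvgM; [exact: c2|exact: cas_continuous].
  by apply: cvgMr; apply: cvgM; [exact: cz|exact: cas_continuous].
have := avg_FTC L_gt0 dW cF; rewrite W0 subrr mulr0.
have iz := itg_mul_cas n (itg_continuous cz).
have i2 := itg_mul_cas n (itg_continuous c2).
by rewrite avgD// ?avgZ//; [rewrite /hart; lra|exact: itgZ].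
Qed.

(** Paired with a test function, both sides are limits of the same partial sums, because
    [hart_test_function] moves [- freq n ^+ 2] from one factor to the other. *)
Lemma weak_deriv_syn a : smb a -> smb (fun n => - freq n ^+ 2 * a n) ->
  weak_deriv L 2 (syn a) (syn (fun n => - freq n ^+ 2 * a n)).
Proof.
move=> sa sa2; split; first exact: syn_L2per.
move=> zeta tz; rewrite !Rintegral_avg sqrrN expr1n mul1r; congr (_ * _).
have i0 : itg zeta.
  by apply: itg_continuous; have := @test_function_continuous _ 0 tz; rewrite derive1n0.
have i2 : itg (derive1n 2 zeta).
  by apply: itg_continuous; exact: test_function_continuous.
have h1 := avg_syn L_gt0 sa i2; have h2 := avg_syn L_gt0 sa2 i0.
rewrite -(cvg_lim _ h1)// -(cvg_lim _ h2)//; congr (limn _); apply/funext => N.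
by apply: eq_bigr => i _; rewrite hart_test_function//; ring.
Qed.

(** The values of [al] and [be] do not matter: the shape shows that [cas n] is derivable to every
    order, hence a test function. *)
Lemma derive1n_cas_shape n k : exists al be : R,
  derive1n k (cas n) = (fun x => al * cos (freq n * x) + be * sin (freq n * x)).
Proof.
elim: k => [|k [al [be E]]].
  by exists 1, 1; rewrite derive1n0; apply/funext => x; rewrite !mul1r.
exists (be * freq n), (- al * freq n); rewrite derive1nS E; apply/funext => x.
rewrite derive1E.
have dd : is_derive x (1 : R) (fun x => al * cos (freq n * x) + be * sin (freq n * x))
   (be * freq n * cos (freq n * x) + - al * freq n * sin (freq n * x)).
  by apply: is_derive_eq; rewrite /GRing.scale/=; ring.
by case: dd.
Qed.

Lemma test_function_cas n : test_function L (cas n).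
Proof.
split; first exact: cas_periodic.
by move=> k x; have [al [be ->]] := derive1n_cas_shape n k.
Qed.

Lemma hart_weak_deriv f g n : itg f -> weak_deriv L 2 f g ->
  hart g n = - freq n ^+ 2 * hart f n.
Proof.
move=> i1 [Lg /(_ _ (test_function_cas n))].
rewrite !Rintegral_avg sqrrN expr1n mul1r => /mulfI fg.
rewrite /hart -fg ?gt_eqF// -avgZ; last exact: itg_mul_cas.
apply: eq_avg => x; rewrite mulrCA; congr (_ * _).
rewrite derive1nS derive1n1 derive1E.
have -> : derive1 (cas n) = (fun x => freq n * (cos (freq n * x) - sin (freq n * x))).
  by apply/funext => y; rewrite derive1E; have [] := is_derive_cas n y.
have dC : is_derive x (1 : R) (fun x => freq n * (cos (freq n * x) - sin (freq n * x)))
    (- freq n ^+ 2 * cas n x).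
  by rewrite /cas; apply: is_derive_eq; rewrite /GRing.scale/=; ring.
by case: dC.
Qed.

End weak_derivative.

(** * Forced oscillators *)

Section oscillator.
Variable R : realType.
Local Notation mu := (@lebesgue_measure R).
Implicit Types (g G : R -> R) (k c d t B : R).

Lemma is_derive_cont (f : R -> R) (x df : R) : is_derive x (1 : R) f df -> {for x, continuous f}.
Proof. by move=> [dfx _]; exact/differentiable_continuous/derivable1_diffP. Qed.

(* The base point [-1] makes [prim g] differentiable on a neighbourhood of [0]. *)
Definition prim g t := \int[mu]_(s in `[-1, t]) g s - \int[mu]_(s in `[-1, 0]) g s.

Lemma prim0 g : prim g 0 = 0.
Proof. by rewrite /prim subrr. Qed.

Lemma integrable_itv_continuous g (a b : R) : continuous g ->
  mu.-integrable `[a, b] (EFin \o g).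
Proof.
move=> cg; apply: continuous_compact_integrable; first exact: segment_compact.
exact: continuous_subspaceT.
Qed.

Lemma is_derive_prim g t : continuous g -> -1 < t -> is_derive t (1 : R) (prim g) (g t).
Proof.
move=> cg t1; have tt1 : t < t + 1 by rewrite ltrDl.
have [dF F'] := continuous_FTC1_closed tt1 (integrable_itv_continuous _ _ cg) t1 (cg t).
have dF' : is_derive t (1 : R) (fun y => \int[mu]_(s in `[-1, y]) g s) (g t).
  by split => //; rewrite -derive1E.
by rewrite /prim; apply: is_derive_eq; rewrite subr0.
Qed.

Lemma primB g G t : continuous g -> continuous G ->
  prim (fun s => g s - G s) t = prim g t - prim G t.
Proof.
move=> cg cG; rewrite /prim !RintegralB//; try exact: integrable_itv_continuous.
by ring.
Qed.

Lemma norm_prim g B t : continuous g -> 0 <= t -> (forall s, `|g s| <= B) ->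
  `|prim g t| <= t * B.
Proof.
move=> cg t0 gB.
have dF s : s \in `]0, t[ -> is_derive s (1 : R) (prim g) (g s).
  by rewrite in_itv/= => /andP[s0 _]; apply: is_derive_prim => //; lra.
have cF : {within `[0, t], continuous (prim g)}.
  apply: derivable_within_continuous => s; rewrite in_itv/= => /andP[s0 _].
  by have [] : is_derive s (1 : R) (prim g) (g s) by apply: is_derive_prim => //; lra.
have [s _] := MVT_segment t0 dF cF.
by rewrite prim0 !subr0 => ->; rewrite normrM (ger0_norm t0) mulrC ler_wpM2l.
Qed.

Lemma continuous_cosM k G : continuous G -> continuous (fun s => cos (k * s) * G s).
Proof. by move=> cG s; apply: cvgM; [exact: cos_lin_continuous|exact: cG]. Qed.

Lemma continuous_sinM k G : continuous G -> continuous (fun s => sin (k * s) * G s).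
Proof. by move=> cG s; apply: cvgM; [exact: sin_lin_continuous|exact: cG]. Qed.

(** Duhamel's kernel [sin (k * (t - s))] is expanded by the addition formula, so that [t] leaves the
    integrand and only primitives in the upper bound have to be differentiated. *)
Definition cosprim k G := prim (fun s => cos (k * s) * G s).
Definition sinprim k G := prim (fun s => sin (k * s) * G s).

(* Variation of constants for [y'' + k^2 y = G], [y 0 = c], [y' 0 = d]. *)
Definition mode k c d G t :=
  c * cos (k * t) + d / k * sin (k * t) +
  k^-1 * (sin (k * t) * cosprim k G t - cos (k * t) * sinprim k G t).

Definition dmode k c d G t :=
  - (k * c) * sin (k * t) + d * cos (k * t) +
  (cos (k * t) * cosprim k G t + sin (k * t) * sinprim k G t).

Lemma mode0 k c d G : mode k c d G 0 = c.
Proof.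
by rewrite /mode mulr0 cos0 sin0 /cosprim /sinprim !prim0; ring.
Qed.

Lemma dmode0 k c d G : dmode k c d G 0 = d.
Proof.
by rewrite /dmode mulr0 cos0 sin0 /cosprim /sinprim !prim0; ring.
Qed.

Lemma is_derive_mode k c d G t : k != 0 -> continuous G -> -1 < t ->
  is_derive t (1 : R) (mode k c d G) (dmode k c d G t).
Proof.
move=> k0 cG t1.
have dC := is_derive_prim (@continuous_cosM k G cG) t1.
have dS := is_derive_prim (@continuous_sinM k G cG) t1.
rewrite -/(cosprim k G) in dC; rewrite -/(sinprim k G) in dS.
have dc := is_derive_cos_lin k t; have ds := is_derive_sin_lin k t.
have e1 := is_deriveM ds dC; have e2 := is_deriveM dc dS.
have e3 := is_deriveZ (k^-1) (is_deriveB e1 e2).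
have e4 := is_deriveD (is_deriveD (is_deriveZ c dc) (is_deriveZ (d / k) ds)) e3.
by apply: (is_derive_eq e4); rewrite /dmode /GRing.scale/=; field.
Qed.

Lemma is_derive_dmode k c d G t : k != 0 -> continuous G -> -1 < t ->
  is_derive t (1 : R) (dmode k c d G) (- k ^+ 2 * mode k c d G t + G t).
Proof.
move=> k0 cG t1.
have dC := is_derive_prim (@continuous_cosM k G cG) t1.
have dS := is_derive_prim (@continuous_sinM k G cG) t1.
rewrite -/(cosprim k G) in dC; rewrite -/(sinprim k G) in dS.
have dc := is_derive_cos_lin k t; have ds := is_derive_sin_lin k t.
have e1 := is_deriveM dc dC; have e2 := is_deriveM ds dS.
have e4 := is_deriveD (is_deriveD (is_deriveZ (- (k * c)) ds) (is_deriveZ d dc)) (is_deriveD e1 e2).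
apply: (is_derive_eq e4); rewrite /mode /GRing.scale/=.
have cs : cos (k * t) * (cos (k * t) * G t) + sin (k * t) * (sin (k * t) * G t) = G t.
  by rewrite !mulrA -mulrDl -!expr2 cos2Dsin2 mul1r.
by rewrite -{3}cs; field.
Qed.

Lemma norm_cosprim k G B t : continuous G -> 0 <= t -> (forall s, `|G s| <= B) ->
  `|cosprim k G t| <= t * B.
Proof.
move=> cG t0 GB; apply: norm_prim => //; first exact: continuous_cosM.
by move=> s; rewrite normrM -[leRHS]mul1r ler_pM// cos_max.
Qed.

Lemma norm_sinprim k G B t : continuous G -> 0 <= t -> (forall s, `|G s| <= B) ->
  `|sinprim k G t| <= t * B.
Proof.
move=> cG t0 GB; apply: norm_prim => //; first exact: continuous_sinM.
by move=> s; rewrite normrM -[leRHS]mul1r ler_pM// sin_max.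
Qed.

Lemma norm_mul_le (a b A : R) : `|a| <= 1 -> `|b| <= A -> `|a * b| <= A.
Proof. by move=> a1 bA; rewrite normrM -[leRHS]mul1r ler_pM. Qed.

(** The division of the forcing by [|k|] is the gain of one derivative; the corresponding bound for
    [dmode] has none. *)
Lemma norm_mode k c d G B t : continuous G -> 0 <= t -> (forall s, `|G s| <= B) ->
  `|mode k c d G t| <= `|c| + `|d| / `|k| + 2 * t * B / `|k|.
Proof.
move=> cG t0 GB; have hC := norm_cosprim k cG t0 GB; have hS := norm_sinprim k cG t0 GB.
apply: le_trans (ler_normD _ _) _; apply: lerD.
  apply: le_trans (ler_normD _ _) _; apply: lerD.
    by rewrite mulrC; apply: norm_mul_le => //; exact: cos_max.
  rewrite mulrC; apply: norm_mul_le; first exact: sin_max.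
  by rewrite normrM normfV.
rewrite normrM normfV mulrC ler_wpM2r ?invr_ge0//.
apply: le_trans (ler_normB _ _) _; rewrite -mulrA mulr_natl mulr2n; apply: lerD.
  by apply: norm_mul_le => //; exact: sin_max.
by apply: norm_mul_le => //; exact: cos_max.
Qed.

Lemma norm_dmode k c d G B t : continuous G -> 0 <= t -> (forall s, `|G s| <= B) ->
  `|dmode k c d G t| <= `|k| * `|c| + `|d| + 2 * t * B.
Proof.
move=> cG t0 GB; have hC := norm_cosprim k cG t0 GB; have hS := norm_sinprim k cG t0 GB.
apply: le_trans (ler_normD _ _) _; apply: lerD.
  apply: le_trans (ler_normD _ _) _; apply: lerD.
    rewrite mulrC; apply: norm_mul_le; first exact: sin_max.
    by rewrite normrN normrM.
  by rewrite mulrC; apply: norm_mul_le => //; exact: cos_max.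
apply: le_trans (ler_normD _ _) _; rewrite -mulrA mulr_natl mulr2n; apply: lerD.
  by apply: norm_mul_le => //; exact: cos_max.
by apply: norm_mul_le => //; exact: sin_max.
Qed.

Lemma modeB k c d G G' t : continuous G -> continuous G' ->
  mode k c d G t - mode k c d G' t = mode k 0 0 (fun s => G s - G' s) t.
Proof.
move=> cG cG'; rewrite /mode /cosprim /sinprim.
rewrite (_ : (fun s => cos (k * s) * (G s - G' s)) =
  (fun s => cos (k * s) * G s - cos (k * s) * G' s)); last first.
  by apply/funext => s; rewrite mulrBr.
rewrite (_ : (fun s => sin (k * s) * (G s - G' s)) =
  (fun s => sin (k * s) * G s - sin (k * s) * G' s)); last first.
  by apply/funext => s; rewrite mulrBr.
rewrite !primB; try exact: continuous_cosM; try exact: continuous_sinM.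
by ring.
Qed.

Lemma norm_modeB k c d G G' B t : continuous G -> continuous G' -> 0 <= t ->
  (forall s, `|G s - G' s| <= B) ->
  `|mode k c d G t - mode k c d G' t| <= 2 * t * B / `|k|.
Proof.
move=> cG cG' t0 GB; rewrite modeB//.
have cGG : continuous (fun s => G s - G' s) by move=> s; apply: cvgB; [exact: cG|exact: cG'].
by have := norm_mode k 0 0 cGG t0 GB; rewrite normr0 mul0r !add0r.
Qed.

(** Projection onto [[0, T]]: it makes the iterates continuous and bounded on the whole line, so
    that suprema and continuity need no restriction to an interval. *)
Definition clamp (T t : R) := Num.max 0 (Num.min t T).

Lemma clamp_ge0 T t : 0 <= clamp T t.
Proof. by rewrite le_max lexx. Qed.

Lemma clamp_le T t : 0 <= T -> clamp T t <= T.
Proof. by move=> T0; rewrite ge_max T0 ge_min lexx orbT. Qed.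

Lemma clamp_id T t : 0 <= t <= T -> clamp T t = t.
Proof. by move=> /andP[t0 tT]; rewrite /clamp (min_idPl tT) (max_idPr t0). Qed.

Lemma clamp_continuous T : continuous (clamp T).
Proof.
move=> t; apply: (@continuous_max R R (cst 0) (fun t => Num.min t T)).
  exact: cst_continuous.
apply: (@continuous_min R R id (cst T)); last exact: cst_continuous.
exact: cvg_id.
Qed.

End oscillator.

(** * The cubic nonlinearity *)

Section majorized.
Variables (R : realType) (T : Type).
Hypothesis t0 : T.
Implicit Types (h : int -> T -> R) (K : R).

(* [sum_n wt n * sup_t |h n t| <= K], without mentioning the supremum *)
Definition maj h K := forall tau : int -> T, bsum (fun n => wt R n * `|h n (tau n)|) K.

Lemma maj_ge0 h K : maj h K -> 0 <= K.
Proof. by move=> /(_ (fun=> t0)) /bsum_ge0. Qed.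

Lemma maj_at h K t : maj h K -> bsum (fun n => `|h n t|) K.
Proof. by move=> hK; apply: bsum_unweight => //; exact: (hK (fun=> t)). Qed.

Lemma majD h h' K K' : maj h K -> maj h' K' -> maj (fun n t => h n t + h' n t) (K + K').
Proof.
move=> hK hK' tau; apply: bsum_le (bsumD (hK tau) (hK' tau)) => n.
by rewrite -mulrDr ler_wpM2l ?wt_ge0// ler_normD.
Qed.

Lemma majN h K : maj h K -> maj (fun n t => - h n t) K.
Proof. by move=> hK tau; apply: bsum_le (hK tau) => n; rewrite normrN. Qed.

Lemma maj_wider h K K' : K <= K' -> maj h K -> maj h K'.
Proof. by move=> KK hK tau; exact: bsum_wider KK (hK tau). Qed.

Lemma maj_of_bound h (M : int -> R) K : (forall n t, `|h n t| <= M n) ->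
  bsum (fun n => wt R n * M n) K -> maj h K.
Proof.
by move=> hM MK tau; apply: bsum_le MK => n; rewrite ler_wpM2l ?wt_ge0.
Qed.

(** [M n] is the supremum over time of [|h n t|]. For a finite set of indices, near-maximising times
    chosen separately for each [n] form a selection [tau], and [maj] allows every selection; the
    error [e / (size s + 1)] per index adds up to at most [e]. *)
Lemma maj_bound h K : maj h K -> exists M : int -> R,
  [/\ forall n, 0 <= M n, forall n t, `|h n t| <= M n &
   bsum (fun n => wt R n * M n) K].
Proof.
move=> hK; pose S n := [set x | exists t, x = wt R n * `|h n t|].
have supS n : has_sup (S n).
  split; first by exists (wt R n * `|h n t0|), t0.
  by exists K => _ [t ->]; exact: (bsum1 n (hK (fun=> t))).
have leS n t : wt R n * `|h n t| <= sup (S n).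
  by apply: ub_le_sup; [case: (supS n)|exists t].
exists (fun n => (wt R n)^-1 * sup (S n)); split.
- move=> n; apply: mulr_ge0; first by rewrite invr_ge0 wt_ge0.
  by apply: le_trans (leS n t0); rewrite mulr_ge0 ?wt_ge0.
- by move=> n t; rewrite ler_pdivlMl ?wt_gt0//.
- move=> s us; apply/ler_addgt0Pr => e e0.
  pose e' := e / ((size s)%:R + 1).
  have e'0 : 0 < e' by rewrite divr_gt0// ltr_wpDl.
  have /choice[tau htau] n : exists t, sup (S n) - e' < wt R n * `|h n t|.
    by have [_ [t ->] ?] := sup_adherent e'0 (supS n); exists t.
  apply: le_trans (_ : \sum_(n <- s) (wt R n * `|h n (tau n)| + e') <= _).
    apply: ler_sum => n _; rewrite mulrA mulfV ?gt_eqF ?wt_gt0// mul1r.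
    by rewrite -lerBlDr ltW.
  rewrite big_split/= lerD ?hK// big_const_seq count_predT iter_addr addr0.
  rewrite -mulr_natl /e' mulrA ler_pdivrMr ?ltr_wpDl// mulrC ler_pM2l//.
  by rewrite lerDl.
Qed.

End majorized.

(** * The cube on coefficient curves *)

Section cubic.
Variables (R : realType) (L : R).
Hypothesis L_gt0 : 0 < L.
Local Notation itg := (itg L).
Local Notation hart := (hart L).
Local Notation syn := (syn L).
Implicit Types (h : int -> R -> R) (K : R).

Definition field h t x := syn (h ^~ t) x.

Definition cube h n t := hart (fun x => field h t x ^+ 3) n.

Lemma maj_smb h K t : maj h K -> smb (h ^~ t).
Proof. by move=> hK; exists K; exact: (maj_at t hK). Qed.

Lemma norm_field h K t x : maj h K -> `|field h t x| <= K * 2.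
Proof. by move=> hK; apply: norm_syn; exact: (maj_at t hK). Qed.

Lemma measurable_field h K t : maj h K -> measurable_fun setT (field h t).
Proof. by move=> /(maj_smb t) sh; exact: measurable_syn. Qed.

Lemma hart_field_mul h h' K K' (M M' : int -> R) t n : maj h K -> maj h' K' ->
  (forall n t, `|h n t| <= M n) -> (forall n t, `|h' n t| <= M' n) ->
  bsum (fun n => wt R n * M n) K -> bsum (fun n => wt R n * M' n) K' ->
  `|hart (fun x => field h t x * field h' t x) n| <= majconv M M' n.
Proof.
move=> hK hK' hM hM' MK MK'.
have M0 m : 0 <= M m by exact: le_trans (hM m 0).
have M'0 m : 0 <= M' m by exact: le_trans (hM' m 0).
have sh' := maj_smb t hK'.
apply: (norm_hart_mul L_gt0 n (hM ^~ t) (bsum_unweight M0 MK) (itg_syn L_gt0 sh')).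
- by move=> m; rewrite hart_syn.
- by move=> m; exact: (bsum1 m (bsum_unweight M'0 MK')).
Qed.

(* [f^3 - g^3 = (f - g) (f^2 + f g + g^2)] *)
Lemma maj_cubeB h h' K d : maj h K -> maj h' K -> maj (fun n t => h n t - h' n t) d ->
  maj (fun n t => cube h n t - cube h' n t) (192 * K ^+ 2 * d).
Proof.
move=> hK hK' hd.
have [M1 [M10 hM1 M1K]] := maj_bound 0 hK.
have [M2 [M20 hM2 M2K]] := maj_bound 0 hK'.
have [D [D0 hD Dd]] := maj_bound 0 hd.
(* One majorant for both functions gives the three quadratic products a common bound, at the price
   of [2 * K] in place of [K]. *)
pose M n := M1 n + M2 n.
have M0 n : 0 <= M n by rewrite addr_ge0.
have MK : bsum (fun n => wt R n * M n) (2 * K).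
  rewrite mulr_natl mulr2n; apply: bsum_le (bsumD M1K M2K) => n.
  by rewrite mulrDr.
have hM n t : `|h n t| <= M n by rewrite (le_trans (hM1 n t))// lerDl.
have hM' n t : `|h' n t| <= M n by rewrite (le_trans (hM2 n t))// lerDr.
have K2 : K <= 2 * K by have := maj_ge0 0 hK; lra.
have hK2 := maj_wider K2 hK; have hK2' := maj_wider K2 hK'.
pose B n := 3 * majconv M M n.
have cvM0 n : 0 <= majconv M M n.
  apply: (majconv_ge0 n M0 (bsum_unweight M0 MK)) => m; rewrite M0.
  exact: (bsum1 m (bsum_unweight M0 MK)).
have BK : bsum (fun n => wt R n * B n) (3 * (4 * (2 * K) * (2 * K))).
  have := majconv_bsum M0 M0 MK MK => /(bsumZ (ler0n _ 3)); apply: bsum_le => n.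
  by rewrite /B mulrCA.
have B0 n : 0 <= B n by rewrite mulr_ge0.
(* The quadratic factor has bound [3 * 4 * (2 * K) ^+ 2 = 48 * K ^+ 2], and one more product with
   the difference gives [4 * d * 48 * K ^+ 2], hence 192. *)
apply: (@maj_of_bound _ _ _ (majconv D B)); last first.
  have := majconv_bsum D0 B0 Dd BK; apply: bsum_wider; by lra.
move=> n t.
have sh := maj_smb t hK; have sh' := maj_smb t hK'.
pose f x := field h t x; pose f' x := field h' t x.
have mf : measurable_fun setT f := measurable_field t hK.
have mf' : measurable_fun setT f' := measurable_field t hK'.
have bf x : `|f x| <= K * 2 := norm_field t x hK.
have bf' x : `|f' x| <= K * 2 := norm_field t x hK'.
have i2 (p q : R -> R) : measurable_fun setT p -> measurable_fun setT q ->
    (forall x, `|p x| <= K * 2) -> (forall x, `|q x| <= K * 2) ->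
    itg (fun x => p x * q x).
  move=> mp mq bp bq; apply: (itgM (M := K * 2)) => //.
  exact: (itg_bounded L_gt0 mp bp).
pose g x := f x * f x + f x * f' x + f' x * f' x.
have ig : itg g by apply: itgD; [apply: itgD|]; exact: i2.
rewrite (_ : cube h n t - cube h' n t =
   hart (fun x => syn (fun m => h m t - h' m t) x * g x) n); last first.
  rewrite /cube -hartB//.
  - by apply: eq_avg => x; rewrite synB// /g /f /f' /field; ring.
  - by apply: (itg_bounded L_gt0 (M := (K * 2) ^+ 3));
      [exact: measurable_funX|move=> x; rewrite normrX lerXn2r// nnegrE (le_trans _ (bf x))].
  - by apply: (itg_bounded L_gt0 (M := (K * 2) ^+ 3));
      [exact: measurable_funX|move=> x; rewrite normrX lerXn2r// nnegrE (le_trans _ (bf' x))].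
apply: (norm_hart_mul L_gt0 n (hD ^~ t) (bsum_unweight D0 Dd) ig).
- move=> m; rewrite /g hartD//; [|by apply: itgD; exact: i2|exact: i2].
  rewrite hartD//; [|exact: i2|exact: i2].
  rewrite /B (_ : 3 * majconv M M m = majconv M M m + majconv M M m + majconv M M m); last by ring.
  apply: le_trans (ler_normD _ _) _; apply: lerD.
    apply: le_trans (ler_normD _ _) _; apply: lerD.
      exact: (hart_field_mul t m hK2 hK2 hM hM MK MK).
    exact: (hart_field_mul t m hK2 hK2' hM hM' MK MK).
  exact: (hart_field_mul t m hK2' hK2' hM' hM' MK MK).
- by move=> m; exact: (bsum1 m (bsum_unweight B0 BK)).
Qed.

Lemma cube_zero n t : cube (fun _ _ => 0) n t = 0.
Proof.
rewrite /cube (_ : (fun x => _) = cst 0); first by rewrite hart_cst// mul0r.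
apply/funext => x; rewrite /field (_ : syn _ x = 0) ?expr0n//.
have h0 : bsum (fun _ : int => `|0 : R|) 0 by move=> s us; rewrite big1// => *; rewrite normr0.
by have := norm_syn L x h0; rewrite mul0r normr_le0 => /eqP.
Qed.

(** Uniformity in [x] comes for free: the l^1 norm of the coefficients bounds the supremum of a
    synthesis up to the factor 2. *)
Lemma field_continuous h K t e : maj h K -> (forall n, continuous (h n)) -> 0 < e ->
  \forall t' \near t, forall x, `|field h t' x - field h t x| <= e.
Proof.
move=> hK ch e0; have [M [M0 hM MK]] := maj_bound 0 hK.
have e2 : 0 < e / 2 by rewrite divr_gt0.
have H : \forall t' \near t, bsum (fun n => `|h n t' - h n t|) (e / 2).
  apply: (@tannery R _ (nbhs t) _ (fun t' n => `|h n t' - h n t|) (fun n => 2 * M n) (2 * K)) => //.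
  - near=> t' => n; rewrite normr_ge0/= (le_trans (ler_normB _ _))//.
    by rewrite mulr_natl mulr2n lerD.
  - by apply: bsumZ => //; exact: bsum_unweight MK.
  - move=> n; apply/norm_cvg0P; rewrite -(subrr (h n t)); apply: cvgB; first exact: ch.
    exact: cvg_cst.
apply: filterS H => t' H x.
rewrite /field -synB; try exact: (maj_smb _ hK).
by have := norm_syn L x H; rewrite divfK.
Unshelve. all: end_near. Qed.

Lemma cube_continuous h K n : maj h K -> (forall n, continuous (h n)) ->
  continuous (cube h n).
Proof.
move=> hK ch t; apply/cvgrPdist_le => /= e e0.
have K0 := maj_ge0 0 hK.
(* [3 * (K * 2) ^+ 2] is the Lipschitz constant of the cube on values below [K * 2], the factor 2
   comes from [norm_cas], and the [+ 1] keeps the denominator positive when [K = 0]. *)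
pose e' := e / (2 * (3 * (K * 2) ^+ 2 + 1)).
have e'0 : 0 < e' by rewrite divr_gt0// mulr_gt0// ltr_wpDl// mulr_ge0// sqr_ge0.
have := field_continuous t hK ch e'0; apply: filterS => t' H.
have mf s : measurable_fun setT (fun x => field h s x ^+ 3).
  by apply: measurable_funX; exact: (measurable_field s hK).
have ic s : itg (fun x => field h s x ^+ 3).
  apply: (itg_bounded L_gt0 (M := (K * 2) ^+ 3)) => // x.
  by have := norm_field s x hK => hb; rewrite normrX lerXn2r// nnegrE (le_trans _ hb).
rewrite /cube -hartB//; apply: (le_trans (norm_hart L_gt0 n (M := e' * (3 * (K * 2) ^+ 2)) _ _)).
- by apply: measurable_funB; exact: mf.
- move=> x; have b1 := norm_field t x hK; have b2 := norm_field t' x hK.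
  rewrite (_ : field h t x ^+ 3 - field h t' x ^+ 3 = (field h t x - field h t' x) *
     (field h t x * field h t x + field h t x * field h t' x + field h t' x * field h t' x)); last by ring.
  rewrite normrM; apply: ler_pM => //; first by rewrite distrC.
  rewrite (_ : 3 * (K * 2) ^+ 2 = (K * 2) * (K * 2) + (K * 2) * (K * 2) + (K * 2) * (K * 2)); last by ring.
  apply: le_trans (ler_normD _ _) _; apply: lerD; last by rewrite normrM ler_pM.
  by apply: le_trans (ler_normD _ _) _; apply: lerD; rewrite normrM ler_pM.
- have : e' * (2 * (3 * (K * 2) ^+ 2 + 1)) = e.
    by rewrite /e' divfK// gt_eqF// mulr_gt0// ltr_wpDl// mulr_ge0// sqr_ge0.
  by set A := (K * 2) ^+ 2; lra.
Qed.

End cubic.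

(** * Picard iteration *)

Section picard.
Variables (R : realType) (L : R).
Hypothesis L_gt0 : 0 < L.
Local Notation freq := (freq L).
Local Notation cube := (cube L).
Implicit Types (h : int -> R -> R) (K T : R).

Definition force h n t := h n t - cube h n t.

Lemma force_continuous h K n : maj h K -> (forall n, continuous (h n)) ->
  continuous (force h n).
Proof.
move=> hK ch t; apply: cvgB; first exact: ch.
exact: (cube_continuous L_gt0 hK ch).
Qed.

Lemma maj_forceB h h' K d : maj h K -> maj h' K -> maj (fun n t => h n t - h' n t) d ->
  maj (fun n t => force h n t - force h' n t) ((1 + 192 * K ^+ 2) * d).
Proof.
move=> hK hK' hd; rewrite mulrDl mul1r.
have := majD hd (majN (maj_cubeB L_gt0 hK hK' hd)).
by congr maj; apply/funext => n; apply/funext => t; rewrite /force; ring.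
Qed.

Lemma norm_freq_ge (n : int) : n != 0 -> freq 1 <= `|freq n|.
Proof.
move=> n0; have w0 := freq1_gt0 L_gt0.
rewrite [freq n]freqE normrM (gtr0_norm w0) ler_peMr ?(ltW w0)//.
rewrite -intr_norm (_ : 1 = 1%:~R)// ler_int.
by rewrite -gtz0_ge1 normr_gt0.
Qed.

Lemma force_zero n t : force (fun _ _ => 0) n t = 0.
Proof. by rewrite /force cube_zero// subrr. Qed.

Variables (c d : int -> R) (K0 : R).
Hypothesis data_K0 : bsum (fun n => wt R n * (`|c n| + `|d n| / `|freq n|)) K0.

(** Setting the zero mode to zero encodes both the mean-zero constraint and the subtraction of the
    nonlocal term, and avoids dividing by [freq 0 = 0]. *)
Definition step T h n t :=
  if n == 0 then 0 else mode (freq n) (c n) (d n) (force h n) (clamp T t).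

Lemma step_continuous T h K n : maj h K -> (forall n, continuous (h n)) ->
  continuous (step T h n).
Proof.
move=> hK ch t; rewrite /step; case: eqVneq => [_|n0]; first exact: cst_continuous.
have cF := @force_continuous h K n hK ch.
have fn0 : freq n != 0 by rewrite freq_eq0.
have lt1 : -1 < clamp T t by apply: lt_le_trans (clamp_ge0 T t); rewrite ltrN10.
have cm := is_derive_cont (is_derive_mode (c n) (d n) fn0 cF lt1).
exact: (continuous_comp (@clamp_continuous _ T t) cm).
Qed.

Lemma maj_stepB T h h' K e : 0 <= T -> maj h K -> maj h' K ->
  (forall n, continuous (h n)) -> (forall n, continuous (h' n)) ->
  maj (fun n t => h n t - h' n t) e ->
  maj (fun n t => step T h n t - step T h' n t)
    (2 * T / freq 1 * ((1 + 192 * K ^+ 2) * e)).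
Proof.
move=> T0 hK hK' ch ch' he.
have [E [E0 hE EK]] := maj_bound 0 (maj_forceB hK hK' he).
have w0 : 0 < freq 1 := freq1_gt0 L_gt0.
have cst0 : 0 <= 2 * T / freq 1 by apply: divr_ge0; [exact: mulr_ge0|exact: ltW].
apply: (@maj_of_bound _ _ _ (fun n => 2 * T / freq 1 * E n)); last first.
  by apply: bsum_le (bsumZ cst0 EK) => n; rewrite mulrCA.
move=> n t; rewrite /step; case: eqVneq => [_|n0].
  by rewrite subrr normr0 mulr_ge0.
have cF := @force_continuous h K n hK ch; have cF' := @force_continuous h' K n hK' ch'.
apply: le_trans (norm_modeB _ _ _ cF cF' (clamp_ge0 T t) (hE n)) _.
rewrite mulrAC; apply: ler_wpM2r => //; apply: ler_pM.
- by rewrite mulr_ge0// clamp_ge0.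
- by rewrite invr_ge0.
- by rewrite ler_pM2l// clamp_le.
- by rewrite lef_pV2 ?posrE ?norm_freq_ge// (lt_le_trans w0) ?norm_freq_ge.
Qed.

(** The force of zero is zero, so this step is the free evolution of the data, of size [K0] whatever
    [T] is. *)
Lemma maj_step_zero T : maj (step T (fun _ _ => 0)) K0.
Proof.
apply: (@maj_of_bound _ _ _ (fun n => `|c n| + `|d n| / `|freq n|)) => // n t.
rewrite /step; case: eqVneq => [_|n0].
  by rewrite normr0 addr_ge0// divr_ge0.
have c0 : continuous (force (fun _ _ => 0) n).
  rewrite (_ : force _ n = cst 0); first by move=> s; exact: cst_continuous.
  by apply/funext => s; rewrite force_zero.
have h0 s : `|force (fun _ _ => 0) n s| <= 0 by rewrite force_zero normr0.
have := norm_mode (freq n) (c n) (d n) c0 (clamp_ge0 T t) h0.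
by rewrite mulr0 mul0r addr0.
Qed.

(** On the ball of radius [2 * K0] the force has Lipschitz constant [1 + 192 * (2 * K0) ^+ 2] and
    Duhamel's formula contributes [2 * T / freq 1]; this [T] makes their product [1/2]. *)
Definition lifespan := freq 1 / (4 * (1 + 192 * (2 * K0) ^+ 2)).

Let lipschitz_gt0 : 0 < 1 + 192 * (2 * K0) ^+ 2.
Proof. by apply: ltr_pwDl => //; apply: mulr_ge0 => //; exact: sqr_ge0. Qed.

Lemma lifespan_gt0 : 0 < lifespan.
Proof. by apply: divr_gt0; [exact: freq1_gt0|exact: mulr_gt0]. Qed.

Let T := lifespan.

Let T0 : 0 <= T. Proof. exact/ltW/lifespan_gt0. Qed.

Let contraction e : 2 * T / freq 1 * ((1 + 192 * (2 * K0) ^+ 2) * e) = 2^-1 * e.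
Proof.
rewrite /T /lifespan.
have /lt0r_neq0 := lipschitz_gt0; have /lt0r_neq0 := freq1_gt0 L_gt0.
by move: (1 + _ * _) (freq 1) => A w w0 A0; field; rewrite w0 A0.
Qed.

Fixpoint iterate j : int -> R -> R :=
  if j is j'.+1 then step T (iterate j') else fun _ _ => 0.

Let K0_ge0 : 0 <= K0. Proof. exact: bsum_ge0 data_K0. Qed.

(** The three claims need one another: the radius is the geometric sum of the increments, so the
    iterates stay in the ball of radius [2 * K0], where the next increment is halved. *)
Lemma iterate_spec j : [/\ maj (iterate j) (2 * K0 * (1 - 2^-1 ^+ j)),
  forall n, continuous (iterate j n) &
  maj (fun n t => iterate j.+1 n t - iterate j n t) (K0 * 2^-1 ^+ j)].
Proof.
have le2 i : 2 * K0 * (1 - 2^-1 ^+ i) <= 2 * K0.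
  by rewrite ler_piMr ?mulr_ge0// gerBl exprn_ge0.
elim: j => [|j [mj cj dj]].
  split.
  - by move=> tau s us; rewrite big1 ?expr0 ?subrr ?mulr0// => n _; rewrite normr0 mulr0.
  - by move=> n; exact: cst_continuous.
  - rewrite expr0 mulr1 /=; have := maj_step_zero T; congr maj.
    by apply/funext => n; apply/funext => t; rewrite subr0.
have mS : maj (iterate j.+1) (2 * K0 * (1 - 2^-1 ^+ j.+1)).
  have := majD mj dj.
  rewrite (_ : 2 * K0 * (1 - 2^-1 ^+ j) + K0 * 2^-1 ^+ j = 2 * K0 * (1 - 2^-1 ^+ j.+1)); last first.
    by rewrite exprS; field.
  by congr maj; apply/funext => n; apply/funext => t; rewrite addrC subrK.
have cS n : continuous (iterate j.+1 n) by exact: step_continuous mj cj.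
split => //.
have := maj_stepB T0 (maj_wider (le2 _) mS) (maj_wider (le2 _) mj) cS cj dj.
by rewrite contraction exprS mulrCA.
Qed.

Let maj_iterate j : maj (iterate j) (2 * K0).
Proof.
have [mj _ _] := iterate_spec j; apply: maj_wider mj.
by rewrite ler_piMr ?mulr_ge0// gerBl exprn_ge0.
Qed.

Let continuous_iterate j n : continuous (iterate j n).
Proof. by have [_ + _] := iterate_spec j; exact. Qed.

Lemma maj_iterateB j i :
  maj (fun n t => iterate (i + j) n t - iterate j n t) (2 * K0 * 2^-1 ^+ j).
Proof.
(* The exact geometric sum is what the induction on [i] can carry; the stated bound drops its
   negative part. *)
suff h : maj (fun n t => iterate (i + j) n t - iterate j n t)
    (2 * K0 * (2^-1 ^+ j - 2^-1 ^+ (i + j))).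
  by apply: maj_wider h; rewrite ler_wpM2l ?mulr_ge0// gerBl exprn_ge0.
elim: i => [|i ih].
  move=> tau s us; rewrite subrr mulr0 big1// => n _.
  by rewrite add0n subrr normr0 mulr0.
have [_ _ di] := iterate_spec (i + j); have := majD ih di.
rewrite (_ : 2 * K0 * (2^-1 ^+ j - 2^-1 ^+ (i + j)) + K0 * 2^-1 ^+ (i + j) =
  2 * K0 * (2^-1 ^+ j - 2^-1 ^+ (i.+1 + j))); last by rewrite addSn exprS; field.
by congr maj; apply/funext => n; apply/funext => t; rewrite addSn; ring.
Qed.

Definition solution n t := limn (fun j => iterate j n t).

Lemma iterate_cvg n t : iterate j n t @[j --> \oo] --> solution n t.
Proof.
have E : (fun j => iterate j n t) = series (fun j => iterate j.+1 n t - iterate j n t).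
  apply/funext => j; rewrite /series /=; elim: j => [|j ih]; first by rewrite big_geq.
  by rewrite big_nat_recr//= -ih addrC subrK.
rewrite /solution E; apply: (@bounded_series_cvg _ _ (2 * K0)) => N.
apply: le_trans (_ : \sum_(0 <= j < N) K0 * 2^-1 ^+ j <= _).
  apply: ler_sum => j _; have [_ _ dj] := iterate_spec j.
  exact: (bsum1 n (maj_at t dj)).
have -> : \sum_(0 <= j < N) K0 * 2^-1 ^+ j = 2 * K0 * (1 - 2^-1 ^+ N).
  elim: N => [|N ih]; first by rewrite big_geq// expr0 subrr mulr0.
  by rewrite big_nat_recr//= ih exprS; field.
by rewrite ler_piMr ?mulr_ge0// gerBl exprn_ge0.
Qed.

(** A bound that is uniform in [i] passes to the pointwise limit because every instance of [maj] is
    a finite sum, even though the times [tau n] differ from mode to mode. *)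
Lemma maj_solutionB j : maj (fun n t => solution n t - iterate j n t) (2 * K0 * 2^-1 ^+ j).
Proof.
move=> tau s us.
have cv : \sum_(n <- s) wt R n * `|iterate (i + j) n (tau n) - iterate j n (tau n)| @[i --> \oo] -->
    \sum_(n <- s) wt R n * `|solution n (tau n) - iterate j n (tau n)|.
  apply: cvg_seq_sum => n; apply: cvgMr; apply: cvg_norm; apply: cvgB; last exact: cvg_cst.
  by have := @iterate_cvg n (tau n); rewrite -(cvg_shiftn j).
by apply: cvgn_le cv _ => i; exact: maj_iterateB.
Qed.

Lemma maj_solution : maj solution (2 * K0).
Proof.
have := maj_solutionB 0; rewrite expr0 mulr1; congr maj.
by apply/funext => n; apply/funext => t; rewrite subr0.
Qed.

Let geo_cvg0 (C : R) : C * 2^-1 ^+ j @[j --> \oo] --> (0 : R).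
Proof.
rewrite -[X in _ --> X](mulr0 C); apply: cvgMr; apply: cvg_expr.
by rewrite ger0_norm// invf_lt1// ltr1n.
Qed.

Lemma solution_continuous n : continuous (solution n).
Proof.
move=> t; apply/cvgrPdist_le => /= e e0.
have e3 : 0 < e / 3 by rewrite divr_gt0.
have [j _ /(_ j (leqnn j)) /= hj] : \forall j \near \oo, `|0 - 2 * K0 * 2^-1 ^+ j| <= e / 3.
  by have /cvgrPdist_le := geo_cvg0 (2 * K0); apply.
have {}hj s : `|solution n s - iterate j n s| <= e / 3.
  apply: le_trans (bsum1 n (maj_at s (maj_solutionB j))) _.
  by apply: le_trans hj; rewrite sub0r normrN ler_norm.
have /cvgrPdist_le/(_ _ e3) := @continuous_iterate j n t.
apply: filterS => s hs.
rewrite (_ : solution n t - solution n s = (solution n t - iterate j n t) +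
  (iterate j n t - iterate j n s) - (solution n s - iterate j n s)); last by ring.
apply: le_trans (ler_normB _ _) _; rewrite (_ : e = e / 3 + e / 3 + e / 3); last by field.
apply: lerD => //; apply: le_trans (ler_normD _ _) _; exact: lerD.
Qed.

Lemma solution_fixpoint n t : solution n t = step T solution n t.
Proof.
apply/eqP; rewrite -subr_eq0 -normr_le0.
apply: (@cvgn_ge _ (fun j => 4 * K0 * 2^-1 ^+ j)); first exact: geo_cvg0.
move=> j; rewrite (_ : solution n t - step T solution n t =
  (solution n t - iterate j.+1 n t) - (step T solution n t - step T (iterate j) n t)); last first.
  by rewrite -[iterate j.+1 n t]/(step T (iterate j) n t) opprB addrA subrK.
apply: le_trans (ler_normB _ _) _.
rewrite (_ : 4 * K0 * 2^-1 ^+ j = 2 * K0 * 2^-1 ^+ j + 2 * K0 * 2^-1 ^+ j); last by ring.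
apply: lerD.
  apply: le_trans (bsum1 n (maj_at t (maj_solutionB j.+1))) _.
  by rewrite ler_wpM2l ?mulr_ge0// exprS ler_piMl ?exprn_ge0// invf_le1// ler1n.
have := maj_stepB T0 maj_solution (maj_iterate j) solution_continuous
  (@continuous_iterate j) (maj_solutionB j).
rewrite contraction => /(maj_at t) /(bsum1 n) /le_trans; apply.
by rewrite ler_piMl ?mulr_ge0 ?exprn_ge0// invf_le1// ler1n.
Qed.

End picard.

(** * Curves in Sobolev spaces *)

Lemma near_within_itv (R : realType) (F : set_system R) (FF : Filter F) (T : R) :
  \forall t \near within `[0, T[%classic F, 0 <= t < T.
Proof. by rewrite near_withinE; apply: nearW => t /=; rewrite in_itv. Qed.

Lemma wt_sqr_ge0 (R : realType) k n (a : R) : 0 <= wt R n ^+ k * a ^+ 2.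
Proof. by apply: mulr_ge0; [apply/exprn_ge0/wt_ge0|exact: sqr_ge0]. Qed.

Lemma mul_sqrB_cvg0 (R : realType) (T : Type) (F : set_system T) (FF : Filter F)
    (u : T -> R) (l C : R) : u t @[t --> F] --> l ->
  C * (u t - l) ^+ 2 @[t --> F] --> (0 : R).
Proof.
move=> ul; have h : u t - l @[t --> F] --> (0 : R).
  by rewrite -(subrr l); apply: cvgB => //; exact: cvg_cst.
have h2 : (u t - l) * (u t - l) @[t --> F] --> (0 : R).
  by rewrite -[X in _ --> X](mulr0 0); exact: cvgM.
by rewrite -[X in _ --> X](mulr0 C); apply: cvgMr.
Qed.

Lemma near_dnbhs_shift (R : realType) (t : R) (P : R -> Prop) :
  (\forall s \near t^', P s) <-> (\forall h \near (0 : R)^', P (h + t)).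
Proof.
have E := @near_shift R R (0 : R) t (fun s => s != t -> P s).
rewrite -[X in X <-> _]/(\forall s \near t, s != t -> P s) E.
rewrite -[X in _ <-> X]/(\forall h \near (0 : R), h != 0 -> P (h + t)).
have N h : (h + t != t) = (h != 0) by rewrite -subr_eq0 addrK.
split; apply: filterS => h /=; rewrite subr0; first by rewrite N.
by move=> H; rewrite N.
Qed.

(** Links [is_derive], stated with increments tending to zero, to the difference quotients between
    two times that occur in [C1_Hs]. *)
Lemma is_derive_quotientP (R : realType) (f : R -> R) (t df : R) :
  is_derive t (1 : R) f df <-> (s - t)^-1 * (f s - f t) @[s --> t^'] --> df.
Proof.
have E : ((s - t)^-1 * (f s - f t) @[s --> t^'] --> df) <->
    (h^-1 *: ((f \o shift t) (h *: (1 : R)) - f t) @[h --> (0 : R)^'] --> df).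
  have q h : h^-1 *: ((f \o shift t) (h *: (1 : R)) - f t) =
     (h + t - t)^-1 * (f (h + t) - f t).
    by rewrite addrK /= /GRing.scale/= mulr1.
  split => /cvgrPdist_lt H; apply/cvgrPdist_lt => e e0.
    have /near_dnbhs_shift := H e e0; apply: filterS => h.
    by rewrite q.
  have := H e e0 => H'; apply/near_dnbhs_shift; move: H'; apply: filterS => h.
  by rewrite q.
split.
  by move=> [dft dfE]; apply/E; rewrite -dfE; exact: dft.
move=> /E h; split; first by apply/cvg_ex; exists df.
exact/cvg_lim.
Qed.

Section curves.
Variables (R : realType) (L : R).
Hypothesis L_gt0 : 0 < L.
Local Notation itg := (itg L).
Local Notation syn := (syn L).
Implicit Types (y dy : int -> R -> R) (B : int -> R) (K T : R) (k : nat).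

Lemma Hs_per_m_syn a k K : smb a -> a 0 = 0 ->
  bsum (fun n => wt R n ^+ k * a n ^+ 2) K -> Hs_per_m L k%:R (syn a).
Proof.
move=> sa a0 aK; split; last first.
  by rewrite Rintegral_avg// -hart0 hart_syn// a0 mulr0.
split; first exact: syn_L2per.
apply: (@le_lt_trans _ _ (L * K)%:E); last exact: ltry.
apply: Hs_sqnorm_le => //; first exact: itg_syn.
by apply: bsum_le aK => n; rewrite hart_syn.
Qed.

Lemma sqrB_le (a b : R) : (a - b) ^+ 2 <= 2 * a ^+ 2 + 2 * b ^+ 2.
Proof. by have := sqr_ge0 (a + b); nra. Qed.

Lemma C0_Hs_syn y B K T k :
  (forall t, 0 <= t < T -> smb (y ^~ t)) ->
  (forall t, 0 <= t < T -> y 0 t = 0) ->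
  (forall n t, 0 <= t < T -> wt R n ^+ k * y n t ^+ 2 <= B n) -> bsum B K ->
  (forall n t, 0 <= t < T -> {for t, continuous (y n)}) ->
  C0_Hs L k%:R T (fun t => syn (y ^~ t)).
Proof.
move=> sy y0 yB BK cy t; rewrite /= in_itv/= => tT; split.
  apply: Hs_per_m_syn; [exact: sy|exact: y0|].
  by apply: bsum_le BK => n; exact: yB.
have near_in : \forall t' \near within `[0, T[%classic (nbhs t), 0 <= t' < T.
  exact: near_within_itv.
apply: Hs_norm_cvg0 => //.
  apply: filterS near_in => t' t'T; apply: itgB; apply: itg_syn => //; exact: sy.
move=> e e0.
have H : \forall t' \near within `[0, T[%classic (nbhs t),
    bsum (fun n => wt R n ^+ k * (y n t' - y n t) ^+ 2) e.
  apply: (@tannery R R _ _ (fun t' n => wt R n ^+ k * (y n t' - y n t) ^+ 2)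
    (fun n => 4 * B n) (4 * K)) => //.
  - apply: filterS near_in => t' t'T n; rewrite wt_sqr_ge0/=.
    have w0 : 0 <= wt R n ^+ k by rewrite exprn_ge0// wt_ge0.
    apply: le_trans (ler_wpM2l w0 (sqrB_le _ _)) _.
    by have := yB n t' t'T; have := yB n t tT; lra.
  - exact: bsumZ.
  - by move=> n; apply: mul_sqrB_cvg0; apply: cvg_within_filter; exact: cy.
apply: filterS2 near_in H => t' t'T; apply: bsum_le => n.
by rewrite hartB ?hart_syn//; try (by apply: sy); apply: itg_syn => //; exact: sy.
Qed.

(** A difference quotient is a value of the derivative, so a majorant of [dy] dominates all
    quotients, on either side of [t]. *)
Lemma mean_value y dy n T t t' : (forall s, 0 <= s < T -> is_derive s (1 : R) (y n) (dy n s)) ->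
  0 <= t < T -> 0 <= t' < T -> t' != t ->
  exists2 s, 0 <= s < T & (y n t' - y n t) / (t' - t) = dy n s.
Proof.
move=> dY.
wlog : t t' / t < t' => [hw tT t'T tt'|tt'' /andP[t0 tT] /andP[t'0 t'T] tt'].
  have /orP[lt|lt] := lt_total tt'; last exact: hw.
  have [s sT E] := hw t' t lt t'T tT (negbT (gt_eqF lt)).
  by exists s => //; rewrite -E -[X in X / _]opprB -[X in _ / X]opprB invrN mulrNN.
have dF s : s \in `]t, t'[ -> is_derive s (1 : R) (y n) (dy n s).
  by rewrite in_itv/= => /andP[ts st]; apply: dY; rewrite (le_trans t0 (ltW ts))/= (lt_trans st).
have cF : {within `[t, t'], continuous (y n)}.
  apply: derivable_within_continuous => s; rewrite in_itv/= => /andP[ts st].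
  have := dY s; rewrite (le_trans t0 ts) (le_lt_trans st t'T) => /(_ isT).
  by case.
have [s] := MVT tt'' dF cF; rewrite in_itv/= => /andP[ts st] E.
exists s; first by rewrite (le_trans t0 (ltW ts))/= (lt_trans st).
by rewrite E mulfK// subr_eq0.
Qed.

Lemma C1_Hs_syn y dy B K T k :
  (forall t, 0 <= t < T -> smb (y ^~ t)) -> (forall t, 0 <= t < T -> smb (dy ^~ t)) ->
  (forall t, 0 <= t < T -> y 0 t = 0) -> (forall t, 0 <= t < T -> dy 0 t = 0) ->
  (forall n t, 0 <= t < T -> wt R n ^+ k * y n t ^+ 2 <= B n) ->
  (forall n t, 0 <= t < T -> wt R n ^+ k * dy n t ^+ 2 <= B n) -> bsum B K ->
  (forall n t, 0 <= t < T -> is_derive t (1 : R) (y n) (dy n t)) ->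
  (forall n t, 0 <= t < T -> {for t, continuous (dy n)}) ->
  C1_Hs L k%:R T (fun t => syn (y ^~ t)) (fun t => syn (dy ^~ t)).
Proof.
move=> sy sdy y0 dy0 yB dyB BK dY cdy; split.
- apply: C0_Hs_syn yB BK _ => // n t tT; exact: is_derive_cont (dY n t tT).
- exact: C0_Hs_syn dyB BK _.
move=> t; rewrite /= in_itv/= => tT.
have near_in : \forall t' \near within `[0, T[%classic t^', 0 <= t' < T.
  exact: near_within_itv.
have near_neq : \forall t' \near within `[0, T[%classic t^', t' != t.
  by rewrite near_withinE; apply: filterS (nbhs_dnbhs_neq t) => t' + _.
have iu s : 0 <= s < T -> itg (syn (y ^~ s)) by move=> sT; apply: itg_syn => //; exact: sy.
have iv s : 0 <= s < T -> itg (syn (dy ^~ s)) by move=> sT; apply: itg_syn => //; exact: sdy.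
have idq t' : 0 <= t' < T -> itg (fun x => (t' - t)^-1 * (syn (y ^~ t') x - syn (y ^~ t) x)).
  by move=> t'T; apply: itgZ; apply: itgB; exact: iu.
rewrite (_ : (fun t' => Hs_norm _ _ _) = (fun t' => Hs_norm L k%:R
  (fun x => (t' - t)^-1 * (syn (y ^~ t') x - syn (y ^~ t) x) - syn (dy ^~ t) x))); last first.
  by apply/funext => t'; congr Hs_norm; apply/funext => x; rewrite mulrC.
apply: Hs_norm_cvg0 => //.
  by apply: filterS near_in => t' t'T; apply: itgB; [exact: idq|exact: iv].
move=> e e0.
pose q t' n := (t' - t)^-1 * (y n t' - y n t) - dy n t.
have H : \forall t' \near within `[0, T[%classic t^',
    bsum (fun n => wt R n ^+ k * q t' n ^+ 2) e.
  apply: (@tannery R R _ _ (fun t' n => wt R n ^+ k * q t' n ^+ 2)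
    (fun n => 4 * B n) (4 * K)) => //.
  - apply: filterS2 near_in near_neq => t' t'T t't n.
    rewrite wt_sqr_ge0/=.
    have w0 : 0 <= wt R n ^+ k by rewrite exprn_ge0// wt_ge0.
    have [s sT E] := mean_value (dY n) tT t'T t't.
    rewrite /q [_^-1 * _]mulrC E; apply: le_trans (ler_wpM2l w0 (sqrB_le _ _)) _.
    by have := dyB n s sT; have := dyB n t tT; lra.
  - exact: bsumZ.
  - move=> n; apply: mul_sqrB_cvg0; apply: cvg_within_filter.
    by have /is_derive_quotientP := dY n t tT.
apply: filterS2 near_in H => t' t'T; apply: bsum_le => n.
rewrite hartB//; [|exact: idq|exact: iv].
rewrite hartZ//; last by apply: itgB; exact: iu.
by rewrite hartB//; [|exact: iu|exact: iu]; rewrite !hart_syn//; first exact: sdy; exact: sy.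
Qed.

End curves.

(** * Decay of the coefficients of the data *)

Section existence.
Variables (R : realType) (L : R).
Hypothesis L_gt0 : 0 < L.
Variables phi0 phi1 : R -> R.
Hypotheses (phi0_H3 : Hs_per_m L 3 phi0) (phi1_H2 : Hs_per_m L 2 phi1).
Local Notation itg := (itg L).
Local Notation hart := (hart L).
Local Notation freq := (freq L).

Let c := hart phi0.
Let d := hart phi1.

Lemma Hs_per_m_itg s f : Hs_per_m L s f -> itg f.
Proof. by case=> -[/(L2per_itg L_gt0)]. Qed.

Lemma Hs_per_m_hart0 s f : Hs_per_m L s f -> hart f 0 = 0.
Proof. by case=> _; rewrite Rintegral_avg// hart0 => /eqP; rewrite mulf_eq0 gt_eqF//= => /eqP. Qed.

Lemma Hs_per_m_bsum k f : Hs_per_m L k%:R f ->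
  exists K, bsum (fun n => wt R n ^+ k * hart f n ^+ 2) K.
Proof. by move=> fH; apply: Hs_sqnorm_bsum => //; [exact: Hs_per_m_itg fH|case: fH => -[]]. Qed.

(** For [n != 0] one has [1 + n^2 <= 2 * n^2], and [freq n = freq 1 * n]: on nonzero modes [kappa]
    compares the Sobolev weight with the squared frequency. *)
Definition kappa := 2 / freq 1 ^+ 2.

Lemma kappa_ge0 : 0 <= kappa.
Proof. by rewrite divr_ge0// sqr_ge0. Qed.

Lemma wt_le_freq n : n != 0 -> wt R n <= kappa * freq n ^+ 2.
Proof.
move=> n0; have w0 := lt0r_neq0 (freq1_gt0 L_gt0).
rewrite [freq n]freqE exprMn /kappa mulrA divfK ?expf_neq0// /wt mulr_natl mulr2n lerD2r.
rewrite -[leRHS]real_normK ?num_real// -intr_norm exprn_ege1//.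
by rewrite (_ : 1 = 1%:~R)// ler_int -gtz0_ge1 normr_gt0.
Qed.

Lemma freq_le_wt n : freq n ^+ 2 <= freq 1 ^+ 2 * wt R n.
Proof. by rewrite [freq n]freqE exprMn ler_wpM2l ?sqr_ge0// lerDr. Qed.

(** [bsum_abs] applied to [wt n * c n] asks for the weight [wt n ^+ 3], the H^3 norm of [phi0];
    applied to [wt n * d n / freq n] it asks, after one weight is absorbed by [freq n ^+ 2], for the
    H^2 norm of [phi1]. *)
Lemma data_majorant : exists K0, bsum (fun n => wt R n * (`|c n| + `|d n| / `|freq n|)) K0.
Proof.
have [Kc hc] := Hs_per_m_bsum phi0_H3; have [Kd hd] := Hs_per_m_bsum phi1_H2.
have h1 : bsum (fun n => `|wt R n * c n|) (12 + Kc).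
  by apply: bsum_abs; apply: bsum_le hc => n; rewrite /c; lra.
have h2 : bsum (fun n => `|wt R n * (d n / freq n)|) (12 + kappa * Kd).
  apply: bsum_abs; apply: bsum_le (bsumZ kappa_ge0 hd) => n.
  rewrite -/(d n); have [->|n0] := eqVneq n 0.
    (* At [n = 0] the quotient is a division by zero, whose value is zero by convention. *)
    rewrite freq0 invr0 !mulr0 expr0n/= mulr0 mulr_ge0 ?kappa_ge0//.
    exact: wt_sqr_ge0.
  have f0 : 0 < freq n ^+ 2 by rewrite exprn_even_gt0//= freq_eq0.
  rewrite (_ : wt R n * _ = wt R n ^+ 2 * d n ^+ 2 * (wt R n / freq n ^+ 2)); last first.
    by field; rewrite freq_eq0.
  rewrite mulrC ler_wpM2r ?wt_sqr_ge0// ler_pdivrMr//; exact: wt_le_freq.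
exists ((12 + Kc) + (12 + kappa * Kd)); apply: bsum_le (bsumD h1 h2) => n.
by rewrite (normrM (wt R n) (c n)) (normrM (wt R n) (d n / freq n)) (normrM (d n)) normfV
  (ger0_norm (wt_ge0 R n)) -mulrDr.
Qed.

End existence.

(** * Existence *)

Section strong.
Variables (R : realType) (L : R).
Hypothesis L_gt0 : 0 < L.
Variables phi0 phi1 : R -> R.
Hypotheses (phi0_H3 : Hs_per_m L 3 phi0) (phi1_H2 : Hs_per_m L 2 phi1).
Local Notation avg := (avg L).
Local Notation itg := (itg L).
Local Notation hart := (hart L).
Local Notation syn := (syn L).
Local Notation freq := (freq L).

Let c := hart phi0.
Let d := hart phi1.
Variable K0 : R.
Hypothesis data_K0 : bsum (fun n => wt R n * (`|c n| + `|d n| / `|freq n|)) K0.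

Let h : int -> R -> R := solution L c d K0.
Let T := lifespan L K0.
Let G := force L h.

Let T_gt0 : 0 < T. Proof. by apply: lifespan_gt0. Qed.

Let maj_h : maj h (2 * K0). Proof. exact: maj_solution. Qed.

Let continuous_h n : continuous (h n). Proof. exact: solution_continuous. Qed.

Let continuous_G n : continuous (G n).
Proof. exact: (@force_continuous _ _ L_gt0 h (2 * K0)). Qed.

Let maj_G : maj G ((1 + 192 * (2 * K0) ^+ 2) * (2 * K0)).
Proof.
have m0 : maj (fun (_ : int) (_ : R) => 0 : R) (2 * K0).
  move=> tau s us; rewrite big1 => [|n _]; last by rewrite normr0 mulr0.
  by have := maj_ge0 0 maj_h.
have mB : maj (fun n t => h n t - 0) (2 * K0).
  by move: maj_h; congr maj; apply/funext => n; apply/funext => t; rewrite subr0.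
have := maj_forceB L_gt0 maj_h m0 mB; congr maj.
by apply/funext => n; apply/funext => t; rewrite force_zero// subr0.
Qed.

(** Equal to [h] on [[0, T[], but without the outer clamp, which may destroy differentiability at
    [0]; time remains clamped only inside the forcing [G]. *)
Definition coef n t := if n == 0 then 0 else mode (freq n) (c n) (d n) (G n) t.
Definition dcoef n t := if n == 0 then 0 else dmode (freq n) (c n) (d n) (G n) t.
Definition ddcoef n t :=
  if n == 0 then 0 else - freq n ^+ 2 * mode (freq n) (c n) (d n) (G n) t + G n t.

Lemma coefE n t : 0 <= t < T -> coef n t = h n t.
Proof.
move=> /andP[t0 tT]; rewrite /h solution_fixpoint// /step clamp_id//.
by rewrite t0 ltW.
Qed.

Lemma is_derive_coef n t : 0 <= t < T -> is_derive t (1 : R) (coef n) (dcoef n t).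
Proof.
move=> /andP[t0 _]; rewrite /coef /dcoef; case: eqVneq => [_|n0].
  exact: is_derive_cst.
apply: is_derive_mode => //; first by rewrite freq_eq0.
by apply: lt_le_trans t0; rewrite ltrN10.
Qed.

Lemma is_derive_dcoef n t : 0 <= t < T -> is_derive t (1 : R) (dcoef n) (ddcoef n t).
Proof.
move=> /andP[t0 _]; rewrite /dcoef /ddcoef; case: eqVneq => [_|n0].
  exact: is_derive_cst.
apply: is_derive_dmode => //; first by rewrite freq_eq0.
by apply: lt_le_trans t0; rewrite ltrN10.
Qed.

Lemma ddcoef_continuous n t : 0 <= t < T -> {for t, continuous (ddcoef n)}.
Proof.
move=> tT; rewrite /ddcoef; case: eqVneq => [_|n0]; first exact: cst_continuous.
apply: cvgD; last exact: continuous_G.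
apply: cvgMr; have := is_derive_cont (is_derive_coef n tT).
by rewrite /coef (negbTE n0).
Qed.

(** [b n] bounds both [|freq n * coef n t|] and [|dcoef n t|], and is square summable with weight
    [wt n ^+ 2]: one factor [freq n] on [c n] uses up the third weight of H^3. The second derivative
    is controlled with weight [wt n], more than L^2, so that its coefficients are absolutely
    summable and can be synthesised. *)
Lemma coef_bounds : exists B K, bsum B K /\ forall n t, 0 <= t < T ->
  [/\ wt R n ^+ 3 * coef n t ^+ 2 <= B n, wt R n ^+ 2 * dcoef n t ^+ 2 <= B n &
      wt R n * ddcoef n t ^+ 2 <= B n].
Proof.
have [E [E0 hE EK]] := maj_bound 0 maj_G.
set KE := _ * _ in EK.
have [Kc hc] := Hs_per_m_bsum L_gt0 phi0_H3; have [Kd hd] := Hs_per_m_bsum L_gt0 phi1_H2.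
pose b n := `|freq n| * `|c n| + `|d n| + 2 * T * E n.
pose beta n := wt R n ^+ 2 * b n ^+ 2 + wt R n ^+ 2 * E n ^+ 2.
have wE : bsum (fun n => wt R n ^+ 2 * E n ^+ 2) (KE ^+ 2).
  have := bsum_sqr _ EK; under eq_fun do rewrite exprMn; apply => n.
  by rewrite mulr_ge0 ?wt_ge0.
have [K hK] : exists K, bsum beta K.
  exists (3 * (freq 1 ^+ 2 * Kc + Kd + 4 * T ^+ 2 * KE ^+ 2) + KE ^+ 2).
  apply: bsumD => //.
  have w0 : 0 <= freq 1 ^+ 2 by exact: sqr_ge0.
  have T20 : 0 <= 4 * T ^+ 2 by rewrite mulr_ge0// sqr_ge0.
  have := bsumZ (ler0n _ 3) (bsumD (bsumD (bsumZ w0 hc) hd) (bsumZ T20 wE)).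
  apply: bsum_le => n; rewrite -/(c n) -/(d n).
  have bb : b n ^+ 2 <= 3 * (freq n ^+ 2 * c n ^+ 2 + d n ^+ 2 + 4 * T ^+ 2 * E n ^+ 2).
    have -> : freq n ^+ 2 * c n ^+ 2 = (`|freq n| * `|c n|) ^+ 2.
      by rewrite [RHS]exprMn !real_normK ?num_real.
    have -> : d n ^+ 2 = `|d n| ^+ 2 by rewrite real_normK ?num_real.
    have -> : 4 * T ^+ 2 * E n ^+ 2 = (2 * T * E n) ^+ 2 by ring.
    rewrite /b; move: (`|freq n| * `|c n|) (`|d n|) (2 * T * E n) => p q r.
    have := sqr_ge0 (p - q); have := sqr_ge0 (q - r); have := sqr_ge0 (p - r); nra.
  have w2 : 0 <= wt R n ^+ 2 by exact: sqr_ge0.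
  apply: le_trans (ler_wpM2l w2 bb) _.
  have c2 : wt R n ^+ 2 * (freq n ^+ 2 * c n ^+ 2) <= wt R n ^+ 2 * ((freq 1 ^+ 2 * wt R n) * c n ^+ 2).
    by rewrite ler_wpM2l// ler_wpM2r ?sqr_ge0// freq_le_wt.
  move: {w2} c2; move: (wt R n) (freq n ^+ 2) (freq 1 ^+ 2) (c n ^+ 2) (d n ^+ 2) (E n ^+ 2) (T ^+ 2).
  by move=> p q r u v x y; lra.
(* The sum of the three constants needed for [coef], [dcoef] and [ddcoef] in turn, so that a single
   majorant serves all. *)
pose Q := kappa L + 1 + 2 * (freq 1 ^+ 2 + 1).
have k0 := kappa_ge0 L.
have w0 : 0 <= freq 1 ^+ 2 by exact: sqr_ge0.
have Q0 : 0 <= Q by rewrite /Q; lra.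
exists (fun n => Q * beta n), (Q * K); split; first exact: bsumZ.
move=> n t /andP[t0 tT].
have B1 : 0 <= wt R n ^+ 2 * b n ^+ 2 := wt_sqr_ge0 2 n (b n).
have B2 : 0 <= wt R n ^+ 2 * E n ^+ 2 := wt_sqr_ge0 2 n (E n).
have be0 : 0 <= beta n by rewrite addr_ge0.
have Qbe0 : 0 <= Q * beta n by rewrite mulr_ge0.
rewrite /coef /dcoef /ddcoef; case: eqVneq => [_|n0].
  by rewrite expr0n/= !mulr0.
have f0 : 0 < `|freq n| by rewrite normr_gt0 freq_eq0.
have tb : 2 * t * E n <= 2 * T * E n by rewrite ler_wpM2r// ler_wpM2l// ltW.
have n1 : `|dmode (freq n) (c n) (d n) (G n) t| <= b n.
  by apply: le_trans (norm_dmode _ _ _ (@continuous_G n) t0 (hE n)) _; rewrite lerD2l.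
have nm : `|mode (freq n) (c n) (d n) (G n) t| * `|freq n| <= b n.
  rewrite -ler_pdivlMr//; apply: le_trans (norm_mode _ _ _ (@continuous_G n) t0 (hE n)) _.
  rewrite /b ler_pdivlMr// mulrDl [(`|c n| + _) * _]mulrDl !divfK ?gt_eqF//.
  by rewrite [`|c n| * _]mulrC lerD2l.
have b0 : 0 <= b n by exact: le_trans n1.
have wk := wt_le_freq L_gt0 n0.
have wg := wt_ge1 R n.
set m := mode _ _ _ _ _ in nm *; set m' := dmode _ _ _ _ _ in n1 *.
have nm2 : freq n ^+ 2 * m ^+ 2 <= b n ^+ 2.
  rewrite -exprMn -[leLHS]real_normK ?num_real// normrM mulrC.
  by rewrite lerXn2r// nnegrE mulr_ge0.
have n12 : m' ^+ 2 <= b n ^+ 2.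
  by rewrite -[leLHS]real_normK ?num_real// lerXn2r// nnegrE.
have w2 : 0 <= wt R n ^+ 2 by exact: sqr_ge0.
have m2 : 0 <= m ^+ 2 by exact: sqr_ge0.
have Qb (q : R) x : q <= Q -> 0 <= x -> x <= q * beta n -> x <= Q * beta n.
  by move=> qQ _ /le_trans; apply; rewrite ler_wpM2r.
split.
- apply: (Qb (kappa L)); [rewrite /Q; lra|exact: wt_sqr_ge0|].
  apply: (@le_trans _ _ (wt R n ^+ 2 * ((kappa L * freq n ^+ 2) * m ^+ 2))).
    by rewrite exprSr -mulrA ler_wpM2l// ler_wpM2r.
  rewrite -mulrA mulrCA ler_wpM2l//; apply: (@le_trans _ _ (wt R n ^+ 2 * b n ^+ 2)).
    by rewrite ler_wpM2l.
  by rewrite lerDl.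
- apply: (Qb 1); [rewrite /Q; lra|exact: wt_sqr_ge0|].
  rewrite mul1r; apply: (@le_trans _ _ (wt R n ^+ 2 * b n ^+ 2)).
    by rewrite ler_wpM2l.
  by rewrite lerDl.
- apply: (Qb (2 * (freq 1 ^+ 2 + 1))); [rewrite /Q; lra| |].
    by have := wt_sqr_ge0 1 n (- freq n ^+ 2 * m + G n t); rewrite expr1.
  have g2 : G n t ^+ 2 <= E n ^+ 2.
    by rewrite -[leLHS]real_normK ?num_real// lerXn2r ?nnegrE.
  have s1 : (- freq n ^+ 2 * m + G n t) ^+ 2 <= 2 * (freq n ^+ 2 * (freq n ^+ 2 * m ^+ 2)) + 2 * G n t ^+ 2.
    have := sqrB_le (G n t) (freq n ^+ 2 * m).
    rewrite (_ : G n t - freq n ^+ 2 * m = - freq n ^+ 2 * m + G n t); last by ring.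
    by move=> /le_trans; apply; rewrite exprMn; lra.
  have s2 : freq n ^+ 2 * (freq n ^+ 2 * m ^+ 2) <= (freq 1 ^+ 2 * wt R n) * b n ^+ 2.
    apply: ler_pM => //; [exact: sqr_ge0|by apply: mulr_ge0 => //; exact: sqr_ge0|exact: freq_le_wt].
  apply: (@le_trans _ _ (wt R n * (2 * ((freq 1 ^+ 2 * wt R n) * b n ^+ 2) + 2 * E n ^+ 2))).
    by rewrite ler_wpM2l ?wt_ge0//; lra.
  have s3 : wt R n * E n ^+ 2 <= wt R n ^+ 2 * E n ^+ 2.
    by rewrite ler_wpM2r ?sqr_ge0// expr2 ler_peMl// wt_ge0.
  rewrite /beta; have := mulr_ge0 w0 B2; lra.
Qed.

Lemma wt_le_exp k n : (0 < k)%N -> wt R n <= wt R n ^+ k.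
Proof. by move=> k0; apply: ler_eXnr => //; exact: wt_ge1. Qed.

Lemma smb_of_sqr (a B : int -> R) K k : (0 < k)%N -> bsum B K ->
  (forall n, wt R n ^+ k * a n ^+ 2 <= B n) -> smb a.
Proof.
move=> k0 BK aB; exists (12 + K); apply: bsum_abs; apply: bsum_le BK => n.
by apply: le_trans (aB n); rewrite ler_wpM2r ?sqr_ge0// wt_le_exp.
Qed.

Lemma strong_solution_syn : strong_solution L T phi0 phi1 (fun t => syn (coef ^~ t)).
Proof.
have [B [K [BK hB]]] := coef_bounds.
have s0 t : 0 <= t < T -> smb (coef ^~ t).
  by move=> tT; apply: (@smb_of_sqr _ B K 3) => // n; have [] := hB n t tT.
have s1 t : 0 <= t < T -> smb (dcoef ^~ t).
  by move=> tT; apply: (@smb_of_sqr _ B K 2) => // n; have [] := hB n t tT.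
have s2 t : 0 <= t < T -> smb (ddcoef ^~ t).
  by move=> tT; apply: (@smb_of_sqr _ B K 1) => // n; have [] := hB n t tT.
have z0 t : 0 <= t < T -> coef 0 t = 0 by [].
have z1 t : 0 <= t < T -> dcoef 0 t = 0 by [].
have z2 t : 0 <= t < T -> ddcoef 0 t = 0 by [].
have b03 n t : 0 <= t < T -> wt R n ^+ 3 * coef n t ^+ 2 <= B n.
  by move=> tT; have [] := hB n t tT.
have b12 n t : 0 <= t < T -> wt R n ^+ 2 * dcoef n t ^+ 2 <= B n.
  by move=> tT; have [] := hB n t tT.
have b02 n t : 0 <= t < T -> wt R n ^+ 2 * coef n t ^+ 2 <= B n.
  move=> tT; apply: le_trans (b03 n t tT); rewrite ler_wpM2r ?sqr_ge0//.
  by rewrite ler_weXn2l ?wt_ge1.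
have b10 n t : 0 <= t < T -> wt R n ^+ 0 * dcoef n t ^+ 2 <= B n.
  move=> tT; apply: le_trans (b12 n t tT); rewrite ler_wpM2r ?sqr_ge0//.
  by rewrite expr0 exprn_ege1// wt_ge1.
have b20 n t : 0 <= t < T -> wt R n ^+ 0 * ddcoef n t ^+ 2 <= B n.
  move=> tT; have [_ _] := hB n t tT; apply: le_trans.
  by rewrite ler_wpM2r ?sqr_ge0// expr0 wt_ge1.
have c0 n t (tT : 0 <= t < T) : {for t, continuous (coef n)} := is_derive_cont (is_derive_coef n tT).
have c1 n t (tT : 0 <= t < T) : {for t, continuous (dcoef n)} := is_derive_cont (is_derive_dcoef n tT).
exists (fun t => syn (dcoef ^~ t)), (fun t => syn (ddcoef ^~ t)); split.
- split; first exact: (C0_Hs_syn L_gt0 s0 z0 b03 BK c0).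
  exact: (C0_Hs_syn L_gt0 s1 z1 b12 BK c1).
- split; first exact: (C1_Hs_syn L_gt0 s0 s1 z0 z1 b02 b12 BK is_derive_coef c1).
  exact: (C1_Hs_syn L_gt0 s1 s2 z1 z2 b10 b20 BK is_derive_dcoef ddcoef_continuous).
- move=> t; rewrite /= in_itv/= => /andP[t0 tT].
  have tT' : 0 <= t < T by rewrite ltW.
  have sG : smb (G ^~ t) by exact: maj_smb maj_G.
  have sxx : smb (fun n => - freq n ^+ 2 * coef n t).
    (* Summability of the second space derivative is read off from the equation: its coefficients
       are [ddcoef] minus the force. *)
    case: (s2 t tT') => K1 h1; case: sG => K2 h2; exists (K1 + K2).
    apply: bsum_le (bsumD h1 h2) => n; rewrite /coef /ddcoef.
    case: eqVneq => [_|n0]; first by rewrite mulr0 normr0 add0r.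
    set m := - freq n ^+ 2 * _; rewrite -[m in leLHS](addrK (G n t)).
    exact: ler_normB.
  exists (syn (fun n => - freq n ^+ 2 * coef n t)).
    exact: weak_deriv_syn (s0 t tT') sxx.
  have fE : syn (coef ^~ t) = field L h t.
    by rewrite /field; congr syn; apply/funext => n; rewrite coefE.
  have mf : measurable_fun setT (field L h t) by exact: measurable_field maj_h.
  have icube : itg (fun x => syn (coef ^~ t) x ^+ 3).
    rewrite fE; apply: (itg_bounded L_gt0 (M := (2 * K0 * 2) ^+ 3)).
      exact: measurable_funX.
    move=> x; have hb : `|field L h t x| <= 2 * K0 * 2 by exact: norm_field maj_h.
    by rewrite normrX lerXn2r// nnegrE (le_trans _ hb).
  have i0 : itg (syn (coef ^~ t)) by apply: itg_syn => //; exact: s0.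
  have ixx : itg (syn (fun n => - freq n ^+ 2 * coef n t)) by exact: itg_syn.
  have itt : itg (syn (ddcoef ^~ t)) by apply: itg_syn => //; exact: s2.
  rewrite -/(avg (fun x => syn (coef ^~ t) x ^+ 3)); set m := avg _.
  (* The equation is verified coefficient by coefficient; injectivity of the coefficient map gives
     it almost everywhere. *)
  apply: (hart_eq0 L_gt0 (f := fun x => syn (ddcoef ^~ t) x -
    syn (fun n => - freq n ^+ 2 * coef n t) x - syn (coef ^~ t) x + syn (coef ^~ t) x ^+ 3 - m)).
    apply: itgB; last exact: itg_cst.
    by apply: itgD => //; apply: itgB => //; exact: itgB.
  move=> n; rewrite hartB//; last 2 first.
  - by apply: itgD => //; apply: itgB => //; exact: itgB.
  - exact: itg_cst.
  rewrite hartD//; last by apply: itgB => //; exact: itgB.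
  rewrite hartB//; last exact: itgB.
  rewrite hartB// !hart_syn//; [|exact: s0|exact: s2].
  rewrite (_ : hart (fun=> m) n = m * (n == 0)%:R); last exact: hart_cst.
  (* At index [0] the constant [m] cancels the mean of the cube; at every other index it has
     coefficient zero and the oscillator equation remains. *)
  rewrite /ddcoef; case: eqVneq => [->|n0].
    by rewrite z0// /m -hart0 mulr1; ring.
  rewrite mulr0 subr0 (_ : mode _ _ _ _ t = coef n t); last by rewrite /coef (negbTE n0).
  rewrite /G /force /cube -fE -coefE//; ring.
- have T0 : 0 <= (0 : R) < T by rewrite lexx.
  split; apply: hart_inj => //.
  + by apply: itg_syn => //; exact: s0.
  + exact: Hs_per_m_itg phi0_H3.
  + move=> n; rewrite hart_syn//; last exact: s0.
    rewrite /coef; case: eqVneq => [->|_]; last by rewrite mode0.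
    by rewrite (Hs_per_m_hart0 L_gt0 phi0_H3).
  + by apply: itg_syn => //; exact: s1.
  + exact: Hs_per_m_itg phi1_H2.
  + move=> n; rewrite hart_syn//; last exact: s1.
    rewrite /dcoef; case: eqVneq => [->|_]; last by rewrite dmode0.
    by rewrite (Hs_per_m_hart0 L_gt0 phi1_H2).
Qed.

End strong.

(** * Coefficients of a strong solution *)

Section locally_bounded.
Variable R : realType.

(** Compactness of the segment turns local bounds into one bound, as [Q] is monotone in the bound.
    Continuity of a curve in H^3 provides only local ones. *)
Lemma compact_bound (a b : R) (Q : R -> R -> Prop) :
  (forall t K K', K <= K' -> Q t K -> Q t K') ->
  (forall t, a <= t <= b -> exists K, \forall s \near t, a <= s <= b -> Q s K) ->
  exists K, forall t, a <= t <= b -> Q t K.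
Proof.
move=> mQ lQ.
have cab : compact (`[a, b]%classic : set R) by exact: segment_compact.
move/compact_near_coveringP : cab => /(_ R (pinfty_nbhs R) (fun i x => a <= x <= b -> Q x i) _).
case=> [t|K [_ h]].
  rewrite /= in_itv/= => /lQ[K hK].
  exists ([set s | a <= s <= b -> Q s K], [set i | K <= i]) => /=.
    by split => //; exists K; split; [exact: num_real|move=> i /ltW].
  by move=> [s i] /= [hs Ki] sab; apply: mQ Ki _; exact: hs.
by exists (K + 1) => t tab; apply: (h (K + 1)) => //; rewrite ltrDl.
Qed.

End locally_bounded.

Section mode_data.
Variables (R : realType) (L : R).
Hypothesis L_gt0 : 0 < L.
Local Notation itg := (itg L).
Local Notation hart := (hart L).

Lemma itg_L2eq (f g : R -> R) : measurable_fun setT f -> itg g -> L2eq L f g -> itg f.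
Proof.
move=> mf ig fg; apply/integrableP; split.
  by apply/measurable_EFinP; exact: itg_mfun.
have /integrableP[mg] := ig; apply: le_lt_trans.
rewrite le_eqVlt; apply/orP; left; apply/eqP.
apply: ae_eq_integral => //.
- by apply/measurable_EFinP; apply: measurableT_comp => //; exact: itg_mfun.
- by apply: measurableT_comp => //.
- by apply: (@ae_mono R _ (fun x => `[0, L]%classic x -> `|(f x)%:E|%E = `|(g x)%:E|%E) _ fg)
    => x h xD; rewrite h.
Qed.

Lemma C0_Hs_mem (s T : R) u t : C0_Hs L s T u -> 0 <= t < T -> Hs_per_m L s (u t).
Proof.
move=> cu tT; have tT' : `[0, T[%classic t by rewrite /= in_itv.
by have [] := cu t tT'.
Qed.

Lemma C0_Hs_itg (s T : R) u t : C0_Hs L s T u -> 0 <= t < T -> itg (u t).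
Proof. by move=> cu tT; apply: Hs_per_m_itg (C0_Hs_mem cu tT). Qed.

Lemma C0_Hs_hart (T : R) k u n t : C0_Hs L k%:R T u -> 0 <= t < T ->
  hart (u s) n @[s --> within `[0, T[%classic (nbhs t)] --> hart (u t) n.
Proof.
move=> cu tT; have tT' : `[0, T[%classic t by rewrite /= in_itv.
have near_in := near_within_itv (nbhs_filter t) T.
have iu s : 0 <= s < T -> itg (u s).
  exact: C0_Hs_itg cu.
have [_ /cvg0_Hs_norm H] := cu t tT'.
have {}H := H L_gt0 _ _.
apply/cvgrPdist_le => /= e e0; have e2 : 0 < e ^+ 2 by rewrite exprn_gt0.
have := H _ _ e2 => H1.
have {H1} : \forall s \near within `[0, T[%classic (nbhs t),
    bsum (fun n => wt R n ^+ k * hart (fun x => u s x - u t x) n ^+ 2) (e ^+ 2).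
  by apply: H1; apply: filterS near_in => s sT; apply: itgB; exact: iu.
apply: filterS2 near_in => s sT /(bsum1 n).
rewrite hartB ?iu// => h; rewrite distrC -(ler_pXn2r (_ : 0 < 2)%N)// ?nnegrE//; last exact: ltW.
rewrite real_normK ?num_real//; apply: le_trans h.
by rewrite ler_peMl ?sqr_ge0// exprn_ege1// wt_ge1.
Qed.

(** At interior times the filter restricted to [[0, T[] is the full punctured neighbourhood, so the
    derivative is two-sided; one coefficient is controlled by the H^k norm. *)
Lemma C1_Hs_hart (T : R) k u v n t : C1_Hs L k%:R T u v -> 0 < t < T ->
  is_derive t (1 : R) (fun s => hart (u s) n) (hart (v t) n).
Proof.
move=> [cu cv duv] /andP[t0 tT]; apply/is_derive_quotientP.
have tT' : `[0, T[%classic t by rewrite /= in_itv/= tT ltW.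
have iu s : 0 <= s < T -> itg (u s).
  exact: C0_Hs_itg cu.
have iv : itg (v t) by apply: C0_Hs_itg cv _; rewrite tT ltW.
have near_in : \forall s \near t^', 0 <= s < T.
  have : t \in `]0, T[ by rewrite in_itv/= t0 tT.
  move=> /near_in_itvoo; rewrite /dnbhs near_withinE; apply: filterS => s.
  by rewrite in_itv/= => /andP[s0 sT] _; rewrite sT ltW.
have idq s : 0 <= s < T -> itg (fun x => (s - t)^-1 * (u s x - u t x) - v t x).
  by move=> sT; apply: itgB => //; apply: itgZ; apply: itgB; apply: iu => //; rewrite tT ltW.
have H := duv t tT'.
have {}H : Hs_norm L k%:R (fun x => (s - t)^-1 * (u s x - u t x) - v t x) @[s --> t^'] --> 0%E.
  have -> : (fun s => Hs_norm L k%:R (fun x => (s - t)^-1 * (u s x - u t x) - v t x)) =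
     (fun s => Hs_norm L k%:R (fun x => (u s x - u t x) / (s - t) - v t x)).
    by apply/funext => s; congr Hs_norm; apply/funext => x; rewrite mulrC.
  apply: cvg_trans H; apply: cvg_app => P; rewrite /within /= => HP.
  by apply: filterS2 near_in HP => s sT; apply; rewrite /= in_itv.
apply/cvgrPdist_le => /= e e0; have e2 : 0 < e ^+ 2 by rewrite exprn_gt0.
have fi : \forall s \near t^', itg (fun x => (s - t)^-1 * (u s x - u t x) - v t x).
  by apply: filterS near_in => s sT; exact: idq.
have := cvg0_Hs_norm L_gt0 _ H fi e2; move=> /(_ _); apply: filterS2 near_in => s sT /(bsum1 n).
have tT2 : 0 <= t < T by rewrite tT ltW.
rewrite hartB//; last by apply: itgZ; apply: itgB; exact: iu.
rewrite hartZ//; last by apply: itgB; exact: iu.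
rewrite hartB ?iu// => h; rewrite distrC -(ler_pXn2r (_ : 0 < 2)%N)// ?nnegrE//; last exact: ltW.
rewrite real_normK ?num_real//; apply: le_trans h.
by rewrite ler_peMl ?sqr_ge0// exprn_ege1// wt_ge1.
Qed.

Lemma C0_Hs_bounded (T t1 : R) u : C0_Hs L 3 T u -> t1 < T ->
  exists M, forall t, 0 <= t <= t1 -> bsum (fun n => `|hart (u t) n|) M.
Proof.
move=> cu t1T.
pose Q t K := bsum (fun n => wt R n ^+ 3 * hart (u t) n ^+ 2) K.
have [] := @compact_bound R 0 t1 Q.
- by move=> t K K' KK'; exact: bsum_wider.
- move=> t /andP[t0 tt1].
  have tT : 0 <= t < T by rewrite t0 (le_lt_trans tt1).
  have tT' : `[0, T[%classic t by rewrite /= in_itv.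
  have [Ht lim] := cu t tT'.
  have [K hK] := Hs_per_m_bsum L_gt0 Ht.
  have iu s : 0 <= s < T -> itg (u s).
    exact: C0_Hs_itg cu.
  have near_in := near_within_itv (nbhs_filter t) T.
  have fi : \forall s \near within `[0, T[%classic (nbhs t), itg (fun x => u s x - u t x).
    by apply: filterS near_in => s sT; apply: itgB; exact: iu.
  have := cvg0_Hs_norm L_gt0 (within_filter _ (nbhs_filter t)) lim fi ltr01.
  rewrite near_withinE => H; exists (2 * 1 + 2 * K).
  apply: filterS H => s H /andP[s0 st1].
  have sT : 0 <= s < T by rewrite s0 (le_lt_trans st1).
  have {}H := H _; rewrite /= in_itv/= in H.
  apply: bsum_le (bsumD (bsumZ (ler0n _ 2) (H sT)) (bsumZ (ler0n _ 2) hK)) => n.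
  rewrite hartB ?iu//.
  have w0 : 0 <= wt R n ^+ 3 by rewrite exprn_ge0// wt_ge0.
  have := ler_wpM2l w0 (sqrB_le (hart (u s) n - hart (u t) n) (- hart (u t) n)).
  by rewrite opprK subrK; move: (wt R n ^+ 3) (hart _ _) (hart _ _) => p q r; lra.
- move=> M hM; exists (12 + M) => t tt1; apply: bsum_abs.
  apply: bsum_le (hM t tt1) => n; rewrite ler_wpM2r ?sqr_ge0//.
  by rewrite wt_le_exp.
Qed.

End mode_data.

(** * Energy estimate *)

Section energy.
(** [e] and [e1] stand for the coefficients of the difference of two solutions and of its time
    derivative, [F] for the difference of their forces. The modes are coupled only through
    [F_lip]. *)
Variables (R : realType) (t1 w A : R) (k : int -> R) (e e1 F : int -> R -> R).
Hypotheses (w_gt0 : 0 < w) (A_ge0 : 0 <= A).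
Hypothesis wk : forall n, n != 0 -> w <= `|k n|.
Hypothesis e_mean0 : forall s, 0 <= s <= t1 -> e 0 s = 0.
Hypothesis e_cont : forall n s, 0 <= s <= t1 ->
  e n r @[r --> within `[0, t1]%classic (nbhs s)] --> e n s.
Hypothesis e1_cont : forall n s, 0 <= s <= t1 ->
  e1 n r @[r --> within `[0, t1]%classic (nbhs s)] --> e1 n s.
Hypothesis e_derive : forall n s, 0 < s < t1 -> is_derive s (1 : R) (e n) (e1 n s).
Hypothesis e1_derive : forall n s, 0 < s < t1 -> n != 0 ->
  is_derive s (1 : R) (e1 n) (- k n ^+ 2 * e n s + F n s).
Hypotheses (e_init : forall n, e n 0 = 0) (e1_init : forall n, e1 n 0 = 0).
Hypothesis F_lip : forall s b, 0 <= s <= t1 ->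
  bsum (fun n => e n s ^+ 2) b -> bsum (fun n => F n s ^+ 2) (A * b).

(** Rate of the exponential weight: from [lam >= 1] and [lam >= 2 * A / w ^+ 2] follows
    [A / (w ^+ 2 * lam ^+ 2) <= 1/2], the contraction factor, whatever the length of the
    interval. *)
Let lam := 1 + 2 * A / w ^+ 2.

Let lam_ge1 : 1 <= lam.
Proof. by rewrite lerDl divr_ge0 ?sqr_ge0// mulr_ge0. Qed.

Let lam_gt0 : 0 < lam. Proof. exact: lt_le_trans lam_ge1. Qed.

Let lam_contracts : A / (w ^+ 2 * lam ^+ 2) <= 2^-1.
Proof.
have w2 : 0 < w ^+ 2 by rewrite exprn_gt0.
have l2 : 0 < lam ^+ 2 by rewrite exprn_gt0.
rewrite ler_pdivrMr ?mulr_gt0// ler_pdivlMl// -ler_pdivrMl//.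
apply: (@le_trans _ _ lam); last by rewrite expr2 ler_peMl// ltW.
by rewrite /lam mulrC lerDr.
Qed.

Let energy (S : seq int) s := \sum_(n <- S) (e1 n s ^+ 2 + k n ^+ 2 * e n s ^+ 2).

Let weighted (S : seq int) C s :=
  energy S s * expR (- (lam * s)) - C * expR (lam * s).

Let is_derive_expRM (c s : R) : is_derive s (1 : R) (fun s => expR (c * s)) (c * expR (c * s)).
Proof. by apply: is_derive_eq; rewrite /GRing.scale/=; ring. Qed.

Let is_derive_energy S s : 0 < s < t1 -> all (fun n => n != 0) S ->
  is_derive s (1 : R) (energy S) (\sum_(n <- S) 2 * e1 n s * F n s).
Proof.
move=> sT; rewrite /energy; elim: S => [|n S ih] /=.
  move=> _; rewrite big_nil (_ : (fun s => _) = cst 0); first exact: is_derive_cst.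
  by apply/funext => r; rewrite big_nil.
move=> /andP[n0 /ih dS]; rewrite big_cons.
rewrite (_ : (fun s => _) = (fun s => (e1 n s ^+ 2 + k n ^+ 2 * e n s ^+ 2) +
  \sum_(n <- S) (e1 n s ^+ 2 + k n ^+ 2 * e n s ^+ 2))); last first.
  by apply/funext => r; rewrite big_cons.
have d0 := e_derive n sT; have d1 := e1_derive sT n0.
have dd : is_derive s (1 : R) (fun s => e1 n s ^+ 2 + k n ^+ 2 * e n s ^+ 2) (2 * e1 n s * F n s).
  by apply: is_derive_eq; rewrite /GRing.scale/=; ring.
exact: is_deriveD dd dS.
Qed.

Let weighted_continuous S C s : 0 <= s <= t1 ->
  weighted S C r @[r --> within `[0, t1]%classic (nbhs s)] --> weighted S C s.
Proof.
move=> sT.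
have ce (c : R) : expR (c * r) @[r --> within `[0, t1]%classic (nbhs s)] --> expR (c * s).
  by apply: cvg_within_filter; exact: is_derive_cont (is_derive_expRM c s).
apply: cvgB; last by apply: cvgMr; exact: ce.
apply: cvgM; last first.
  rewrite -[X in _ --> expR X]mulNr.
  under eq_cvg do rewrite -mulNr.
  exact: ce.
apply: cvg_seq_sum => n.
have sq (f : R -> R) (l : R) : f r @[r --> within `[0, t1]%classic (nbhs s)] --> l ->
    f r ^+ 2 @[r --> within `[0, t1]%classic (nbhs s)] --> l ^+ 2.
  by move=> fl; rewrite expr2; under eq_cvg do rewrite expr2; exact: cvgM.
apply: cvgD; first by apply: sq; exact: e1_cont.
by apply: cvgMr; apply: sq; exact: e_cont.
Qed.

(** Only finitely many modes [S] enter, so no sum has to be differentiated termwise at infinity.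
    Young's inequality bounds the derivative of the energy by [lam] times the energy plus [lam^-1]
    times the sum of the [F n r ^+ 2]; with [F_lip] and [C = A * b / lam ^+ 2], [weighted S C] has a
    nonpositive derivative and starts at a nonpositive value. *)
Let energy_bound b S s : 0 <= b ->
  (forall s, 0 <= s <= t1 -> bsum (fun n => e n s ^+ 2) (b * expR (2 * lam * s))) ->
  0 <= s <= t1 -> uniq S -> all (fun n => n != 0) S ->
  energy S s <= A * b / lam ^+ 2 * expR (2 * lam * s).
Proof.
move=> b0 Qb /andP[s0 sT] uS S0; pose C := A * b / lam ^+ 2.
have dF r : r \in `]0, s[ -> is_derive r (1 : R) (weighted S C)
   (expR (- (lam * r)) * (\sum_(n <- S) 2 * e1 n r * F n r - lam * energy S r)
     - C * lam * expR (lam * r)).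
  rewrite in_itv/= => /andP[r0 rs].
  have dE : is_derive r (1 : R) (energy S) (\sum_(n <- S) 2 * e1 n r * F n r).
    by apply: is_derive_energy => //; rewrite r0 (lt_le_trans rs).
  have d1 : is_derive r (1 : R) (fun s => expR (- (lam * s))) (- lam * expR (- (lam * r))).
    by apply: is_derive_eq; rewrite /GRing.scale/=; ring.
  have d2 := is_derive_expRM lam r.
  by apply: (is_derive_eq (is_deriveB (is_deriveM dE d1) (is_deriveZ C d2)));
    rewrite /GRing.scale/=; ring.
have cF : {within `[0, s], continuous (weighted S C)}.
  apply/subspace_continuousP => r; rewrite /= in_itv/= => /andP[r0 rs].
  have rT : 0 <= r <= t1 by rewrite r0 (le_trans rs).
  apply: cvg_trans (@weighted_continuous S C r rT); apply: cvg_app; apply: within_subset => q.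
  by rewrite /= !in_itv/= => /andP[q0 qs]; rewrite q0 (le_trans qs).
have [->|sne] := eqVneq s 0.
  rewrite mulr0 expR0 mulr1 /energy big1 => [|n _].
    by rewrite divr_ge0 ?sqr_ge0// mulr_ge0.
  by rewrite e_init e1_init expr0n/= mulr0 addr0.
have s0' : 0 < s by rewrite lt_neqAle eq_sym sne.
have [r rs E] := MVT s0' dF cF.
have : weighted S C s - weighted S C 0 <= 0.
  rewrite E subr0; apply: mulr_le0_ge0 => //.
  move: rs; rewrite in_itv/= => /andP[r0 rs].
  have rT : 0 <= r <= t1 by rewrite (ltW r0) (le_trans (ltW rs)).
  have hF : \sum_(n <- S) F n r ^+ 2 <= A * (b * expR (2 * lam * r)).
    exact: (F_lip rT (Qb r rT)).
  have young : \sum_(n <- S) 2 * e1 n r * F n r <= lam * energy S r + lam^-1 * \sum_(n <- S) F n r ^+ 2.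
    rewrite /energy !mulr_sumr -big_split/=; apply: ler_sum => n _.
    have -> : lam * (e1 n r ^+ 2 + k n ^+ 2 * e n r ^+ 2) + lam^-1 * F n r ^+ 2 =
      2 * e1 n r * F n r + (lam^-1 * (lam * e1 n r - F n r) ^+ 2 + lam * (k n * e n r) ^+ 2).
      by field; rewrite gt_eqF.
    by rewrite lerDl addr_ge0// mulr_ge0 ?sqr_ge0 ?invr_ge0// ltW.
  have ee : expR (2 * lam * r) = expR (lam * r) * expR (lam * r).
    by rewrite -expRD; congr expR; ring.
  have ei : expR (- (lam * r)) * expR (lam * r) = 1 by rewrite -expRD addNr expR0.
  rewrite subr_le0.
  apply: (@le_trans _ _ (expR (- (lam * r)) * (lam^-1 * (A * (b * expR (2 * lam * r)))))).
    rewrite ler_wpM2l ?expR_ge0// lerBlDl; apply: le_trans young _.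
    by rewrite lerD2l ler_wpM2l// invr_ge0 ltW.
  have CE : C * lam = lam^-1 * A * b.
    by have := lt0r_neq0 lam_gt0; rewrite /C; move: lam => l l0; field; rewrite l0.
  rewrite ee CE -[leRHS]mul1r -ei; move: (expR _) (expR _) (lam^-1) => p q l.
  by rewrite le_eqVlt; apply/orP; left; apply/eqP; ring.
have W0 : weighted S C 0 <= 0.
  rewrite /weighted mulr0 oppr0 expR0 !mulr1 /energy big1 => [|n _].
    by rewrite sub0r oppr_le0 divr_ge0 ?sqr_ge0// mulr_ge0.
  by rewrite e_init e1_init expr0n/= mulr0 addr0.
rewrite subr_le0 => /le_trans /(_ W0); rewrite /weighted subr_le0 => H.
rewrite -/C (_ : expR (2 * lam * s) = expR (lam * s) * expR (lam * s)); last first.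
  by rewrite -expRD; congr expR; ring.
rewrite mulrA -ler_pdivrMr ?expR_gt0// -expRN.
exact: H.
Qed.

(** The energy controls [w ^+ 2] times the squares of the nonzero modes, and the zero mode vanishes.
    As [energy_bound] holds for every finite [S], the improved bound again concerns all modes. *)
Let halve b : 0 <= b ->
  (forall s, 0 <= s <= t1 -> bsum (fun n => e n s ^+ 2) (b * expR (2 * lam * s))) ->
  (forall s, 0 <= s <= t1 -> bsum (fun n => e n s ^+ 2) (b / 2 * expR (2 * lam * s))).
Proof.
move=> b0 Qb s sT S0 uS0.
pose S := [seq n <- S0 | n != 0].
have -> : \sum_(n <- S0) e n s ^+ 2 = \sum_(n <- S) e n s ^+ 2.
  rewrite (bigID (fun n => n != 0))/= big_filter [X in _ + X]big1 ?addr0// => n.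
  by rewrite negbK => /eqP ->; rewrite e_mean0// expr0n.
have uS : uniq S by exact: filter_uniq.
have S0' : all (fun n => n != 0) S by exact: filter_all.
have w2 : 0 < w ^+ 2 by rewrite exprn_gt0.
have hE := energy_bound b0 Qb sT uS S0'.
have : w ^+ 2 * \sum_(n <- S) e n s ^+ 2 <= energy S s.
  rewrite mulr_sumr /energy big_seq [leRHS]big_seq; apply: ler_sum => n nS.
  have n0 : n != 0 by exact: (allP S0').
  apply: (@le_trans _ _ (k n ^+ 2 * e n s ^+ 2)); last by rewrite lerDr sqr_ge0.
  rewrite ler_wpM2r ?sqr_ge0// -[leRHS]real_normK ?num_real//.
  by rewrite lerXn2r ?nnegrE ?wk// ltW.
move=> /le_trans /(_ hE); rewrite -ler_pdivlMl// => /le_trans; apply.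
rewrite mulrA ler_wpM2r ?expR_ge0//.
rewrite [leLHS](_ : _ = b * (A / (w ^+ 2 * lam ^+ 2))); last first.
  by rewrite [(w ^+ 2 * _)^-1]invfM; move: (w ^- 2) (lam ^- 2) => p q; ring.
by rewrite ler_wpM2l.
Qed.

(** Any crude l^2 bound starts the argument; halving it repeatedly drives it to zero. *)
Lemma energy_unique b0 : (forall s, 0 <= s <= t1 -> bsum (fun n => e n s ^+ 2) b0) ->
  forall n s, 0 <= s <= t1 -> e n s = 0.
Proof.
move=> Qb0 n s sT.
have b00 : 0 <= b0 by exact: bsum_ge0 (Qb0 s sT).
have Q j r : 0 <= r <= t1 -> bsum (fun n => e n r ^+ 2) (b0 * 2^-1 ^+ j * expR (2 * lam * r)).
  elim: j r => [|j ih] r rT.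
    apply: bsum_wider (Qb0 r rT); rewrite expr0 mulr1 ler_peMr// -expR0 ler_expR.
    by case/andP: rT => r0 _; rewrite mulr_ge0// mulr_ge0// ltW.
  rewrite exprSr mulrA; apply: halve => //.
  by rewrite mulr_ge0// exprn_ge0.
apply/eqP; rewrite -sqrf_eq0 eq_le sqr_ge0 andbT.
apply: (@cvgn_ge _ (fun j => b0 * expR (2 * lam * s) * 2^-1 ^+ j)) => [|j].
  rewrite -[X in _ --> X](mulr0 (b0 * expR (2 * lam * s))); apply: cvgMr; apply: cvg_expr.
  by rewrite ger0_norm// invf_lt1// ltr1n.
by rewrite mulrAC; exact: (bsum1 n (Q j s sT)).
Qed.

End energy.

(** * Uniqueness *)

Section cubic_lipschitz_l2.
Variables (R : realType) (L : R).
Hypothesis L_gt0 : 0 < L.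
Local Notation avg := (avg L).
Local Notation itg := (itg L).
Local Notation hart := (hart L).
Local Notation syn := (syn L).
Implicit Types (a b : int -> R) (M : R).

Lemma itg_syn_cube a : smb a -> itg (fun x => syn a x ^+ 3).
Proof.
move=> sa; case: (sa) => M aM.
apply: (itg_bounded L_gt0 (M := (M * 2) ^+ 3)).
  by apply: measurable_funX; exact: measurable_syn.
move=> x; have hb := norm_syn L x aM.
by rewrite normrX lerXn2r// nnegrE (le_trans _ hb).
Qed.

(** Syntheses are bounded by [M * 2], so [W] is pointwise at most [1 + 3 * (M * 2) ^+ 2] times the
    synthesis of [a - b]: the 1 is the linear term, the 3 counts the products in [f^2 + f g + g^2].
    Bessel leads from coefficients to means, Parseval back. *)
Lemma bsum_cubeB_sqr a b M K :
  bsum (fun n => `|a n|) M -> bsum (fun n => `|b n|) M ->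
  bsum (fun n => (a n - b n) ^+ 2) K ->
  bsum (fun n => (a n - b n - (hart (fun x => syn a x ^+ 3) n - hart (fun x => syn b x ^+ 3) n)) ^+ 2)
    ((1 + 3 * (M * 2) ^+ 2) ^+ 2 * K).
Proof.
move=> aM bM abK; have sa : smb a by exists M.
have sb : smb b by exists M.
have sab := smbB sa sb.
pose W x := syn a x - syn b x - (syn a x ^+ 3 - syn b x ^+ 3).
pose A : R := 1 + 3 * (M * 2) ^+ 2.
have ha x : `|syn a x| <= M * 2 := norm_syn L x aM.
have hb x : `|syn b x| <= M * 2 := norm_syn L x bM.
have ma := measurable_syn L sa; have mb := measurable_syn L sb.
have mW : measurable_fun setT W.
  by apply: measurable_funB; [exact: measurable_funB|apply: measurable_funB; exact: measurable_funX].
have WE x : `|W x| <= A * `|syn (fun n => a n - b n) x|.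
  rewrite synB// (_ : W x = (1 - (syn a x * syn a x + syn a x * syn b x + syn b x * syn b x)) *
    (syn a x - syn b x)); last by rewrite /W; ring.
  rewrite normrM ler_wpM2r//; apply: le_trans (ler_normB _ _) _.
  rewrite normr1 lerD2l (_ : 3 * (M * 2) ^+ 2 = (M * 2) * (M * 2) + (M * 2) * (M * 2) + (M * 2) * (M * 2)); last by ring.
  apply: le_trans (ler_normD _ _) _; apply: lerD; last by rewrite normrM ler_pM.
  by apply: le_trans (ler_normD _ _) _; apply: lerD; rewrite normrM ler_pM.
have [D abD] := sab.
have D0 := bsum_ge0 abD.
have A0 : 0 <= A by rewrite addr_ge0// mulr_ge0// sqr_ge0.
have LW : L2per L W.
  apply: (L2per_bounded L_gt0 (M := A * (D * 2)) mW).
    by move=> x; rewrite /W !syn_periodic.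
  move=> x; apply: le_trans (WE x) _; apply: ler_wpM2l => //; exact: norm_syn abD.
have hW n : hart W n = a n - b n - (hart (fun x => syn a x ^+ 3) n - hart (fun x => syn b x ^+ 3) n).
  have ia : itg (syn a) by exact: itg_syn.
  have ib : itg (syn b) by exact: itg_syn.
  have ia3 := itg_syn_cube sa; have ib3 := itg_syn_cube sb.
  rewrite /W hartB//; [|exact: itgB|exact: itgB].
  by rewrite !hartB// !hart_syn.
under eq_fun do rewrite -hW.
apply: bsum_wider (bessel L_gt0 LW).
apply: (@le_trans _ _ (avg (fun x => A ^+ 2 * syn (fun n => a n - b n) x ^+ 2))).
  have iS : itg (fun x => A ^+ 2 * syn (fun n => a n - b n) x ^+ 2).
    by apply: itgZ; apply: L2per_itg_sqr; exact: syn_L2per.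
  apply: le_avg => //; first exact: L2per_itg_sqr.
  move=> x; rewrite -exprMn -[leLHS]real_normK ?num_real// -[leRHS]real_normK ?num_real//.
  by rewrite lerXn2r ?nnegrE// normrM (ger0_norm A0).
rewrite avgZ//; last by apply: L2per_itg_sqr; exact: syn_L2per.
by rewrite ler_wpM2l ?sqr_ge0//; exact: avg_syn_sqr_le.
Qed.

End cubic_lipschitz_l2.

(** * Comparison of two strong solutions *)

Section uniqueness_of_strong_solutions.
Variables (R : realType) (L : R).
Hypothesis L_gt0 : 0 < L.
Local Notation avg := (avg L).
Local Notation itg := (itg L).
Local Notation hart := (hart L).
Local Notation syn := (syn L).
Local Notation freq := (freq L).
Implicit Types (phi psi : R -> R -> R).

(** The cube is taken of the synthesis of the coefficients, a representative of [phi t] that is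
    bounded everywhere, whereas [phi t] itself is determined only almost everywhere. *)
Definition cube_coef phi n t := hart (fun x => syn (hart (phi t)) x ^+ 3) n.

(** The equation is paired with [cas n]: for [n != 0] the nonlocal constant disappears, and the weak
    derivative becomes multiplication by [- freq n ^+ 2]. *)
Lemma strong_solution_modes (T : R) (phi0 phi1 : R -> R) phi : strong_solution L T phi0 phi1 phi ->
  exists phi_t, [/\ C0_Hs L 3 T phi /\ C0_Hs L 2 T phi_t,
    forall n t, 0 < t < T ->
      is_derive t (1 : R) (fun s => hart (phi s) n) (hart (phi_t t) n),
    forall n t, 0 < t < T -> n != 0 ->
      is_derive t (1 : R) (fun s => hart (phi_t s) n)
       (- freq n ^+ 2 * hart (phi t) n + (hart (phi t) n - cube_coef phi n t)) &
    L2eq L (phi 0) phi0 /\ L2eq L (phi_t 0) phi1].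
Proof.
move=> [phi_t [phi_tt [[c3 c2] [d0 d1] eqn init]]].
exists phi_t; split => //.
  by move=> n t; exact: (@C1_Hs_hart _ _ L_gt0 T 2 _ _ n t d0).
move=> n t tT n0; apply: (is_derive_eq (@C1_Hs_hart _ _ L_gt0 T 0 _ _ n t d1 tT)).
have tT' : 0 <= t < T by case/andP: tT => t0 ->; rewrite ltW.
have [|phi_xx wd] := eqn t; first by rewrite /= in_itv.
have Hphi := C0_Hs_mem c3 tT'.
have iphi : itg (phi t) := C0_Hs_itg L_gt0 c3 tT'.
have itt : itg (phi_tt t).
  by case: d1 => _ c0 _; exact: (C0_Hs_itg L_gt0 c0 tT').
have ixx : itg phi_xx by apply: L2per_itg => //; case: wd.
have sphi : smb (hart (phi t)).
  by have [K hK] := Hs_per_m_bsum (k := 3) L_gt0 Hphi; exact: (smb_of_sqr (k := 3) _ hK).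
have phiE : L2eq L (phi t) (syn (hart (phi t))).
  by apply: hart_inj => //; [exact: itg_syn|move=> m; rewrite hart_syn].
have cubeE : L2eq L (fun x => phi t x ^+ 3) (fun x => syn (hart (phi t)) x ^+ 3).
  by apply: L2eqW phiE => x ->.
have mphi : measurable_fun setT (phi t) by case: Hphi => -[[]].
have icube : itg (fun x => phi t x ^+ 3).
  by apply: itg_L2eq cubeE; [exact: measurable_funX|exact: itg_syn_cube].
rewrite -/(avg (fun x => phi t x ^+ 3)); set m := avg _ => E.
have i1 : itg (fun x => phi_tt t x - phi_xx x - phi t x) by apply: itgB => //; exact: itgB.
have i2 : itg (fun x => phi_tt t x - phi_xx x - phi t x + phi t x ^+ 3) by exact: itgD.
have := @L2eq_hart _ _ _ _ n (itgB i2 (itg_cst L_gt0 m)) (itg_cst L_gt0 0) E.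
rewrite [RHS]hart_cst// mul0r hartB//; last exact: itg_cst.
rewrite hartD// hartB//; last exact: itgB.
rewrite hartB// (hart_weak_deriv L_gt0 n iphi wd).
rewrite (_ : hart (cst m) n = 0); last by rewrite hart_cst// (negbTE n0) mulr0.
rewrite (L2eq_hart n icube (itg_syn_cube L_gt0 sphi) cubeE) -/(cube_coef phi n t).
by move: (hart _ _) (hart _ _) (cube_coef _ _ _) (freq n ^+ 2) => p q r s; lra.
Qed.

(** On the compact interval [[0, t]] with [t < T] both solutions have uniform l^1 bounds, hence a
    common Lipschitz constant for the cube. [T] is arbitrary, with no smallness condition. *)
Lemma strong_solution_unique (T : R) (phi0 phi1 : R -> R) phi psi t :
  Hs_per_m L 3 phi0 -> Hs_per_m L 2 phi1 ->
  strong_solution L T phi0 phi1 phi -> strong_solution L T phi0 phi1 psi ->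
  0 <= t < T -> L2eq L (psi t) (phi t).
Proof.
move=> H0 H1 Sphi Spsi /andP[t0 tT].
have [phi_t [[c3 c2] d0 d1 [init0 init1]]] := strong_solution_modes Sphi.
have [psi_t [[c3' c2'] d0' d1' [init0' init1']]] := strong_solution_modes Spsi.
have sT s : 0 <= s <= t -> 0 <= s < T by move=> /andP[-> st]; exact: le_lt_trans tT.
have sT' s : 0 < s < t -> 0 < s < T by move=> /andP[-> st]; exact: lt_trans tT.
have T0 : 0 <= (0 : R) < T by rewrite lexx (le_lt_trans t0).
have [M1 hM1] := C0_Hs_bounded L_gt0 c3 tT; have [M2 hM2] := C0_Hs_bounded L_gt0 c3' tT.
pose M := M1 + M2.
have M10 : 0 <= M1 by apply: (bsum_ge0 (hM1 0 _)); rewrite lexx.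
have M20 : 0 <= M2 by apply: (bsum_ge0 (hM2 0 _)); rewrite lexx.
have hM s : 0 <= s <= t -> bsum (fun n => `|hart (phi s) n|) M.
  by move=> /hM1; apply: bsum_wider; rewrite lerDl.
have hM' s : 0 <= s <= t -> bsum (fun n => `|hart (psi s) n|) M.
  by move=> /hM2; apply: bsum_wider; rewrite lerDr.
pose e n s := hart (phi s) n - hart (psi s) n.
pose e1 n s := hart (phi_t s) n - hart (psi_t s) n.
pose F n s := e n s - (cube_coef phi n s - cube_coef psi n s).
have wi (f : R -> R) (s l : R) : f r @[r --> within `[0, T[%classic (nbhs s)] --> l ->
    f r @[r --> within `[0, t]%classic (nbhs s)] --> l.
  apply: cvg_trans; apply: cvg_app; apply: within_subset => q.
  by rewrite /= !in_itv/= => /sT.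
suff eq n : hart (psi t) n = hart (phi t) n.
  have tT2 : 0 <= t < T by rewrite t0.
  by apply: hart_inj => //; [exact: C0_Hs_itg c3' tT2|exact: C0_Hs_itg c3 tT2].
apply/esym/eqP; rewrite -subr_eq0; apply/eqP.
have h4 s : 0 <= s <= t -> e 0 s = 0.
  move=> st; rewrite /e (Hs_per_m_hart0 L_gt0 (C0_Hs_mem c3 (sT s st))).
  by rewrite (Hs_per_m_hart0 L_gt0 (C0_Hs_mem c3' (sT s st))) subrr.
have h5 m s : 0 <= s <= t ->
    e m r @[r --> within `[0, t]%classic (nbhs s)] --> e m s.
  move=> st; apply: cvgB; apply: wi.
    exact: (@C0_Hs_hart _ _ L_gt0 T 3 phi m s c3 (sT s st)).
  exact: (@C0_Hs_hart _ _ L_gt0 T 3 psi m s c3' (sT s st)).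
have h6 m s : 0 <= s <= t ->
    e1 m r @[r --> within `[0, t]%classic (nbhs s)] --> e1 m s.
  move=> st; apply: cvgB; apply: wi.
    exact: (@C0_Hs_hart _ _ L_gt0 T 2 phi_t m s c2 (sT s st)).
  exact: (@C0_Hs_hart _ _ L_gt0 T 2 psi_t m s c2' (sT s st)).
have h7 m s : 0 < s < t -> is_derive s (1 : R) (e m) (e1 m s).
  by move=> st; exact: is_deriveB (d0 m s (sT' s st)) (d0' m s (sT' s st)).
have h8 m s : 0 < s < t -> m != 0 ->
    is_derive s (1 : R) (e1 m) (- freq m ^+ 2 * e m s + F m s).
  move=> st m0.
  apply: (is_derive_eq (is_deriveB (d1 m s (sT' s st) m0) (d1' m s (sT' s st) m0))).
  rewrite /F /e; move: (hart (phi s) m) (hart (psi s) m) (cube_coef phi m s).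
  by move: (cube_coef psi m s) (freq m) => p q r x y; ring.
have h9 m : e m 0 = 0.
  have i1 := C0_Hs_itg L_gt0 c3 T0; have i2 := C0_Hs_itg L_gt0 c3' T0.
  have i3 := Hs_per_m_itg L_gt0 H0.
  by rewrite /e (L2eq_hart m i1 i3 init0) (L2eq_hart m i2 i3 init0') subrr.
have h10 m : e1 m 0 = 0.
  have i1 := C0_Hs_itg L_gt0 c2 T0; have i2 := C0_Hs_itg L_gt0 c2' T0.
  have i3 := Hs_per_m_itg L_gt0 H1.
  by rewrite /e1 (L2eq_hart m i1 i3 init1) (L2eq_hart m i2 i3 init1') subrr.
pose A := (1 + 3 * (M * 2) ^+ 2) ^+ 2.
have h11 s b : 0 <= s <= t -> bsum (fun n => e n s ^+ 2) b ->
    bsum (fun n => F n s ^+ 2) (A * b).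
  by move=> st eb; exact: (bsum_cubeB_sqr L_gt0 (hM s st) (hM' s st) eb).
have h12 s : 0 <= s <= t -> bsum (fun n => e n s ^+ 2) ((M + M) ^+ 2).
  move=> st; have h := bsumD (hM s st) (hM' s st).
  have := bsum_sqr (fun n => addr_ge0 (normr_ge0 _) (normr_ge0 _)) h.
  apply: bsum_le => m; rewrite -[leLHS]real_normK ?num_real// lerXn2r ?nnegrE ?addr_ge0//.
  exact: ler_normB.
have A0 : 0 <= A by exact: sqr_ge0.
have tt : 0 <= t <= t by rewrite t0 lexx.
exact: (energy_unique (freq1_gt0 L_gt0) A0 (norm_freq_ge L_gt0) h4 h5 h6 h7 h8 h9 h10 h11 h12 n tt).
Qed.

End uniqueness_of_strong_solutions.

Theorem theorem1p2 (R : realType) (L : R) (L_gt0 : 0 < L)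
    (phi0 phi1 : R -> R)
    (phi0_H3 : Hs_per_m L 3 phi0) (phi1_H2 : Hs_per_m L 2 phi1) :
  exists2 tmax : R, 0 < tmax &
    exists2 phi : R -> R -> R, strong_solution L tmax phi0 phi1 phi &
      forall psi : R -> R -> R, strong_solution L tmax phi0 phi1 psi ->
        forall t : R, 0 <= t < tmax -> L2eq L (psi t) (phi t).
Proof.
have [K0 data_K0] := data_majorant L_gt0 phi0_H3 phi1_H2.
have sol := strong_solution_syn L_gt0 phi0_H3 phi1_H2 data_K0.
exists (lifespan L K0); first exact: lifespan_gt0.
exists (fun t => syn L ((coef L phi0 phi1 K0) ^~ t)) => // psi Spsi t tT.
exact: strong_solution_unique phi0_H3 phi1_H2 sol Spsi tT.
Qed.
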